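(* The theory $\mathsf{RCA}_0+\mathsf{WKL}+$ ''the real numbers are uncountable'' is $\Pi^1_1$-conservative over $\mathsf{RCA}_0$, i.e., every $\Pi^1_1$-sentence provable in this theory is provable in $\mathsf{RCA}_0$.
   Context: $\mathsf{RCA}_0$ is the usual base system of second-order arithmetic (basic arithmetic axioms, $\Sigma^0_1$-induction, $\Delta^0_1$-comprehension). $\mathsf{WKL}$ is weak Kőnig's lemma: every infinite subtree of $2^{<\omega}$ has an infinite path. ''The real numbers are uncountable'' is the statement that for any family $(x_n)_{n\in\mathbb N}$ of reals there is a real $y$ with $x_n\neq y$ for all $n\in\mathbb N$, where the following definitions are used. A real is a Cauchy sequence $x=(x_n)_{n\in\mathbb N}$ of rationals with no rate of convergence given: for each rational $\varepsilon>0$ there is an $N\in\mathbb N$ with $|x_m-x_n|<\varepsilon$ for all $m,n\geq N$. For reals $x,y$: $x\leq y$ means that for each rational $\varepsilon>0$ there is an $N$ with $x_n\leq y_n+\varepsilon$ for all $n\geq N$; $x=y$ means $x\leq y$ and $y\leq x$. A family $(x_n)_{n\in\mathbb N}$ of reals is a double sequence $(x_{ni})_{n,i\in\mathbb N}$ of rationals with the only requirement that $x_n=(x_{ni})_{i\in\mathbb N}$ is Cauchy for each $n\in\mathbb N$ (no uniformity in $n$). *)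

(* Defs.v *)
From HB Require Import structures.
From mathcomp Require Import all_boot.

Set Implicit Arguments.
Unset Strict Implicit.
Unset Printing Implicit Defensive.

(** * The two-sorted language of second-order arithmetic

    Number variables and set variables are de Bruijn indices, counted
    separately: [fallN] binds number index 0 and [fallS] binds set index 0.
    Set variables are the only set terms, and equality is primitive for
    numbers only. *)

Inductive term : Type :=
| tvar (x : nat)
| tzero
| tone
| tadd (s t : term)
| tmul (s t : term).

Inductive form : Type :=
| fbot
| feq (s t : term)
| flt (s t : term)
| fin (t : term) (X : nat)
| fimp (A B : form)
| fallN (A : form)
| fallS (A : form).

Lemma term_comparable : comparable term.
Proof. by rewrite /comparable /decidable; decide equality; apply: eq_comparable. Qed.
HB.instance Definition _ := hasDecEq.Build term (compareP term_comparable).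

Lemma form_comparable : comparable form.
Proof. by rewrite /comparable /decidable; decide equality; apply: eq_comparable. Qed.
HB.instance Definition _ := hasDecEq.Build form (compareP form_comparable).

Definition fnot A := fimp A fbot.
Definition fand A B := fnot (fimp A (fnot B)).
Definition for_ A B := fimp (fnot A) B.
Definition fiff A B := fand (fimp A B) (fimp B A).
Definition fexN A := fnot (fallN (fnot A)).
Definition fexS A := fnot (fallS (fnot A)).

(** Simultaneous substitution of terms for number variables and of set
    variables for set variables. *)

Fixpoint tsubst (f : nat -> term) (t : term) : term :=
  match t with
  | tvar x => f x
  | tzero => tzero
  | tone => tone
  | tadd s t => tadd (tsubst f s) (tsubst f t)
  | tmul s t => tmul (tsubst f s) (tsubst f t)
  end.

Definition tshift : term -> term := tsubst (fun x => tvar x.+1).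

Definition upN (f : nat -> term) (x : nat) : term :=
  if x is y.+1 then tshift (f y) else tvar 0.

Definition upS (g : nat -> nat) (X : nat) : nat :=
  if X is Y.+1 then (g Y).+1 else 0.

Fixpoint fsubst (f : nat -> term) (g : nat -> nat) (A : form) : form :=
  match A with
  | fbot => fbot
  | feq s t => feq (tsubst f s) (tsubst f t)
  | flt s t => flt (tsubst f s) (tsubst f t)
  | fin t X => fin (tsubst f t) (g X)
  | fimp A B => fimp (fsubst f g A) (fsubst f g B)
  | fallN A => fallN (fsubst (upN f) g A)
  | fallS A => fallS (fsubst f (upS g) A)
  end.

Definition shiftN (A : form) := fsubst (fun x => tvar x.+1) id A.
Definition shiftS (A : form) := fsubst tvar S A.

(** [instN t A] and [instS Y A] instantiate index 0 and lower the others;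
    they undo the quantifiers [fallN A] and [fallS A]. *)
Definition instN (t : term) (A : form) :=
  fsubst (fun x => if x is y.+1 then tvar y else t) id A.
Definition instS (Y : nat) (A : form) :=
  fsubst tvar (fun X => if X is Z.+1 then Z else Y) A.

(** [fbound k l A]: the free number variables of [A] are below [k] and its
    free set variables are below [l]. *)

Fixpoint tbound (k : nat) (t : term) : bool :=
  match t with
  | tvar x => x < k
  | tzero | tone => true
  | tadd s t | tmul s t => tbound k s && tbound k t
  end.

Fixpoint fbound (k l : nat) (A : form) : bool :=
  match A with
  | fbot => true
  | feq s t | flt s t => tbound k s && tbound k t
  | fin t X => tbound k t && (X < l)
  | fimp A B => fbound k l A && fbound k l B
  | fallN A => fbound k.+1 l A
  | fallS A => fbound k l.+1 A
  end.

Definition sentence (A : form) : bool := fbound 0 0 A.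

Definition universal_closure (A C : form) : Prop :=
  exists k l, fbound k l A /\ C = iter k fallN (iter l fallS A).

(** * Provability: classical natural deduction with equality *)

Inductive derivable : seq form -> form -> Prop :=
| d_hyp G A : A \in G -> derivable G A
| d_impI G A B : derivable (A :: G) B -> derivable G (fimp A B)
| d_impE G A B : derivable G (fimp A B) -> derivable G A -> derivable G B
| d_raa G A : derivable (fnot A :: G) fbot -> derivable G A
| d_allNI G A : derivable (map shiftN G) A -> derivable G (fallN A)
| d_allNE G A t : derivable G (fallN A) -> derivable G (instN t A)
| d_allSI G A : derivable (map shiftS G) A -> derivable G (fallS A)
| d_allSE G A Y : derivable G (fallS A) -> derivable G (instS Y A)
| d_refl G t : derivable G (feq t t)
| d_leibniz G A s t : derivable G (feq s t) ->
    derivable G (instN s A) -> derivable G (instN t A).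

Definition theory := form -> Prop.

Definition provable (T : theory) (A : form) : Prop :=
  exists G : seq form, (forall B, B \in G -> T B) /\ derivable G A.

(** * Formula classes *)

(** The bounded universal quantifier "for all x < t" is the only primitive
    one; its bound does not contain the bound variable. "There is x < t"
    is its dual, [fnot (ball t (fnot A))]. *)
Definition ball (t : term) (A : form) :=
  fallN (fimp (flt (tvar 0) (tshift t)) A).

Inductive delta00 : form -> Prop :=
| delta00_bot : delta00 fbot
| delta00_eq s t : delta00 (feq s t)
| delta00_lt s t : delta00 (flt s t)
| delta00_in t X : delta00 (fin t X)
| delta00_imp A B : delta00 A -> delta00 B -> delta00 (fimp A B)
| delta00_ball t A : delta00 A -> delta00 (ball t A).

Definition sigma01 (A : form) : Prop := exists2 B, delta00 B & A = fexN B.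
Definition pi01 (A : form) : Prop := exists2 B, delta00 B & A = fallN B.

Fixpoint arithmetical (A : form) : bool :=
  match A with
  | fbot | feq _ _ | flt _ _ | fin _ _ => true
  | fimp A B => arithmetical A && arithmetical B
  | fallN A => arithmetical A
  | fallS _ => false
  end.

(** Any number of universal set quantifiers, possibly none, in front of an
    arithmetical formula. *)
Definition pi11 (A : form) : Prop :=
  exists l B, arithmetical B /\ A = iter l fallS B.

(** * Writing concrete sentences with named variables

    An [nterm] (resp. [fmla]) is a term (resp. formula) depending on the
    number of number quantifiers (resp. number and set quantifiers) above it.
    A variable bound below [d] quantifiers of its sort has index
    [d' - d.+1] below [d'] of them. This allows the quantifiers to be
    written with Rocq binders: [sent] turns the result into a de Bruijn
    sentence. *)

Definition nterm := nat -> term.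
Definition svar := nat -> nat.
Definition fmla := nat -> nat -> form.

Definition sent (A : fmla) : form := A 0 0.

Definition hallN (A : nterm -> fmla) : fmla := fun d e =>
  fallN (A (fun d' => tvar (d' - d.+1)) d.+1 e).
Definition hexN (A : nterm -> fmla) : fmla := fun d e =>
  fexN (A (fun d' => tvar (d' - d.+1)) d.+1 e).
Definition hallS (A : svar -> fmla) : fmla := fun d e =>
  fallS (A (fun e' => e' - e.+1) d e.+1).
Definition hexS (A : svar -> fmla) : fmla := fun d e =>
  fexS (A (fun e' => e' - e.+1) d e.+1).

Definition h0 : nterm := fun=> tzero.
Definition h1 : nterm := fun=> tone.
Definition hadd (s t : nterm) : nterm := fun d => tadd (s d) (t d).
Definition hmul (s t : nterm) : nterm := fun d => tmul (s d) (t d).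
Definition heq (s t : nterm) : fmla := fun d e => feq (s d) (t d).
Definition hlt (s t : nterm) : fmla := fun d e => flt (s d) (t d).
Definition hin (t : nterm) (X : svar) : fmla := fun d e => fin (t d) (X e).
Definition himp (A B : fmla) : fmla := fun d e => fimp (A d e) (B d e).
Definition hand (A B : fmla) : fmla := fun d e => fand (A d e) (B d e).
Definition hor (A B : fmla) : fmla := fun d e => for_ (A d e) (B d e).
Definition hiff (A B : fmla) : fmla := fun d e => fiff (A d e) (B d e).
Definition hnot (A : fmla) : fmla := fun d e => fnot (A d e).

Declare Scope hoas_scope.
Delimit Scope hoas_scope with H.
Bind Scope hoas_scope with fmla.
Bind Scope hoas_scope with nterm.

Local Notation "0" := h0 : hoas_scope.
Local Notation "1" := h1 : hoas_scope.
Local Notation "s + t" := (hadd s t) : hoas_scope.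
Local Notation "s * t" := (hmul s t) : hoas_scope.
Local Notation "s '=n' t" := (heq s t) (at level 70) : hoas_scope.
Local Notation "s < t" := (hlt s t) : hoas_scope.
Local Notation "s '<=n' t" := (hor (hlt s t) (heq s t)) (at level 70) : hoas_scope.
Local Notation "t '\inn' X" := (hin t X) (at level 70) : hoas_scope.
Local Notation "~ A" := (hnot A) : hoas_scope.
Local Notation "A /\ B" := (hand A B) : hoas_scope.
Local Notation "A \/ B" := (hor A B) : hoas_scope.
Local Notation "A <-> B" := (hiff A B) : hoas_scope.
Local Notation "A ===> B" := (himp A B) (at level 98, right associativity)
  : hoas_scope.
Local Notation "'allN' x , A" := (hallN (fun x => A))
  (at level 200, x name) : hoas_scope.
Local Notation "'exN' x , A" := (hexN (fun x => A))
  (at level 200, x name) : hoas_scope.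
Local Notation "'allS' X , A" := (hallS (fun X => A))
  (at level 200, X name) : hoas_scope.
Local Notation "'exS' X , A" := (hexS (fun X => A))
  (at level 200, X name) : hoas_scope.
Local Open Scope hoas_scope.

(** * RCA0 *)

Definition basic_axioms : seq form := map sent
  [:: allN n, ~ (n + 1 =n 0);
      allN m, allN n, (m + 1 =n n + 1 ===> m =n n);
      allN m, m + 0 =n m;
      allN m, allN n, m + (n + 1) =n (m + n) + 1;
      allN m, m * 0 =n 0;
      allN m, allN n, m * (n + 1) =n (m * n) + m;
      allN m, ~ (m < 0);
      allN m, allN n, (m < n + 1 <-> (m < n \/ m =n n)) ].

Definition succ_inst (A : form) : form :=
  fsubst (fun x => if x is _.+1 then tvar x else tadd (tvar x) tone) id A.

Definition induction_form (A : form) : form :=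
  fimp (fand (instN tzero A) (fallN (fimp A (succ_inst A)))) (fallN A).

(** The set asserted to exist has index 0; [shiftS] keeps it out of [A]. *)
Definition comprehension_form (A B : form) : form :=
  fimp (fallN (fiff A B))
       (fexS (fallN (fiff (fin (tvar 0) 0) (shiftS A)))).

Inductive RCA0 : theory :=
| RCA0_basic C : C \in basic_axioms -> RCA0 C
| RCA0_induction A C : sigma01 A ->
    universal_closure (induction_form A) C -> RCA0 C
| RCA0_comprehension A B C : sigma01 A -> pi01 B ->
    universal_closure (comprehension_form A B) C -> RCA0 C.

(** The pairing (m, n) |-> (m + n)^2 + m, injective provably in RCA0. *)
Definition hpair (m n : nterm) : nterm := (m + n) * (m + n) + m.

(** * Weak König's lemma

    The number [s] codes the finite binary string whose digits, preceded by
    a leading 1, form the binary expansion of s + 1. This is a bijection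
    between N and the finite binary strings; 0 codes the empty string. *)

Definition hempty : nterm := 0.
Definition happ0 (s : nterm) : nterm := s + s + 1.
Definition happ1 (s : nterm) : nterm := s + s + 1 + 1.

(** [p] is a power of 2: every divisor of [p] is 1 or even. *)
Definition hpow2 (p : nterm) : fmla :=
  allN d, allN c, (p =n d * c ===> (d =n 1 \/ exN b, d =n b + b)).

(** [t] is an initial segment of [s]: t + 1 arises from s + 1 by deleting
    some final binary digits. *)
Definition hinitseg (t s : nterm) : fmla :=
  exN p, exN r, (hpow2 p /\ r < p /\ s + 1 =n (t + 1) * p + r).

Definition htree (T : svar) : fmla :=
  allN s, allN t, (s \inn T /\ hinitseg t s ===> t \inn T).

Definition hinfinite (T : svar) : fmla :=
  allN k, exN s, (k < s /\ s \inn T).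

(** [G] is the graph of a function from N to N. *)
Definition hfunction (G : svar) : fmla :=
  (allN m, (m \inn G ===> exN n, exN s, m =n hpair n s)) /\
  (allN n, exN s, allN s', (hpair n s' \inn G <-> s' =n s)).

(** [G] is the function n |-> f[n] = <f(0), ..., f(n-1)>, where [f] is the
    element of 2^N given by its set of ones. *)
Definition hrestrictions (f G : svar) : fmla :=
  hfunction G /\
  hpair 0 hempty \inn G /\
  (allN n, allN s, (hpair n s \inn G ===>
     (n \inn f ===> hpair (n + 1) (happ1 s) \inn G) /\
     (~ (n \inn f) ===> hpair (n + 1) (happ0 s) \inn G))).

(** [f] is a path through [T]: all f[n] are in [T]. *)
Definition hpath (f T : svar) : fmla :=
  exS G, (hrestrictions f G /\
          allN n, allN s, (hpair n s \inn G ===> s \inn T)).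

Definition WKL : form := sent
  (allS T, (htree T /\ hinfinite T ===> exS f, hpath f T)).

(** * Rational and real numbers

    [HQ a b c] is the rational number (a - b) / (c + 1), coded by the number
    [hcode (HQ a b c)]. A rational has many codes; nothing below depends on
    which one is used. *)

Record hrat : Type := HQ { hpos : nterm; hneg : nterm; hden1 : nterm }.

Definition hcode (q : hrat) : nterm := hpair (hpair (hpos q) (hneg q)) (hden1 q).

Definition hden (q : hrat) : nterm := hden1 q + 1.

(** The last component is (hden q * hden r) - 1. *)
Definition hratD (q r : hrat) : hrat :=
  HQ (hpos q * hden r + hpos r * hden q) (hneg q * hden r + hneg r * hden q)
     (hden1 q * hden1 r + hden1 q + hden1 r).

Definition hratN (q : hrat) : hrat := HQ (hneg q) (hpos q) (hden1 q).

Definition hrat0 : hrat := HQ 0 0 0.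

Definition hratlt (q r : hrat) : fmla :=
  hpos q * hden r + hneg r * hden q < hneg q * hden r + hpos r * hden q.

Definition hratle (q r : hrat) : fmla :=
  hpos q * hden r + hneg r * hden q <=n hneg q * hden r + hpos r * hden q.

(** |q - r| < eps *)
Definition hratdist_lt (q r eps : hrat) : fmla :=
  hratlt (hratD q (hratN r)) eps /\ hratlt (hratD r (hratN q)) eps.

Definition hallQ (A : hrat -> fmla) : fmla :=
  allN a, allN b, allN c, A (HQ a b c).
Definition hexQ (A : hrat -> fmla) : fmla :=
  exN a, exN b, exN c, A (HQ a b c).

Local Notation "'allQ' q , A" := (hallQ (fun q => A))
  (at level 200, q name) : hoas_scope.
Local Notation "'exQ' q , A" := (hexQ (fun q => A))
  (at level 200, q name) : hoas_scope.

(** A sequence of rationals is given by the formula "the i-th term is q". *)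
Definition hseq := nterm -> hrat -> fmla.

Definition seq_of (X : svar) : hseq := fun i q => hpair i (hcode q) \inn X.

Definition row_of (F : svar) (n : nterm) : hseq :=
  fun i q => hpair (hpair n i) (hcode q) \inn F.

(** [X] is the graph of a function from N to Q. *)
Definition hrational_seq (X : svar) : fmla :=
  (allN m, (m \inn X ===> exN i, exQ q, m =n hpair i (hcode q))) /\
  (allN i, exQ q, allQ r, (seq_of X i r <-> hcode r =n hcode q)).

(** [F] is the graph of a function from N x N to Q. *)
Definition hrational_dblseq (F : svar) : fmla :=
  (allN m, (m \inn F ===>
     exN n, exN i, exQ q, m =n hpair (hpair n i) (hcode q))) /\
  (allN n, allN i, exQ q, allQ r, (row_of F n i r <-> hcode r =n hcode q)).

Definition hcauchy (x : hseq) : fmla :=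
  allQ eps, (hratlt hrat0 eps ===> exN N,
    allN m, allN n, (N <=n m /\ N <=n n ===>
      allQ q, allQ r, (x m q /\ x n r ===> hratdist_lt q r eps))).

Definition hrealle (x y : hseq) : fmla :=
  allQ eps, (hratlt hrat0 eps ===> exN N,
    allN n, (N <=n n ===>
      allQ q, allQ r, (x n q /\ y n r ===> hratle q (hratD r eps)))).

Definition hrealeq (x y : hseq) : fmla := hrealle x y /\ hrealle y x.

Definition hreal (X : svar) : fmla := hrational_seq X /\ hcauchy (seq_of X).

Definition hreal_family (F : svar) : fmla :=
  hrational_dblseq F /\ allN n, hcauchy (row_of F n).

Definition reals_uncountable : form := sent
  (allS F, (hreal_family F ===>
     exS Y, (hreal Y /\ allN n, ~ hrealeq (row_of F n) (seq_of Y)))).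

Local Close Scope hoas_scope.

(** RCA0 + WKL + "the real numbers are uncountable" *)
Definition RCA0_WKL_unc : theory := fun A =>
  RCA0 A \/ A = WKL \/ A = reals_uncountable.

(* Main.v *)
(** The argument is model theoretic.  If RCA0 does not prove the Pi^1_1 sentence
    [A], the completeness theorem gives a countable model (N, S) of RCA0 + ~A.
    We add sets to S, keeping N, until WKL and the uncountability of the reals
    hold; the witnesses for ~A survive, so [A] is not provable in the extended
    theory either.

    Sets are added one at a time and generically: the forcing conditions are
    certain infinite binary trees of the model, the new object [G] is a branch
    (a maximal chain of strings), and a Delta_0 statement about [G] is decided by
    a long enough string of [G].  Sigma_1 induction survives in (N, S + G)
    because, below any condition and for any Sigma_1 predicate P and any n, some
    condition either makes P(n) true or makes P(i) true for all i < m and false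
    at m, for some m.
    - A path through a tree T: the conditions are the infinite subtrees of T
      (Harrington's forcing), and m is the least number for which the strings of
      the condition not yet forcing P(m) form an infinite tree.
    - A real outside a family (x_n): the conditions are the cones of strings
      extending a given one (Cohen forcing).  Each x_n is Cauchy in the model,
      so beyond some index it stays within a small interval, and one of two
      extensions of a given string keeps its dyadic interval away from it.
    The Delta_1 definable sets over (N, S + G) form a model of RCA0 again, and
    countably many such steps, iterated omega times, treat all trees and all
    families. *)

From HB Require Import structures.
From Stdlib Require Import Ring.
From mathcomp Require Import all_boot all_order all_algebra.
From mathcomp Require Import boolp.
Require Import Defs.

Set Implicit Arguments.
Unset Strict Implicit.
Unset Printing Implicit Defensive.

(** * Substitution and Tarski semantics *)

(** The language has no exponentiation, so the forcing works with strings as numbers and never with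
    their lengths: [pow2] and the prefix relation [pre] are Delta_0, and a level of the binary tree
    is named by a power of two. Exponentiation is constructed only because the final path and the
    final real are functions of a length. The Delta_0 form is essential: whether a string forces a
    Delta_0 statement is then itself Delta_0 over the ground model, so the strings of a condition
    that do not force P(m) form a set of the model, and the finiteness of the tree they form is
    Sigma_1. This is what allows the least m to be found with the Sigma_1 induction of the ground
    model. That the Cauchy property has no modulus uniform in n does no harm. Genericity asks only
    that, for each single n, the strings keeping away from x_n be dense; these dense sets are listed
    from outside, along an enumeration of the countable model, and need not be definable in it. *)

Lemma tsubst_comp f g t : tsubst f (tsubst g t) = tsubst (tsubst f \o g) t.
Proof. by elim: t => //= s -> t ->. Qed.

Lemma tsubst_id t : tsubst tvar t = t.
Proof. by elim: t => //= s -> t ->. Qed.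

Lemma upN_comp f g : tsubst (upN f) \o upN g = upN (tsubst f \o g).
Proof.
apply/funext => -[|x] //=; rewrite /tshift !tsubst_comp; congr tsubst.
Qed.

Lemma upS_comp f g : upS f \o upS g = upS (f \o g).
Proof. by apply/funext => -[|x]. Qed.

Lemma upN_id : upN tvar = tvar. Proof. by apply/funext => -[|x]. Qed.
Lemma upS_id : upS id = id. Proof. by apply/funext => -[|x]. Qed.

Lemma fsubst_comp f g f' g' A :
  fsubst f g (fsubst f' g' A) = fsubst (tsubst f \o f') (g \o g') A.
Proof.
elim: A f g f' g' => //= [s t|s t|t X|A IHA B IHB|A IHA|A IHA] f g f' g'.
- by rewrite !tsubst_comp.
- by rewrite !tsubst_comp.
- by rewrite !tsubst_comp.
- by rewrite IHA IHB.
- by rewrite IHA upN_comp.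
- by rewrite IHA upS_comp.
Qed.

Lemma fsubst_id A : fsubst tvar id A = A.
Proof.
elim: A => //= [s t|s t|t X|A -> B ->|A IHA|A IHA] //;
by rewrite ?tsubst_id // ?upN_id ?upS_id IHA.
Qed.

Lemma shiftN_subst f g A :
  fsubst (upN f) g (shiftN A) = shiftN (fsubst f g A).
Proof. by rewrite /shiftN !fsubst_comp. Qed.

Lemma shiftS_subst f g A :
  fsubst f (upS g) (shiftS A) = shiftS (fsubst f g A).
Proof.
rewrite /shiftS !fsubst_comp; congr fsubst.
by apply/funext => x /=; rewrite tsubst_id.
Qed.

Definition scons (T : Type) (x : T) (r : nat -> T) : nat -> T :=
  fun n => if n is m.+1 then r m else x.

Lemma if_scons T k (v r : nat -> T) x :
  (if x < k then v x else scons (v k) r (x - k)) =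
  if x < k.+1 then v x else r (x - k.+1).
Proof.
case: ltngtP => [xk|kx|->]; first by rewrite ltnS ltnW.
  by rewrite ltnS leqNgt kx -(subnSK kx).
by rewrite ltnSn subnn.
Qed.

Lemma instN_upN f g t A : instN t (fsubst (upN f) g A) = fsubst (scons t f) g A.
Proof.
rewrite /instN fsubst_comp; congr fsubst.
by apply/funext => -[|x] //=; rewrite /tshift tsubst_comp /comp tsubst_id.
Qed.

Lemma instS_upS f g Y A : instS Y (fsubst f (upS g) A) = fsubst f (scons Y g) A.
Proof.
rewrite /instS fsubst_comp; congr fsubst; apply/funext; last by case.
by move=> x /=; rewrite tsubst_id.
Qed.

Lemma fsubst_instN f g t A :
  fsubst f g (instN t A) = instN (tsubst f t) (fsubst (upN f) g A).
Proof.
by rewrite instN_upN /instN fsubst_comp; congr fsubst; apply/funext => -[|x].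
Qed.

Lemma fsubst_instS f g Y A :
  fsubst f g (instS Y A) = instS (g Y) (fsubst f (upS g) A).
Proof.
by rewrite instS_upS /instS fsubst_comp; congr fsubst; apply/funext => -[|x].
Qed.

Lemma derivable_subst G A : derivable G A ->
  forall f g, derivable (map (fsubst f g) G) (fsubst f g A).
Proof.
elim=> {G A} /= [G A AG|G A B _ IH|G A B _ IH1 _ IH2|G A _ IH|G A _ IH|
  G A t _ IH|G A _ IH|G A Y _ IH|G t|G A s t _ IH1 _ IH2] f g.
- by apply/d_hyp/map_f.
- exact/d_impI/IH.
- exact: d_impE (IH1 f g) (IH2 f g).
- exact/d_raa/IH.
- apply: d_allNI; have := IH (upN f) g.
  by rewrite -!map_comp (_ : _ \o _ = shiftN \o fsubst f g) //;
     apply/funext => B /=; rewrite shiftN_subst.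
- by rewrite fsubst_instN; apply/d_allNE/IH.
- apply: d_allSI; have := IH f (upS g).
  by rewrite -!map_comp (_ : _ \o _ = shiftS \o fsubst f g) //;
     apply/funext => B /=; rewrite shiftS_subst.
- by rewrite fsubst_instS; apply/d_allSE/IH.
- exact: d_refl.
- rewrite fsubst_instN; apply: d_leibniz (IH1 f g) _.
  by have := IH2 f g; rewrite fsubst_instN.
Qed.

Lemma derivable_weak G A : derivable G A ->
  forall G', {subset G <= G'} -> derivable G' A.
Proof.
have consS B (G1 G2 : seq form) :
  {subset G1 <= G2} -> {subset B :: G1 <= B :: G2}.
  by move=> sG C; rewrite !inE => /orP[->//|/sG ->]; rewrite orbT.
have mapS h (G1 G2 : seq form) :
  {subset G1 <= G2} -> {subset map h G1 <= map h G2}.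
  by move=> sG C /mapP[D /sG DG ->]; apply: map_f.
elim=> {G A} /= [G A AG|G A B _ IH|G A B _ IH1 _ IH2|G A _ IH|G A _ IH|
  G A t _ IH|G A _ IH|G A Y _ IH|G t|G A s t _ IH1 _ IH2] G' sG.
- exact/d_hyp/sG.
- exact/d_impI/IH/consS.
- exact: d_impE (IH1 _ sG) (IH2 _ sG).
- exact/d_raa/IH/consS.
- exact/d_allNI/IH/mapS.
- exact/d_allNE/IH.
- exact/d_allSI/IH/mapS.
- exact/d_allSE/IH.
- exact: d_refl.
- exact: d_leibniz (IH1 _ sG) (IH2 _ sG).
Qed.

Record arith := Arith {
  dom :> Type; az : dom; ao : dom;
  aad : dom -> dom -> dom; amu : dom -> dom -> dom; alt : dom -> dom -> Prop }.

Section Semantics.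
Variable M : arith.

Fixpoint eval (r : nat -> M) (t : term) : M :=
  match t with
  | tvar x => r x
  | tzero => az M
  | tone => ao M
  | tadd s t => aad (eval r s) (eval r t)
  | tmul s t => amu (eval r s) (eval r t)
  end.

(** Henkin semantics: only [fallS] sees the class [C], while the valuation [s] may leave it. A new
    set can therefore be put into a valuation by [scons] before it belongs to any model. *)
Fixpoint sat (C : (M -> Prop) -> Prop) (A : form) (r : nat -> M)
    (s : nat -> M -> Prop) : Prop :=
  match A with
  | fbot => False
  | feq t u => eval r t = eval r u
  | flt t u => alt (eval r t) (eval r u)
  | fin t X => s X (eval r t)
  | fimp A B => sat C A r s -> sat C B r s
  | fallN A => forall n, sat C A (scons n r) s
  | fallS A => forall P, C P -> sat C A r (scons P s)
  end.

Lemma eval_subst r f t : eval r (tsubst f t) = eval (eval r \o f) t.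
Proof. by elim: t => //= s -> t ->. Qed.

Lemma eval_upN n r f : eval (scons n r) \o upN f = scons n (eval r \o f).
Proof. by apply/funext => -[|x] //=; rewrite /tshift eval_subst. Qed.

Lemma eval_shift n r t : eval (scons n r) (tshift t) = eval r t.
Proof. exact: eval_subst. Qed.

Lemma sat_subst C f g A r s :
  sat C (fsubst f g A) r s = sat C A (eval r \o f) (s \o g).
Proof.
elim: A f g r s => //= [t u|t u|t X|A IHA B IHB|A IHA|A IHA] f g r s.
- by rewrite !eval_subst.
- by rewrite !eval_subst.
- by rewrite !eval_subst.
- by rewrite IHA IHB.
- by apply: eq_forall => n; rewrite IHA eval_upN.
- apply: eq_forall => P; rewrite IHA; congr (_ -> sat C A _ _).
  by apply/funext => -[|X].
Qed.

Lemma sat_instN C t A r s :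
  sat C (instN t A) r s = sat C A (scons (eval r t) r) s.
Proof. by rewrite sat_subst; congr sat; apply/funext => -[|x]. Qed.

Lemma sat_instS C Y A r s :
  sat C (instS Y A) r s = sat C A r (scons (s Y) s).
Proof. by rewrite sat_subst; congr sat; apply/funext => -[|x]. Qed.

Lemma soundness C G A : derivable G A -> forall r s, (forall X, C (s X)) ->
  (forall B, B \in G -> sat C B r s) -> sat C A r s.
Proof.
elim=> {G A} /= [G A AG|G A B _ IH|G A B _ IH1 _ IH2|G A _ IH|G A _ IH|
  G A t _ IH|G A _ IH|G A Y _ IH|G t|G A u t _ IH1 _ IH2] r s Cs sG.
- exact: sG.
- by move=> satA; apply: IH => // C'; rewrite inE => /orP[/eqP->//|/sG].
- exact: (IH1 r s Cs sG) (IH2 r s Cs sG).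
- apply: contrapT => nA; apply: (IH r s Cs) => B.
  by rewrite inE => /orP[/eqP->//|/sG].
- by move=> n; apply: IH => // _ /mapP[B /sG ? ->]; rewrite sat_subst.
- by rewrite sat_instN; apply: (IH r s Cs sG).
- move=> P CP; apply: IH => [[|X]//=|_ /mapP[B /sG ? ->]].
  by rewrite sat_subst.
- by rewrite sat_instS; apply: (IH r s Cs sG).
- by [].
- have := IH2 r s Cs sG; rewrite !sat_instN.
  by have /= -> := IH1 r s Cs sG.
Qed.

Lemma eval_bound k t r r' : tbound k t -> (forall x, x < k -> r x = r' x) ->
  eval r t = eval r' t.
Proof.
elim: t => //= [x|s IHs t IHt|s IHs t IHt] b e; first exact: e.
all: by case/andP: b => bs bt; rewrite IHs // IHt.
Qed.

Lemma sat_bound C k l A r r' s s' : fbound k l A ->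
  (forall x, x < k -> r x = r' x) -> (forall X, X < l -> s X = s' X) ->
  sat C A r s = sat C A r' s'.
Proof.
elim: A k l r r' s s' => //= [t u|t u|t X|A IHA B IHB|A IHA|A IHA] k l r r' s s'.
- by case/andP=> bt bu er es; rewrite (eval_bound bt er) (eval_bound bu er).
- by case/andP=> bt bu er es; rewrite (eval_bound bt er) (eval_bound bu er).
- by case/andP=> bt Xl er es; rewrite (eval_bound bt er) es.
- by case/andP=> bA bB er es; rewrite (IHA _ _ _ _ _ _ bA er es) (IHB _ _ _ _ _ _ bB er es).
- move=> bA er es; apply: eq_forall => n; apply: (IHA _ _ _ _ _ _ bA) => //.
  by move=> [|x] //= /er.
- move=> bA er es; apply: eq_forall => P; congr (_ -> _).
  by apply: (IHA _ _ _ _ _ _ bA) => // -[|x] //= /es.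
Qed.

Lemma sat_iter_fallN C k A r s : sat C (iter k fallN A) r s <->
  forall v, sat C A (fun x => if x < k then v x else r (x - k)) s.
Proof.
elim: k r => [|k IH] r /=.
  split=> [h v|/(_ r)].
    by rewrite (_ : (fun _ => _) = r) //; apply/funext => x; rewrite subn0.
  by rewrite (_ : (fun _ => _) = r) //; apply/funext => x; rewrite subn0.
split=> [h v|h n].
  have /IH/(_ v) := h (v k); congr sat; apply/funext => x.
  exact: if_scons.
apply/IH => v; have := h (fun x => if x < k then v x else n).
congr sat; apply/funext => x.
rewrite -(@if_scons _ k (fun y => if y < k then v y else n)) ltnn.
by case: ifP => // ->.
Qed.

Lemma sat_iter_fallS C l A r s : sat C (iter l fallS A) r s <->
  forall v, (forall X, X < l -> C (v X)) ->
  sat C A r (fun x => if x < l then v x else s (x - l)).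
Proof.
elim: l s => [|l IH] s /=.
  split=> [h v _|/(_ s)].
    by rewrite (_ : (fun _ => _) = s) //; apply/funext => x; rewrite subn0.
  by rewrite (_ : (fun _ => _) = s) //; [exact|apply/funext => x; rewrite subn0].
split=> [h v Cv|h P CP].
  have /IH/(_ v) := h (v l) (Cv _ (leqnn _)).
  have Cv' : forall X, X < l -> C (v X) by move=> X /ltnW; apply: Cv.
  move=> /(_ Cv'); congr sat; apply/funext => x.
  exact: if_scons.
apply/IH => v Cv; have := h (fun x => if x < l then v x else P).
have Cv' X : X < l.+1 -> C (if X < l then v X else P).
  by case: ifP => // /Cv.
move=> /(_ Cv'); congr sat; apply/funext => x.
rewrite -(@if_scons _ l (fun y => if y < l then v y else P)) ltnn.
by case: ifP => // ->.
Qed.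

Lemma sat_closure C A B r s : (forall X, C (s X)) -> universal_closure A B ->
  sat C B r s <-> (forall r' s', (forall X, C (s' X)) -> sat C A r' s').
Proof.
move=> Cs [k [l [bA ->]]]; split=> [h r' s' Cs'|h].
  move/sat_iter_fallN/(_ r')/sat_iter_fallS/(_ s' (fun X _ => Cs' X)): h.
  by rewrite (@sat_bound C k l A _ r' _ s') // => x ->.
apply/sat_iter_fallN => v; apply/sat_iter_fallS => w Cw.
by apply: h => X; case: ifP => [/Cw|].
Qed.

End Semantics.

(** * Completeness *)

(** Generic trees of numbers are countable through [pickle]. The resulting enumeration of formulas
    drives the Henkin construction, the list of forcing requirements and the list of Delta_1
    sets. *)
Fixpoint term_tree (t : term) : GenTree.tree nat :=
  match t with
  | tvar x => GenTree.Leaf x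
  | tzero => GenTree.Node 0 [::]
  | tone => GenTree.Node 1 [::]
  | tadd s t => GenTree.Node 2 [:: term_tree s; term_tree t]
  | tmul s t => GenTree.Node 3 [:: term_tree s; term_tree t]
  end.

Fixpoint tree_term (u : GenTree.tree nat) : term :=
  match u with
  | GenTree.Leaf x => tvar x
  | GenTree.Node 1 _ => tone
  | GenTree.Node 2 [:: s; t] => tadd (tree_term s) (tree_term t)
  | GenTree.Node 3 [:: s; t] => tmul (tree_term s) (tree_term t)
  | _ => tzero
  end.

Lemma term_treeK : cancel term_tree tree_term.
Proof. by elim=> //= s -> t ->. Qed.

Fixpoint form_tree (A : form) : GenTree.tree nat :=
  match A with
  | fbot => GenTree.Node 0 [::]
  | feq s t => GenTree.Node 1 [:: term_tree s; term_tree t]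
  | flt s t => GenTree.Node 2 [:: term_tree s; term_tree t]
  | fin t X => GenTree.Node 3 [:: term_tree t; GenTree.Leaf X]
  | fimp A B => GenTree.Node 4 [:: form_tree A; form_tree B]
  | fallN A => GenTree.Node 5 [:: form_tree A]
  | fallS A => GenTree.Node 6 [:: form_tree A]
  end.

Fixpoint tree_form (u : GenTree.tree nat) : form :=
  match u with
  | GenTree.Node 1 [:: s; t] => feq (tree_term s) (tree_term t)
  | GenTree.Node 2 [:: s; t] => flt (tree_term s) (tree_term t)
  | GenTree.Node 3 [:: t; GenTree.Leaf X] => fin (tree_term t) X
  | GenTree.Node 4 [:: A; B] => fimp (tree_form A) (tree_form B)
  | GenTree.Node 5 [:: A] => fallN (tree_form A)
  | GenTree.Node 6 [:: A] => fallS (tree_form A)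
  | _ => fbot
  end.

Lemma form_treeK : cancel form_tree tree_form.
Proof. by elim=> //= [s t|s t|t X|A -> B ->|A ->|A ->] //; rewrite !term_treeK. Qed.

Definition nth_term (n : nat) : term :=
  if unpickle n is Some u then tree_term u else tzero.
Definition nth_form (n : nat) : form :=
  if unpickle n is Some u then tree_form u else fbot.

Lemma nth_term_surj t : exists n, nth_term n = t.
Proof. by exists (pickle (term_tree t)); rewrite /nth_term pickleK term_treeK. Qed.
Lemma nth_form_surj A : exists n, nth_form n = A.
Proof. by exists (pickle (form_tree A)); rewrite /nth_form pickleK form_treeK. Qed.

Lemma tbound_mono k k' t : k <= k' -> tbound k t -> tbound k' t.
Proof.
move=> kk'; elim: t => //= [x xk|s IHs t IHt /andP[/IHs-> /IHt->]|
  s IHs t IHt /andP[/IHs-> /IHt->]] //; exact: leq_trans kk'.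
Qed.

Lemma fbound_mono k l k' l' A : k <= k' -> l <= l' ->
  fbound k l A -> fbound k' l' A.
Proof.
elim: A k l k' l' => //= [s t|s t|t X|A IHA B IHB|A IHA|A IHA] k l k' l' kk' ll'.
- by case/andP=> /(tbound_mono kk')-> /(tbound_mono kk')->.
- by case/andP=> /(tbound_mono kk')-> /(tbound_mono kk')->.
- by case/andP=> /(tbound_mono kk')-> /leq_trans->.
- by case/andP=> /(IHA _ _ _ _ kk' ll')-> /(IHB _ _ _ _ kk' ll')->.
- exact: IHA.
- exact: IHA.
Qed.

Lemma tbound_ex t : exists k, tbound k t.
Proof.
elim: t => /= [x|||s [k ks] t [l lt]|s [k ks] t [l lt]].
- by exists x.+1.
- by exists 0.
- by exists 0.
all: exists (maxn k l).
all: by rewrite (tbound_mono (leq_maxl k l)) // (tbound_mono (leq_maxr k l)).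
Qed.

Lemma fbound_ex A : exists k, fbound k k A.
Proof.
elim: A => /= [|s t|s t|t X|A [k kA] B [l lB]|A [k kA]|A [k kA]].
- by exists 0.
- have [[k ks] [l lt]] := (tbound_ex s, tbound_ex t); exists (maxn k l).
  by rewrite (tbound_mono (leq_maxl k l)) // (tbound_mono (leq_maxr k l)).
- have [[k ks] [l lt]] := (tbound_ex s, tbound_ex t); exists (maxn k l).
  by rewrite (tbound_mono (leq_maxl k l)) // (tbound_mono (leq_maxr k l)).
- have [k ks] := tbound_ex t; exists (maxn k X.+1).
  by rewrite (tbound_mono (leq_maxl k _)) // leq_maxr.
- exists (maxn k l); have [h1 h2] := (leq_maxl k l, leq_maxr k l).
  by rewrite (fbound_mono h1 h1) // (fbound_mono h2 h2).
- by exists k; apply: fbound_mono kA.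
- by exists k; apply: fbound_mono kA.
Qed.

Lemma fbound_ex_seq (G : seq form) : exists k, all (fbound k k) G.
Proof.
elim: G => [|A G [k kG]]; first by exists 0.
have [l lA] := fbound_ex A; exists (maxn k l) => /=.
have [h1 h2] := (leq_maxl k l, leq_maxr k l).
rewrite (fbound_mono h2 h2) //=.
by apply: sub_all kG => B; apply: fbound_mono.
Qed.

Lemma tsubst_bound k t f f' : tbound k t -> (forall x, x < k -> f x = f' x) ->
  tsubst f t = tsubst f' t.
Proof.
elim: t => //= [x|s IHs t IHt|s IHs t IHt] b e; first exact: e.
all: by case/andP: b => bs bt; rewrite IHs // IHt.
Qed.

Lemma fsubst_bound k l A f f' g g' : fbound k l A ->
  (forall x, x < k -> f x = f' x) -> (forall X, X < l -> g X = g' X) ->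
  fsubst f g A = fsubst f' g' A.
Proof.
elim: A k l f f' g g' => //= [t u|t u|t X|A IHA B IHB|A IHA|A IHA] k l f f' g g'.
- by case/andP=> bt bu er es; rewrite (tsubst_bound bt er) (tsubst_bound bu er).
- by case/andP=> bt bu er es; rewrite (tsubst_bound bt er) (tsubst_bound bu er).
- by case/andP=> bt Xl er es; rewrite (tsubst_bound bt er) es.
- by case/andP=> bA bB er es; rewrite (IHA _ _ _ _ _ _ bA er es) (IHB _ _ _ _ _ _ bB er es).
- move=> bA er es; congr fallN; apply: (IHA _ _ _ _ _ _ bA) => //.
  by move=> [|x] //= /er ->.
- move=> bA er es; congr fallS; apply: (IHA _ _ _ _ _ _ bA) => // -[|X] //= /es ->.
  by [].
Qed.

Section Henkin.
Variable T : theory.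
Hypothesis T_sentence : forall B, T B -> sentence B.

(** All members of [T] are sentences, so a variable that is fresh for the finite list [G] is fresh
    for every hypothesis in use. *)
Definition thd (G : seq form) (A : form) : Prop :=
  exists2 G0, (forall B, B \in G0 -> T B) & derivable (G0 ++ G) A.

Lemma thd_weak G G' A : {subset G <= G'} -> thd G A -> thd G' A.
Proof.
move=> sG [G0 TG0 dA]; exists G0 => //; apply: (derivable_weak dA) => B.
by rewrite !mem_cat => /orP[->//|/sG ->]; rewrite orbT.
Qed.

Lemma thd_hyp G A : A \in G -> thd G A.
Proof. by move=> AG; exists [::] => //; apply: d_hyp. Qed.

Lemma thd_T G A : T A -> thd G A.
Proof.
move=> TA; exists [:: A] => [B|]; first by rewrite inE => /eqP->.
by apply: d_hyp; rewrite inE eqxx.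
Qed.

Lemma thd_impI G A B : thd (A :: G) B -> thd G (fimp A B).
Proof.
move=> [G0 TG0 dA]; exists G0 => //; apply: d_impI.
by apply: (derivable_weak dA) => C; rewrite !(inE, mem_cat) orbCA.
Qed.

Lemma thd_raa G A : thd (fnot A :: G) fbot -> thd G A.
Proof.
move=> [G0 TG0 dA]; exists G0 => //; apply: d_raa.
by apply: (derivable_weak dA) => C; rewrite !(inE, mem_cat) orbCA.
Qed.

Lemma thd2 G A B C :
  (forall G, derivable G A -> derivable G B -> derivable G C) ->
  thd G A -> thd G B -> thd G C.
Proof.
move=> r [G1 TG1 dA] [G2 TG2 dB]; exists (G1 ++ G2) => [D|].
  by rewrite mem_cat => /orP[/TG1|/TG2].
apply: r.
  by apply: (derivable_weak dA) => D; rewrite !mem_cat => /orP[]->; rewrite ?orbT.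
by apply: (derivable_weak dB) => D; rewrite !mem_cat => /orP[]->; rewrite ?orbT.
Qed.

Lemma thd_impE G A B : thd G (fimp A B) -> thd G A -> thd G B.
Proof. by apply: thd2 => G' h1 h2; apply: d_impE h1 h2. Qed.

Lemma fresh_map f g G0 G k l : (forall B, B \in G0 -> T B) ->
  all (fbound k l) G -> forall f' g',
  (forall x, x < k -> f x = f' x) -> (forall X, X < l -> g X = g' X) ->
  map (fsubst f g) (G0 ++ G) = map (fsubst f' g') (G0 ++ G).
Proof.
move=> TG0 bG f' g' ef eg; apply/eq_in_map => B.
rewrite mem_cat => /orP[/TG0/T_sentence b|/(allP bG) b].
  by exact: (fsubst_bound b).
by exact: (fsubst_bound b).
Qed.

(** The renaming that sends [x] to index 0 and any other [y] to [y + 1] acts on the hypotheses as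
    [shiftN], because [x] is not free in them, and turns [instN (tvar x) C] back into [C]. *)
Lemma thd_freshN G C x l : all (fbound x l) G -> fbound x l (fallN C) ->
  thd G (instN (tvar x) C) -> thd G (fallN C).
Proof.
move=> bG bC [G0 TG0 dC]; exists G0 => //; apply: d_allNI.
have := derivable_subst dC (fun y => tvar (if y == x then 0 else y.+1)) id.
rewrite (fresh_map TG0 bG (f' := fun x => tvar x.+1) (g' := id)) //; last first.
  by move=> y yx; rewrite ltn_eqF.
rewrite [fsubst _ _ (instN _ _)](_ : _ = C) //.
rewrite fsubst_instN instN_upN.
rewrite (@fsubst_bound x.+1 l C _ tvar _ id bC) ?fsubst_id //.
by case=> [|y] /=; rewrite ?eqxx // ltnS => yx; rewrite ltn_eqF.
Qed.

Lemma thd_freshS G C X k : all (fbound k X) G -> fbound k X (fallS C) ->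
  thd G (instS X C) -> thd G (fallS C).
Proof.
move=> bG bC [G0 TG0 dC]; exists G0 => //; apply: d_allSI.
have := derivable_subst dC tvar (fun y => if y == X then 0 else y.+1).
rewrite (fresh_map TG0 bG (f' := tvar) (g' := S)) //; last first.
  by move=> y yx; rewrite ltn_eqF.
rewrite [fsubst _ _ (instS _ _)](_ : _ = C) //.
rewrite fsubst_instS instS_upS.
rewrite (@fsubst_bound k X.+1 C _ tvar _ id bC) ?fsubst_id //.
by case=> [|y] /=; rewrite ?eqxx // ltnS => yx; rewrite ltn_eqF.
Qed.

Definition consistent G := ~ thd G fbot.

Lemma consistent_not G A : ~ thd G A -> consistent (fnot A :: G).
Proof. by move=> nA /thd_raa. Qed.

(** Consistency stands inside the existential so that choice yields a total step function. Fresh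
    variables serve as Henkin witnesses, so the language needs no new constants. *)
Lemma henkin_step G B : exists G', consistent G ->
  [/\ consistent G', {subset G <= G'} &
   B \in G' \/ [/\ fnot B \in G',
     forall C, B = fallN C -> exists x, fnot (instN (tvar x) C) \in G' &
     forall C, B = fallS C -> exists X, fnot (instS X C) \in G']].
Proof.
have sub1 (D : form) G1 : {subset G1 <= D :: G1}.
  by move=> E; rewrite inE orbC => ->.
have [cB|ncB] := pselect (consistent (B :: G)).
  by exists (B :: G) => cG; split=> //; left; rewrite inE eqxx.
have nB : thd G (fnot B) by apply: thd_impI; apply: contrapT.
have [cG|ncG] := pselect (consistent G); last by exists [::].
have cnB : consistent (fnot B :: G).
  by move=> /thd_impI h; apply/cG/(thd_impE h nB).
have [k /= /andP[bB bG]] := fbound_ex_seq (B :: G).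
have bnG : all (fbound k k) (fnot B :: G) by rewrite /= bB.
have in1 (D : form) G1 : D \in D :: G1 by rewrite inE eqxx.
clear ncB nB.
case: B cnB bB bnG => [|s t|s t|t X|D E|C|C] cnB bB bnG;
  try by eexists => _; split; [exact: cnB|exact: sub1|right; split].
- exists [:: fnot (instN (tvar k) C), fnot (fallN C) & G] => _; split.
  + apply: consistent_not => h0. have h := thd_freshN bnG bB h0.
    by apply/cnB/(thd_impE (thd_hyp (in1 _ _)) h).
  + by move=> D /sub1/sub1.
  + right; split=> // [|_ [<-]]; first by rewrite sub1.
    by exists k.
- exists [:: fnot (instS k C), fnot (fallS C) & G] => _; split.
  + apply: consistent_not => h0. have h := thd_freshS bnG bB h0.
    by apply/cnB/(thd_impE (thd_hyp (in1 _ _)) h).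
  + by move=> D /sub1/sub1.
  + right; split=> // [|_ [<-]]; first by rewrite sub1.
    by exists k.
Qed.

Variable A0 : form.
Hypothesis A0_unprovable : ~ provable T A0.

Lemma consistent0 : consistent [:: fnot A0].
Proof.
refine (consistent_not _) => -[G TG]; rewrite cats0 => dA.
by apply: A0_unprovable; exists G.
Qed.

Definition hstep G B : seq form := projT1 (cid (henkin_step G B)).

Fixpoint hseqn n : seq form :=
  if n is m.+1 then hstep (hseqn m) (nth_form m) else [:: fnot A0].

Lemma hseqn_cons n : consistent (hseqn n).
Proof.
elim: n => [|n IH] /=; first exact: consistent0.
by rewrite /hstep; case: cid => G' /= /(_ IH) [].
Qed.

Lemma hseqn_mono m n : m <= n -> {subset hseqn m <= hseqn n}.
Proof.
elim: n => [|n IH]; first by rewrite leqn0 => /eqP->.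
rewrite leq_eqVlt => /orP[/eqP->//|/IH s] B /s BG /=.
by rewrite /hstep; case: cid => G' /= /(_ (@hseqn_cons n)) [_ s' _]; apply: s'.
Qed.

Definition hmax (B : form) : Prop := exists n, B \in hseqn n.

Lemma hmax_step B : hmax B \/ [/\ hmax (fnot B),
     forall C, B = fallN C -> exists x, hmax (fnot (instN (tvar x) C)) &
     forall C, B = fallS C -> exists X, hmax (fnot (instS X C))].
Proof.
have [n nB] := nth_form_surj B.
have := projT2 (cid (henkin_step (hseqn n) (nth_form n))).
rewrite -/(hstep _ _) -/(hseqn n.+1) nB => /(_ (@hseqn_cons n)) [_ _].
case=> [h|[h1 h2 h3]]; [left|right; split].
- by exists n.+1.
- by exists n.+1.
- by move=> C /h2[x xC]; exists x, n.+1.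
- by move=> C /h3[x xC]; exists x, n.+1.
Qed.

Lemma hmax_thd n B : thd (hseqn n) B -> hmax B.
Proof.
move=> dB; have [//|[[m nB] _ _]] := hmax_step B; exfalso.
apply: (@hseqn_cons (maxn n m)); apply: (@thd_impE _ B).
  by apply: thd_hyp; apply: hseqn_mono nB; apply: leq_maxr.
by apply: (thd_weak _ dB); apply: hseqn_mono; apply: leq_maxl.
Qed.

Lemma hmax2 A B C :
  (forall G, derivable G A -> derivable G B -> derivable G C) ->
  hmax A -> hmax B -> hmax C.
Proof.
move=> r [m mA] [n nB]; apply: (@hmax_thd (maxn m n)).
apply: (thd2 r); apply: thd_hyp.
  by apply: hseqn_mono mA; apply: leq_maxl.
by apply: hseqn_mono nB; apply: leq_maxr.
Qed.

Lemma hmax1 A C :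
  (forall G, derivable G A -> derivable G C) -> hmax A -> hmax C.
Proof. by move=> r h; apply: (hmax2 _ h h) => G' h' _; apply: r. Qed.

Lemma hmax_der C : (forall G, derivable G C) -> hmax C.
Proof. by move=> r; apply: (@hmax_thd 0); exists [::]. Qed.

Lemma hmax_T B : T B -> hmax B.
Proof. by move=> TB; apply: (@hmax_thd 0); apply: thd_T. Qed.

Lemma hmax_bot : ~ hmax fbot.
Proof. by move=> [n nB]; apply: (@hseqn_cons n); apply: thd_hyp. Qed.

Lemma hmax_imp A B : hmax (fimp A B) <-> (hmax A -> hmax B).
Proof.
split=> [h1 h2|h].
  by apply: hmax2 h1 h2 => G h1 h2; apply: d_impE h1 h2.
have [/h hB|[nA _ _]] := hmax_step A.
  apply: hmax1 hB => G d; apply: d_impI; apply: (derivable_weak d) => C.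
  by rewrite inE orbC => ->.
apply: hmax1 nA => G d; apply/d_impI/d_raa/(@d_impE _ A).
  by apply: (derivable_weak d) => C; rewrite !inE orbC => ->; rewrite orbT.
by apply: d_hyp; rewrite !inE eqxx orbT.
Qed.

Lemma hmax_not A : hmax (fnot A) <-> ~ hmax A.
Proof. by rewrite /fnot; split=> [/hmax_imp h /h/hmax_bot|h]; last exact/hmax_imp. Qed.

Lemma hmax_allN A : hmax (fallN A) <-> forall t, hmax (instN t A).
Proof.
split=> [h t|h]; first by apply: hmax1 h => G; apply: d_allNE.
have [//|[_ /(_ _ erefl) [x /hmax_not nh] _]] := hmax_step (fallN A).
by case: nh.
Qed.

Lemma hmax_allS A : hmax (fallS A) <-> forall X, hmax (instS X A).
Proof.
split=> [h t|h]; first by apply: hmax1 h => G; apply: d_allSE.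
have [//|[_ _ /(_ _ erefl) [x /hmax_not nh]]] := hmax_step (fallS A).
by case: nh.
Qed.

Definition teq s t := hmax (feq s t).

Lemma teq_refl s : teq s s.
Proof. by apply: hmax_der => G; apply: d_refl. Qed.

Lemma teq_subst A s t : teq s t -> hmax (instN s A) -> hmax (instN t A).
Proof. by apply: hmax2 => G; apply: d_leibniz. Qed.

Lemma tshiftK s t :
  tsubst (fun x => if x is y.+1 then tvar y else s) (tshift t) = t.
Proof. by rewrite /tshift tsubst_comp /comp tsubst_id. Qed.

Lemma teq_sym s t : teq s t -> teq t s.
Proof.
move=> h; have := @teq_subst (feq (tvar 0) (tshift s)) s t h.
by rewrite /instN /= !tshiftK; apply; apply: teq_refl.
Qed.

Lemma teq_trans s t u : teq s t -> teq t u -> teq s u.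
Proof.
move=> h1 h2; have := @teq_subst (feq (tshift s) (tvar 0)) t u h2.
by rewrite /instN /= !tshiftK; apply.
Qed.

Definition tdom := {P : term -> Prop | exists t, P = teq t}.
Definition cls (t : term) : tdom := exist _ (teq t) (ex_intro _ t erefl).

Lemma cls_surj (x : tdom) : exists t, cls t = x.
Proof. by case: x => P [t e]; exists t; apply: eq_exist. Qed.

Definition repr (x : tdom) : term := projT1 (cid (cls_surj x)).
Lemma reprK x : cls (repr x) = x.
Proof. by rewrite /repr; case: cid. Qed.

Lemma clsP s t : cls s = cls t <-> teq s t.
Proof.
split=> [[e]|st]; first by rewrite e; apply: teq_refl.
apply: eq_exist; apply/funext => u; apply/propext; split.
  by apply: teq_trans; apply: teq_sym.
exact: teq_trans.
Qed.

Lemma teq_repr t : teq (repr (cls t)) t.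
Proof. by apply/clsP; rewrite reprK. Qed.

Definition tmod : arith := @Arith tdom (cls tzero) (cls tone)
  (fun x y => cls (tadd (repr x) (repr y)))
  (fun x y => cls (tmul (repr x) (repr y)))
  (fun x y => hmax (flt (repr x) (repr y))).

Definition tset (X : nat) (x : tmod) : Prop := hmax (fin (repr x) X).

Lemma teq_op2 (op : term -> term -> term) : 
  (forall f s t, tsubst f (op s t) = op (tsubst f s) (tsubst f t)) ->
  forall s t s' t', teq s s' -> teq t t' -> teq (op s t) (op s' t').
Proof.
move=> opE s t s' t' h1 h2; apply: (@teq_trans _ (op s' t)).
  have := @teq_subst (feq (tshift (op s t)) (op (tvar 0) (tshift t))) s s' h1.
  by rewrite /instN /= !tshiftK !opE /= !tshiftK; apply; apply: teq_refl.
have := @teq_subst (feq (tshift (op s' t)) (op (tshift s') (tvar 0))) t t' h2.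
by rewrite /instN /= !tshiftK !opE /= !tshiftK; apply; apply: teq_refl.
Qed.

Lemma teq_lt s t s' t' : teq s s' -> teq t t' -> 
  hmax (flt s t) -> hmax (flt s' t').
Proof.
move=> h1 h2 h.
have := @teq_subst (flt (tvar 0) (tshift t)) s s' h1.
rewrite /instN /= !tshiftK => /(_ h) {}h.
have := @teq_subst (flt (tshift s') (tvar 0)) t t' h2.
by rewrite /instN /= !tshiftK => /(_ h).
Qed.

Lemma teq_in s s' X : teq s s' -> hmax (fin s X) -> hmax (fin s' X).
Proof. by move=> h; apply: (@teq_subst (fin (tvar 0) X) s s' h). Qed.

Lemma eval_cls (f : nat -> term) t :
  eval (M := tmod) (cls \o f) t = cls (tsubst f t).
Proof.
elim: t => //= s -> t ->; apply/clsP.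
  by apply: (@teq_op2 tadd) => //; apply: teq_repr.
by apply: (@teq_op2 tmul) => //; apply: teq_repr.
Qed.

(** The truth lemma for terms modulo provable equality. Arbitrary substitutions [f] and [g] let the
    induction pass under the quantifiers. *)
Lemma sat_hmax A f g :
  sat (M := tmod) (fun P => exists X, tset X = P) A (cls \o f) (tset \o g) <->
  hmax (fsubst f g A).
Proof.
elim: A f g => /= [|s t|s t|t X|A IHA B IHB|A IHA|A IHA] f g.
- by split=> // /hmax_bot.
- by rewrite !eval_cls; apply: clsP.
- rewrite !eval_cls; split; apply: teq_lt; try exact: teq_repr.
    exact/teq_sym/teq_repr.
  exact/teq_sym/teq_repr.
- rewrite eval_cls; split; apply: teq_in; first exact: teq_repr.
  exact/teq_sym/teq_repr.
- by rewrite IHA IHB; split=> /hmax_imp.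
- have E t : scons (cls t) (cls \o f) = cls \o scons t f.
    by apply/funext => -[].
  split=> [h|/hmax_allN h x].
    apply/hmax_allN => t; rewrite instN_upN; apply/IHA.
    by rewrite -E; apply: h.
  by have [t <-] := cls_surj x; rewrite E; apply/IHA; rewrite -instN_upN.
- have E X : scons (tset X) (tset \o g) = tset \o scons X g.
    by apply/funext => -[].
  split=> [h|/hmax_allS h _ [X <-]].
    apply/hmax_allS => X; rewrite instS_upS; apply/IHA.
    by rewrite -E; apply: h; exists X.
  by rewrite E; apply/IHA; rewrite -instS_upS.
Qed.

End Henkin.

(** Besides the model, the enumeration [pi] of its domain is kept: countability is what makes
    generic branches exist. *)
Theorem completeness (T : theory) (A : form) :
  (forall B, T B -> sentence B) -> ~ provable T A ->
  exists (M : arith) (pi r : nat -> M) (s : nat -> M -> Prop),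
    [/\ forall x, exists k, pi k = x,
        forall B, T B -> sat (fun P => exists k, s k = P) B r s &
        ~ sat (fun P => exists k, s k = P) A r s].
Proof.
move=> Ts nA; exists (tmod Ts A), (@cls _ Ts A \o nth_term).
exists (@cls _ Ts A \o tvar), (@tset _ Ts A \o id); split.
- move=> x; have [t <-] := cls_surj x.
  by have [n <-] := nth_term_surj t; exists n.
- by move=> B TB; apply/(sat_hmax Ts nA); rewrite fsubst_id; apply: hmax_T.
- apply/(sat_hmax Ts nA (fnot A)); rewrite fsubst_id; exists 0 => /=.
  by rewrite inE eqxx.
Qed.

(** * Definability over a model *)

(** Delta_0 formulas have no set quantifiers, so the class of sets is immaterial for them; the empty
    class is a canonical choice. *)
Definition sat0 (M : arith) := @sat M (fun _ => False).

Lemma delta00_sat (M : arith) C A (r : nat -> M) s : delta00 A ->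
  sat C A r s = sat0 A r s.
Proof.
move=> dA; elim: dA r => //= [B D _ IH1 _ IH2|t B _ IH] r.
  by rewrite IH1 IH2.
by apply: eq_forall => n; rewrite IH.
Qed.

Lemma fsubst_ball f g t A :
  fsubst f g (ball t A) = ball (tsubst f t) (fsubst (upN f) g A).
Proof. by rewrite /ball /= /tshift !tsubst_comp. Qed.

Lemma delta00_subst f g A : delta00 A -> delta00 (fsubst f g A).
Proof.
move=> dA; elim: dA f => [|s t|s t|t X|B D _ IH1 _ IH2|t B _ IH] f;
  try by constructor.
by rewrite fsubst_ball; constructor.
Qed.

Section Definability.
Variables (M : arith) (pi : nat -> M).
Hypothesis pi_surj : forall x, exists k, pi k = x.

(* Even variables are arguments; odd variables range over all parameters. *)
Definition mix (r : nat -> M) (i : nat) : M :=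
  if odd i then pi i./2 else r i./2.

Definition term_def (f : (nat -> M) -> M) : Prop :=
  exists t, forall r, f r = eval (mix r) t.

Lemma mix_even r k : mix r k.*2 = r k.
Proof. by rewrite /mix odd_double doubleK. Qed.

Lemma mix_odd r k : mix r k.*2.+1 = pi k.
Proof. by rewrite /mix /= odd_double /= uphalf_double. Qed.

Lemma Tm_var k : term_def (fun r => r k).
Proof. by exists (tvar k.*2) => r; rewrite /= mix_even. Qed.

Lemma Tm_const c : term_def (fun=> c).
Proof.
have [k <-] := pi_surj c; exists (tvar k.*2.+1) => r.
by rewrite /eval mix_odd.
Qed.

Lemma Tm_add f g : term_def f -> term_def g -> term_def (fun r => aad (f r) (g r)).
Proof. by move=> [t ft] [u gu]; exists (tadd t u) => r; rewrite ft gu. Qed.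

Lemma Tm_mul f g : term_def f -> term_def g -> term_def (fun r => amu (f r) (g r)).
Proof. by move=> [t ft] [u gu]; exists (tmul t u) => r; rewrite ft gu. Qed.

Variable s : nat -> M -> Prop.

(** Definability is a property of predicates on valuations, not of formulas, so it can be proved by
    following the shape of a predicate, without writing de Bruijn formulas. *)
Definition delta0_def (P : (nat -> M) -> Prop) : Prop :=
  exists A, delta00 A /\ forall r, P r <-> sat0 A (mix r) s.

Lemma D0_raw A ts : delta00 A -> (forall i, term_def (ts i)) ->
  delta0_def (fun r => sat0 A (fun i => ts i r) s).
Proof.
move=> dA /choice[f fE]; exists (fsubst f id A); split.
  exact: delta00_subst.
move=> r; rewrite /sat0 sat_subst [X in _ <-> sat _ A X _](_ : _ = fun i => ts i r) //.
by apply/funext => i; rewrite fE.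
Qed.

Lemma D0_ext P Q : (forall r, P r <-> Q r) -> delta0_def P -> delta0_def Q.
Proof. by move=> e [A [dA AE]]; exists A; split=> // r; rewrite -e. Qed.

Lemma D0_subst P ts : delta0_def P -> (forall i, term_def (ts i)) ->
  delta0_def (fun r => P (fun i => ts i r)).
Proof.
move=> [A [dA AE]] tts.
have h : forall i, term_def (fun r => mix (fun j => ts j r) i).
  by move=> i; rewrite /mix; case: odd => //; apply: Tm_const.
by apply: D0_ext (D0_raw dA h) => r; rewrite AE.
Qed.

Lemma D0_eq f g : term_def f -> term_def g -> delta0_def (fun r => f r = g r).
Proof.
move=> [t ft] [u gu]; exists (feq t u); split; first by constructor.
by move=> r; rewrite /sat0 /= ft gu.
Qed.

Lemma D0_lt f g : term_def f -> term_def g -> delta0_def (fun r => alt (f r) (g r)).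
Proof.
move=> [t ft] [u gu]; exists (flt t u); split; first by constructor.
by move=> r; rewrite /sat0 /= ft gu.
Qed.

Lemma D0_set X f : term_def f -> delta0_def (fun r => s X (f r)).
Proof.
move=> [t ft]; exists (fin t X); split; first by constructor.
by move=> r; rewrite /sat0 /= ft.
Qed.

Lemma D0_false : delta0_def (fun=> False).
Proof. by exists fbot; split; first by constructor. Qed.

Lemma D0_imp P Q : delta0_def P -> delta0_def Q -> delta0_def (fun r => P r -> Q r).
Proof.
move=> [A [dA PA]] [B [dB QB]]; exists (fimp A B); split; first by constructor.
by move=> r; rewrite /sat0 /= PA QB.
Qed.

Lemma D0_not P : delta0_def P -> delta0_def (fun r => ~ P r).
Proof. by move=> dP; apply: D0_imp => //; apply: D0_false. Qed.

Lemma D0_and P Q : delta0_def P -> delta0_def Q -> delta0_def (fun r => P r /\ Q r).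
Proof.
move=> dP dQ; have := D0_not (D0_imp dP (D0_not dQ)).
apply: D0_ext => r; split=> [h|[p q] h]; last exact: h.
by split; apply: contrapT => n; apply: h => p // q; apply: n.
Qed.

Lemma D0_or P Q : delta0_def P -> delta0_def Q -> delta0_def (fun r => P r \/ Q r).
Proof.
move=> dP dQ; have := D0_imp (D0_not dP) dQ.
apply: D0_ext => r; split=> [h|[p n|//]]; last by [].
by have [p|/h] := pselect (P r); [left|right].
Qed.

Lemma D0_iff P Q : delta0_def P -> delta0_def Q -> delta0_def (fun r => P r <-> Q r).
Proof. by move=> dP dQ; apply: D0_and; apply: D0_imp. Qed.

(** A new argument moves the old arguments up by two even places and leaves the parameters at their
    odd places, whereas [scons] moves everything by one; this is the correction. *)
Definition lift_mix (i : nat) : nat := if odd i then i.+1 else i.-1.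

Lemma mix_scons n r i : mix (scons n r) i = scons n (mix r) (lift_mix i).
Proof.
rewrite -(odd_double_half i) /lift_mix; move: (i./2) => k.
case: (odd i).
  rewrite add1n mix_odd [odd _]/= odd_double /=.
  by rewrite -[RHS]/(mix r k.*2.+1) mix_odd.
rewrite add0n mix_even odd_double; case: k => //= k.
by rewrite -[RHS]/(mix r k.*2) mix_even.
Qed.

Lemma D0_ball t Q : term_def t -> delta0_def (fun r => Q (r 0) (fun i => r i.+1)) ->
  delta0_def (fun r => forall n, alt n (t r) -> Q n r).
Proof.
move=> [u tu] [A [dA AE]].
exists (ball u (fsubst (tvar \o lift_mix) id A)); split.
  by constructor; apply: delta00_subst.
move=> r; rewrite /sat0 /=.
have h n : Q n r <-> sat0 (fsubst (tvar \o lift_mix) id A) (scons n (mix r)) s.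
  have /= -> := AE (scons n r); rewrite /sat0 sat_subst.
  rewrite (_ : mix _ = eval (scons n (mix r)) \o (tvar \o lift_mix)) //.
  by apply/funext => i; rewrite mix_scons.
by split=> H n; have := H n; rewrite eval_shift tu => H' /H' /h.
Qed.

Lemma D0_bex t Q : term_def t -> delta0_def (fun r => Q (r 0) (fun i => r i.+1)) ->
  delta0_def (fun r => exists n, alt n (t r) /\ Q n r).
Proof.
move=> tt dQ.
have := D0_not (D0_ball (Q := fun n r => ~ Q n r) tt (D0_not dQ)).
apply: D0_ext => r; split=> [h|[n [nt qn]] /(_ n nt)]; last by apply.
apply: contrapT => h'; apply: h => n nt qn; apply: h'; by exists n.
Qed.

Definition sigma1_def (P : (nat -> M) -> Prop) : Prop :=
  exists2 Q, delta0_def Q & forall r, P r <-> exists w, Q (scons w r).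

Lemma Sig_ext P Q : (forall r, P r <-> Q r) -> sigma1_def P -> sigma1_def Q.
Proof. by move=> e [R dR RE]; exists R => // r; rewrite -e. Qed.

Lemma D0_shift P : delta0_def P -> delta0_def (fun r => P (fun i => r i.+1)).
Proof. by move=> dP; apply: (D0_subst dP) => i; apply: Tm_var. Qed.

Lemma Sig_D0 P : delta0_def P -> sigma1_def P.
Proof.
move=> dP; exists (fun r => P (fun i => r i.+1)); first exact: D0_shift.
by move=> r; split=> [h|[]//]; exists (az M).
Qed.

Lemma Sig_ex0 Q : delta0_def (fun r => Q (r 0) (fun i => r i.+1)) ->
  sigma1_def (fun r => exists n, Q n r).
Proof. by move=> dQ; exists (fun r => Q (r 0) (fun i => r i.+1)). Qed.

Lemma Sig_subst P ts : sigma1_def P -> (forall i, term_def (ts i)) ->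
  sigma1_def (fun r => P (fun i => ts i r)).
Proof.
move=> [Q dQ QE] tts.
exists (fun r => Q (fun i => scons (r 0) (fun j => ts j (fun i => r i.+1)) i)).
  apply: (D0_subst dQ) => -[|i] /=; first exact: Tm_var.
  have [t tE] := tts i.
  exists (tsubst (tvar \o (fun j => if odd j then j else j.+2)) t) => r.
  rewrite tE eval_subst; congr eval; apply/funext => j /=.
  by rewrite /mix; case: ifP => oj; rewrite ?oj //= !negbK oj.
move=> r; rewrite QE; split=> -[w h]; exists w.
  by rewrite (_ : (fun _ => _) = scons w (fun i => ts i r)) //; apply/funext => -[].
by rewrite (_ : scons _ _ = (fun i => scons w (fun j => ts j r) i)).
Qed.

Definition ISig : Prop := forall P : M -> Prop, sigma1_def (fun r => P (r 0)) ->
  P (az M) -> (forall n, P n -> P (aad n (ao M))) -> forall n, P n.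

Definition RCAm : Prop := ISig /\ forall P : M -> Prop,
  sigma1_def (fun r => P (r 0)) -> sigma1_def (fun r => ~ P (r 0)) -> exists k, s k = P.

End Definability.

Ltac dtm := solve [
  repeat first [ apply: Tm_add | apply: Tm_mul | apply: Tm_const; assumption
               | apply: Tm_var ] ].

(** * Arithmetic of a model: the discretely ordered semiring *)

Record Basic (M : arith) : Prop := {
  b_succ0 : forall n : M, aad n (ao M) <> az M;
  b_succI : forall m n : M, aad m (ao M) = aad n (ao M) -> m = n;
  b_addr0 : forall m : M, aad m (az M) = m;
  b_addrS : forall m n : M, aad m (aad n (ao M)) = aad (aad m n) (ao M);
  b_mulr0 : forall m : M, amu m (az M) = az M;
  b_mulrS : forall m n : M, amu m (aad n (ao M)) = aad (amu m n) m;
  b_lt0 : forall m : M, ~ alt m (az M);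
  b_ltS : forall m n : M, alt m (aad n (ao M)) <-> alt m n \/ m = n }.

(* Discretely ordered commutative semirings. *)
Record dsr := Dsr {
  dsrM :> arith;
  addmA : forall x y z : dsrM, aad x (aad y z) = aad (aad x y) z;
  addmC : forall x y : dsrM, aad x y = aad y x;
  addm0 : forall x : dsrM, aad x (az dsrM) = x;
  mulmA : forall x y z : dsrM, amu x (amu y z) = amu (amu x y) z;
  mulmC : forall x y : dsrM, amu x y = amu y x;
  mulm0 : forall x : dsrM, amu x (az dsrM) = az dsrM;
  mulm1 : forall x : dsrM, amu x (ao dsrM) = x;
  mulmDl : forall x y z : dsrM, amu (aad x y) z = aad (amu x z) (amu y z);
  addmI : forall x y z : dsrM, aad x z = aad y z -> x = y;
  addm_eq0 : forall x y : dsrM, aad x y = az dsrM -> x = az dsrM;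
  lemP : forall x y : dsrM, alt x y <-> exists k, y = aad (aad x k) (ao dsrM);
  ltm_total : forall x y : dsrM, alt x y \/ x = y \/ alt y x;
  one_neq0 : ao dsrM <> az dsrM;
}.

Section BasicArith.
Variables (M : arith) (pi : nat -> M) (s : nat -> M -> Prop).
Hypothesis pi_surj : forall x, exists k, pi k = x.
Hypothesis MB : Basic M.
Hypothesis MI : ISig pi s.
Local Notation "x +s y" := (@aad M x y) (at level 50, left associativity).
Local Notation "x *s y" := (@amu M x y) (at level 40, left associativity).
Local Notation "x <s y" := (@alt M x y) (at level 70).
Local Notation Z := (az M).
Local Notation I := (ao M).

Lemma eq_ind_m (f g : M -> M) :
  term_def pi (fun r => f (r 0)) -> term_def pi (fun r => g (r 0)) ->
  f Z = g Z -> (forall n, f n = g n -> f (n +s I) = g (n +s I)) ->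
  forall n, f n = g n.
Proof. by move=> tf tg; apply: MI; apply: Sig_D0 => //; apply: D0_eq. Qed.

Let add0m x : Z +s x = x.
Proof.
move: x; apply: eq_ind_m; [dtm|dtm|by rewrite b_addr0|].
by move=> n IH; rewrite b_addrS // IH.
Qed.

Let addmA' x y z : x +s (y +s z) = (x +s y) +s z.
Proof.
move: z; apply: eq_ind_m; [dtm|dtm|by rewrite !b_addr0|].
by move=> n IH; rewrite !b_addrS // IH.
Qed.

Let addSm x y : (x +s I) +s y = (x +s y) +s I.
Proof.
move: y; apply: eq_ind_m; [dtm|dtm|by rewrite !b_addr0|].
by move=> n IH; rewrite !b_addrS // IH.
Qed.

Let addmC' x y : x +s y = y +s x.
Proof.
move: x; apply: eq_ind_m; [dtm|dtm|by rewrite b_addr0 // add0m|].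
by move=> n IH; rewrite addSm IH b_addrS.
Qed.

Let mul0m x : Z *s x = Z.
Proof.
move: x; apply: eq_ind_m; [dtm|dtm|by rewrite b_mulr0|].
by move=> n IH; rewrite b_mulrS // IH b_addr0.
Qed.

Let mulSm x y : (x +s I) *s y = x *s y +s y.
Proof.
move: y; apply: eq_ind_m; [dtm|dtm|by rewrite !b_mulr0 // b_addr0|].
by move=> n IH; rewrite !b_mulrS // IH -!addmA' (addmC' n) -addmA' (addmC' I).
Qed.

Let mulmC' x y : x *s y = y *s x.
Proof.
move: x; apply: eq_ind_m; [dtm|dtm|by rewrite b_mulr0 // mul0m|].
by move=> n IH; rewrite mulSm IH b_mulrS.
Qed.

Let mulmDr x y z : x *s (y +s z) = x *s y +s x *s z.
Proof.
move: z; apply: eq_ind_m; [dtm|dtm|by rewrite b_mulr0 // !b_addr0|].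
by move=> n IH; rewrite b_addrS // !b_mulrS // IH addmA'.
Qed.

Let mulmA' x y z : x *s (y *s z) = (x *s y) *s z.
Proof.
move: z; apply: eq_ind_m; [dtm|dtm|by rewrite !b_mulr0|].
by move=> n IH; rewrite !b_mulrS // mulmDr IH.
Qed.

Let addmI' x y z : x +s z = y +s z -> x = y.
Proof.
move: z; apply: MI => [||].
- by apply: Sig_D0 => //; apply: D0_imp; apply: D0_eq; dtm.
- by rewrite !b_addr0.
- by move=> n IH; rewrite !b_addrS // => /(b_succI MB).
Qed.

Let zero_or_succ x : x = Z \/ exists y, x = y +s I.
Proof.
move: x; apply: MI => [||].
- exists (fun r => r 1 = Z \/ r 1 = r 0 +s I).
    by apply: D0_or; apply: D0_eq; dtm.
  move=> r /=; split=> [[->|[y ->]]|[w [->|->]]].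
  + by exists Z; left.
  + by exists y; right.
  + by left.
  + by right; exists w.
- by left.
- by move=> n _; right; exists n.
Qed.

Let addm_eq0' x y : x +s y = Z -> x = Z.
Proof.
case: (zero_or_succ y) => [->|[z ->]]; first by rewrite b_addr0.
by rewrite b_addrS // => /(b_succ0 MB).
Qed.

(** The implication becomes Sigma_1 when its Delta_0 premise is moved behind the quantifier: some
    [k] satisfies the equation, or [x <s y] fails. *)
Let lem1 x y : x <s y -> exists k, y = x +s k +s I.
Proof.
move: y; apply: MI => [||].
- exists (fun r => r 1 = x +s r 0 +s I \/ ~ (x <s r 1)).
    by apply: D0_or; [apply: D0_eq|apply: D0_not; apply: D0_lt]; dtm.
  move=> r /=; split=> [h|[w [->|h]]].
  + have [/h[k ->]|nx] := pselect (x <s r 0); first by exists k; left.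
    by exists Z; right.
  + by exists w.
  + by move=> /h.
- by move/(b_lt0 MB).
- move=> n IH /(b_ltS MB)[/IH[k ->]|->].
    by exists (k +s I); rewrite b_addrS.
  by exists Z; rewrite b_addr0.
Qed.

Let lem2 x k : x <s x +s k +s I.
Proof.
move: k; apply: MI => [||].
- by apply: Sig_D0 => //; apply: D0_lt; dtm.
- by rewrite b_addr0 //; apply/b_ltS => //; right.
- by move=> n IH; apply/b_ltS => //; left; rewrite b_addrS.
Qed.

Let total x y : x <s y \/ x = y \/ y <s x.
Proof.
move: y; apply: MI => [||].
- by apply: Sig_D0 => //; apply: D0_or;
    [apply: D0_lt|apply: D0_or; [apply: D0_eq|apply: D0_lt]]; dtm.
- have [->|[y ->]] := zero_or_succ x; first by right; left.
  by right; right; have := lem2 Z y; rewrite add0m.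
- move=> n [xn|[->|/lem1[k ->]]].
  + by left; apply/b_ltS => //; left.
  + by left; apply/b_ltS => //; right.
  + right; have [->|[l ->]] := zero_or_succ k; first by left; rewrite b_addr0.
    by right; rewrite b_addrS // -addSm; apply: lem2.
Qed.

Definition dsr_of : dsr.
Proof.
refine (@Dsr M addmA' addmC' (b_addr0 MB) mulmA' mulmC' (b_mulr0 MB)
  _ _ addmI' addm_eq0' _ total _).
- by move=> x; rewrite -[I]add0m b_mulrS // b_mulr0 // add0m.
- by move=> x y z; rewrite mulmC' mulmDr !(mulmC' z).
- by move=> x y; split=> [/lem1|[k ->]].
- by move=> h; apply: (b_succ0 MB (n := Z)); rewrite add0m.
Defined.

End BasicArith.

(** * The ordered ring generated by a model *)

Section Grothendieck.
Variable S : dsr.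
Local Notation "x +s y" := (@aad S x y) (at level 50, left associativity).
Local Notation "x *s y" := (@amu S x y) (at level 40, left associativity).
Local Notation "x <s y" := (@alt S x y) (at level 70).
Local Notation O := (az S).
Local Notation I := (ao S).

Lemma dsr_theory : semi_ring_theory O I (@aad S) (@amu S) eq.
Proof.
split=> *.
- by rewrite addmC addm0.
- exact: addmC.
- exact: addmA.
- by rewrite mulmC mulm1.
- by rewrite mulmC mulm0.
- exact: mulmC.
- exact: mulmA.
- exact: mulmDl.
Qed.
Add Ring dsr_ring : dsr_theory.

(** The pair (a, b) stands for the difference a - b. The ring of differences is formed so that
    [ring], [lra] and [nra] apply; facts of the semiring are carried there and back by the injective
    [zi]. *)
Definition geq (p q : S * S) : Prop := p.1 +s q.2 = q.1 +s p.2.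

Lemma geq_sym p q : geq p q -> geq q p.
Proof. by rewrite /geq => ->. Qed.

Lemma geq_trans p q u : geq p q -> geq q u -> geq p u.
Proof.
rewrite /geq => h1 h2; apply: (@addmI _ _ _ q.2).
transitivity (u.2 +s (p.1 +s q.2)); first ring.
rewrite h1; transitivity (p.2 +s (q.1 +s u.2)); first ring.
by rewrite h2; ring.
Qed.

Definition gint := {P : S * S -> Prop | exists p, P = geq p}.
Definition gcl (p : S * S) : gint := exist _ (geq p) (ex_intro _ p erefl).

Lemma gclP p q : gcl p = gcl q <-> geq p q.
Proof.
split=> [[e]|pq]; first by rewrite e.
apply: eq_exist; apply/funext => u; apply/propext; split.
  by apply: geq_trans; apply: geq_sym.
exact: geq_trans.
Qed.

Lemma gcl_surj (x : gint) : exists p, gcl p = x.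
Proof. by case: x => P [t e]; exists t; apply: eq_exist. Qed.

Definition grep (x : gint) := projT1 (cid (gcl_surj x)).
Lemma grepK x : gcl (grep x) = x.
Proof. by rewrite /grep; case: cid. Qed.
Lemma grep_gcl p : geq (grep (gcl p)) p.
Proof. by apply/gclP; rewrite grepK. Qed.

Definition gadd x y := gcl ((grep x).1 +s (grep y).1, (grep x).2 +s (grep y).2).
Definition gopp x := gcl ((grep x).2, (grep x).1).
Definition gmul x y := gcl
  ((grep x).1 *s (grep y).1 +s (grep x).2 *s (grep y).2,
   (grep x).1 *s (grep y).2 +s (grep x).2 *s (grep y).1).
Definition gle x y : bool := `[< exists k,
  (grep y).1 +s (grep x).2 = (grep x).1 +s (grep y).2 +s k >].

Lemma gaddE p q : gadd (gcl p) (gcl q) = gcl (p.1 +s q.1, p.2 +s q.2).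
Proof.
apply/gclP; have := grep_gcl p; have := grep_gcl q; rewrite /geq /=.
move: (grep (gcl p)) (grep (gcl q)) => p' q' h2 h1.
transitivity ((p'.1 +s p.2) +s (q'.1 +s q.2)); first ring.
by rewrite h1 h2; ring.
Qed.

Lemma goppE p : gopp (gcl p) = gcl (p.2, p.1).
Proof.
apply/gclP; have := grep_gcl p; rewrite /geq /= => h.
by rewrite addmC -h addmC.
Qed.

Lemma gmul_wd p p' q q' : geq p p' -> geq q q' ->
  geq (p.1 *s q.1 +s p.2 *s q.2, p.1 *s q.2 +s p.2 *s q.1)
      (p'.1 *s q'.1 +s p'.2 *s q'.2, p'.1 *s q'.2 +s p'.2 *s q'.1).
Proof.
move=> h1 h2; apply: (@geq_trans _
  (p'.1 *s q.1 +s p'.2 *s q.2, p'.1 *s q.2 +s p'.2 *s q.1)).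
  move: h1; rewrite /geq /= => h.
  transitivity ((p.1 +s p'.2) *s q.1 +s (p'.1 +s p.2) *s q.2); first ring.
  rewrite h.
  transitivity ((p'.1 +s p.2) *s q.1 +s (p.1 +s p'.2) *s q.2); last ring.
  by rewrite h.
move: h2; rewrite /geq /= => h.
transitivity ((q.1 +s q'.2) *s p'.1 +s (q'.1 +s q.2) *s p'.2); first ring.
rewrite h.
transitivity ((q'.1 +s q.2) *s p'.1 +s (q.1 +s q'.2) *s p'.2); last ring.
by rewrite h.
Qed.

Lemma gmulE p q : gmul (gcl p) (gcl q) =
  gcl (p.1 *s q.1 +s p.2 *s q.2, p.1 *s q.2 +s p.2 *s q.1).
Proof. by apply/gclP/gmul_wd; apply: grep_gcl. Qed.

Lemma gleE p q : gle (gcl p) (gcl q) <->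
  exists k, q.1 +s p.2 = p.1 +s q.2 +s k.
Proof.
have wd a a' b b' : geq a a' -> geq b b' ->
  (exists k, b.1 +s a.2 = a.1 +s b.2 +s k) ->
  exists k, b'.1 +s a'.2 = a'.1 +s b'.2 +s k.
  rewrite /geq => h1 h2 [k h]; exists k; apply: (@addmI _ _ _ (a.1 +s b.2)).
  transitivity ((b'.1 +s b.2) +s (a.1 +s a'.2)); first ring.
  rewrite h1 -h2.
  transitivity ((b.1 +s a.2) +s (a'.1 +s b'.2)); first ring.
  by rewrite h; ring.
rewrite /gle; split=> [/asboolP|h].
  by apply: wd; apply: grep_gcl.
by apply/asboolP; apply: wd h; apply/geq_sym/grep_gcl.
Qed.

Definition g0 := gcl (O, O).
Definition g1 := gcl (I, O).

Lemma gaddA : associative gadd.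
Proof.
move=> x y z; rewrite -[x]grepK -[y]grepK -[z]grepK.
by rewrite !(gaddE, goppE, gmulE); apply/gclP; rewrite /geq /=; ring.
Qed.
Lemma gaddC : commutative gadd.
Proof.
move=> x y; rewrite -[x]grepK -[y]grepK.
by rewrite !(gaddE, goppE, gmulE); apply/gclP; rewrite /geq /=; ring.
Qed.
Lemma gadd0 : left_id g0 gadd.
Proof.
move=> x; rewrite -[x]grepK.
by rewrite !(gaddE, goppE, gmulE); apply/gclP; rewrite /geq /=; ring.
Qed.
Lemma gaddN : left_inverse g0 gopp gadd.
Proof.
move=> x; rewrite -[x]grepK.
by rewrite !(gaddE, goppE, gmulE); apply/gclP; rewrite /geq /=; ring.
Qed.
Lemma gmulA : associative gmul.
Proof.
move=> x y z; rewrite -[x]grepK -[y]grepK -[z]grepK.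
by rewrite !(gaddE, goppE, gmulE); apply/gclP; rewrite /geq /=; ring.
Qed.
Lemma gmulC : commutative gmul.
Proof.
move=> x y; rewrite -[x]grepK -[y]grepK.
by rewrite !(gaddE, goppE, gmulE); apply/gclP; rewrite /geq /=; ring.
Qed.
Lemma gmul1 : left_id g1 gmul.
Proof.
move=> x; rewrite -[x]grepK.
by rewrite !(gaddE, goppE, gmulE); apply/gclP; rewrite /geq /=; ring.
Qed.
Lemma gmulD : left_distributive gmul gadd.
Proof.
move=> x y z; rewrite -[x]grepK -[y]grepK -[z]grepK.
by rewrite !(gaddE, goppE, gmulE); apply/gclP; rewrite /geq /=; ring.
Qed.
Lemma g1_neq0 : g1 <> g0.
Proof.
move=> /gclP; rewrite /geq /= => h; apply: (@one_neq0 S).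
by rewrite -[I]addm0 h addm0.
Qed.

HB.instance Definition _ := gen_eqMixin gint.
HB.instance Definition _ := gen_choiceMixin gint.
HB.instance Definition _ := GRing.isZmodule.Build gint gaddA gaddC gadd0 gaddN.
Fact g1_neq0b : g1 != 0%R :> gint. Proof. exact/eqP/g1_neq0. Qed.
HB.instance Definition _ :=
  GRing.Zmodule_isComNzRing.Build gint gmulA gmulC gmul1 gmulD g1_neq0b.

Definition zi (x : S) : gint := gcl (x, O).

Import GRing.Theory.
Local Open Scope ring_scope.

Lemma zi0 : zi O = 0. Proof. by []. Qed.
Lemma zi1 : zi I = 1. Proof. by []. Qed.
Lemma ziD x y : zi (x +s y) = zi x + zi y.
Proof. by rewrite [RHS]gaddE; apply/gclP; rewrite /geq /=; ring. Qed.
Lemma ziM x y : zi (x *s y) = zi x * zi y.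
Proof. by rewrite [RHS]gmulE; apply/gclP; rewrite /geq /=; ring. Qed.
Lemma zi_inj x y : zi x = zi y -> x = y.
Proof. by move/gclP; rewrite /geq /= !addm0. Qed.

Lemma gint_case (x : gint) : exists k, x = zi k \/ x = - zi (k +s I).
Proof.
have [[a b] <-] := gcl_surj x.
have [/lemP[k ->]|[->|/lemP[k ->]]] := ltm_total a b.
- by exists k; right; rewrite [RHS]goppE; apply/gclP; rewrite /geq /=; ring.
- by exists O; left; apply/gclP; rewrite /geq /=; ring.
- by exists (k +s I); left; apply/gclP; rewrite /geq /=; ring.
Qed.

Lemma zi_mul_eq0 x y : zi x * zi y = 0 -> zi x = 0 \/ zi y = 0.
Proof.
rewrite -ziM -zi0 => /zi_inj h.
have [/lemP[k xE]|[<-|/lemP[k]]] := ltm_total O x; last first.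
- rewrite (_ : x +s k +s I = I +s k +s x); last by ring.
  move/esym => e; have e1 := addm_eq0 e; move: e1.
  by move=> /addm_eq0 e2; case: (@one_neq0 S e2).
- by left.
right; congr zi; move: h; rewrite xE.
by rewrite (_ : _ *s _ = y +s y *s k); [move/addm_eq0|ring].
Qed.

Lemma gint_idomain (x y : gint) : x * y = 0 -> (x == 0) || (y == 0).
Proof.
have [k [->|->]] := gint_case x; have [l [->|->]] := gint_case y;
  rewrite ?(mulrN, mulNr) ?opprK.
- by move=> /zi_mul_eq0[->|->]; rewrite eqxx ?orbT.
- move=> /eqP; rewrite oppr_eq0 => /eqP /zi_mul_eq0[->|->];
  by rewrite ?oppr0 eqxx ?orbT.
- move=> /eqP; rewrite oppr_eq0 => /eqP /zi_mul_eq0[->|->];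
  by rewrite ?oppr0 eqxx ?orbT.
- by move=> /zi_mul_eq0[->|->]; rewrite ?oppr0 eqxx ?orbT.
Qed.

(** The integral domain structure is built on rings with a partial inverse, so one is chosen
    classically, with the identity as default. *)
Definition gunit : pred gint := fun x => `[< exists y, y * x = 1 >].
Definition ginv (x : gint) : gint :=
  if pselect (exists y, y * x = 1) is left h then projT1 (cid h) else x.
Fact gmulVx : {in gunit, left_inverse 1 ginv *%R}.
Proof.
move=> x /asboolP h; rewrite /ginv; case: pselect => // h'.
by case: cid.
Qed.
Fact gunitPl (x y : gint) : y * x = 1 -> gunit x.
Proof. by move=> h; apply/asboolP; exists y. Qed.
Fact ginv_out : {in [predC gunit], ginv =1 id}.
Proof.
move=> x /negP nx; rewrite /ginv; case: pselect => // h.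
by case: nx; apply/asboolP.
Qed.
HB.instance Definition _ :=
  GRing.ComNzRing_hasMulInverse.Build gint gmulVx gunitPl ginv_out.
HB.instance Definition _ :=
  GRing.ComUnitRing_isIntegral.Build gint gint_idomain.

Definition gnorm (x : gint) : gint := if gle 0 x then x else - x.

Lemma gle_iota x y : gle (zi x) (zi y) <-> exists k, y = x +s k.
Proof.
rewrite gleE /=; split=> -[k h]; exists k.
  by rewrite -[LHS]addm0 h addm0.
by rewrite h !addm0.
Qed.

Lemma gle0P x : gle 0 x <-> exists k, x = zi k.
Proof.
split=> [|[k ->]]; last first.
  by apply/gle_iota; exists k; ring.
have [k [->|->]] := gint_case x; first by exists k.
rewrite [- _]goppE => /gleE [l] /=; rewrite (_ : O +s O = O); last by ring.
rewrite (_ : O +s (k +s I) +s l = I +s (k +s l)); last by ring.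
by move=> /esym /addm_eq0 e; case: (@one_neq0 S e).
Qed.

Lemma gsub_ge0 x y : gle 0 (y - x) = gle x y.
Proof.
apply/idP/idP.
  have [[a b] <-] := gcl_surj x; have [[c d] <-] := gcl_surj y.
  rewrite [- _]goppE [_ + _]gaddE => /gleE [k] /= e; apply/gleE; exists k => /=.
  by move: e; rewrite !addm0 => ->; ring.
have [[a b] <-] := gcl_surj x; have [[c d] <-] := gcl_surj y.
rewrite [- _]goppE [_ + _]gaddE => /gleE [k] /= e; apply/gleE; exists k => /=.
by rewrite addm0 e; ring.
Qed.

Lemma gle0_total x : gle 0 x || gle x 0.
Proof.
have [k [->|->]] := gint_case x; first by rewrite (gle0P _).2 //; exists k.
by rewrite -(gsub_ge0 _ 0) sub0r opprK (gle0P (zi _)).2 ?orbT //; eexists.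
Qed.

Lemma gle0_anti x : gle 0 x -> gle x 0 -> x = 0.
Proof.
move=> /gle0P[k ->]; rewrite -zi0 => /gle_iota[l].
by move=> /esym /addm_eq0 ->.
Qed.

Fact gle0_add x y : gle 0 x -> gle 0 y -> gle 0 (x + y).
Proof. by move=> /gle0P[k ->] /gle0P[l ->]; apply/gle0P; exists (k +s l); rewrite ziD. Qed.
Fact gle0_mul x y : gle 0 x -> gle 0 y -> gle 0 (x * y).
Proof. by move=> /gle0P[k ->] /gle0P[l ->]; apply/gle0P; exists (k *s l); rewrite ziM. Qed.
Fact gnormN x : gnorm (- x) = gnorm x.
Proof.
rewrite /gnorm opprK.
have := gle0_total x; rewrite -(gsub_ge0 x 0) sub0r.
case: ifP => h1; case: ifP => h2 //= _.
have -> : x = 0 by apply: gle0_anti => //; rewrite -gsub_ge0 sub0r.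
by rewrite oppr0.
Qed.
Fact gge0_norm x : gle 0 x -> gnorm x = x.
Proof. by rewrite /gnorm => ->. Qed.
HB.instance Definition _ := Num.IntegralDomain_isLeReal.Build gint
  gle0_add gle0_mul gle0_anti gsub_ge0 gle0_total gnormN gge0_norm
  (fun _ _ => erefl).

Lemma zi_leP x y : reflect (exists k, y = x +s k) (zi x <= zi y).
Proof. by apply: (iffP idP) => /gle_iota. Qed.

Lemma zi_ge0 x : 0 <= zi x.
Proof. by rewrite -zi0; apply/zi_leP; exists x; ring. Qed.

(** Discreteness of the order. Rewriting strict inequalities between elements of the model in this
    form makes their integrality available to linear arithmetic. *)
Lemma zi_lt1 x y : (zi x < zi y) = (zi x + 1 <= zi y).
Proof.
apply/idP/idP => [|h]; last first.
  by apply: Order.POrderTheory.lt_le_trans h; rewrite Num.Theory.ltrDl Num.Theory.ltr01.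
rewrite Order.POrderTheory.lt_neqAle => /andP[/eqP ne /zi_leP[k e]].
rewrite -zi1 -ziD; have [h|[h|]] := ltm_total O k.
- by move: h e => /lemP[l ->] ->; apply/zi_leP; exists l; ring.
- by case: ne; rewrite e -h addm0.
- move=> /lemP[l] /esym h; case: (@one_neq0 S).
  by apply: (@addm_eq0 _ _ (k +s l)); rewrite -h; ring.
Qed.

Lemma zi_ltP x y : x <s y <-> zi x < zi y.
Proof.
rewrite zi_lt1 -zi1 -ziD lemP; split=> [[k ->]|/zi_leP[k ->]].
  by apply/zi_leP; exists k; ring.
by exists k; ring.
Qed.

Lemma zi_sub x y : zi x <= zi y -> exists k, zi k = zi y - zi x.
Proof.
by move=> /zi_leP[k ->]; exists k; rewrite ziD addrC addKr.
Qed.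

End Grothendieck.

(* From here on [ring] is the tactic for MathComp rings. *)
From mathcomp Require Import ring lra.

Import Order.TTheory GRing.Theory Num.Theory.
Local Open Scope ring_scope.

Notation "x +s y" := (@aad _ x y) (at level 50, left associativity).
Notation "x *s y" := (@amu _ x y) (at level 40, left associativity).
Notation "x <s y" := (@alt _ x y) (at level 70).
Notation "'0s'" := (az _).
Notation "'1s'" := (ao _).
Notation "x <=s y" := (zi x <= zi y) (at level 70).

Section Order.
Variable S : dsr.
Implicit Types x y z : S.

Lemma ltm_irr x : ~ x <s x.
Proof. by move=> /zi_ltP; rewrite ltxx. Qed.
Lemma zi_le1 x y : (zi x <= zi y) = (zi x < zi y + 1).
Proof. by rewrite -zi1 -ziD zi_lt1 ziD zi1 lerD2r. Qed.
Lemma alt_ziP x y : x <s y <-> zi x + 1 <= zi y.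
Proof. by rewrite zi_ltP zi_lt1. Qed.
Lemma nalt_ziP x y : ~ x <s y <-> zi y <= zi x.
Proof.
rewrite leNgt; split=> [h|/negP h]; first by apply/negP => /zi_ltP.
by move=> /zi_ltP.
Qed.
Lemma ltS x y : x <s y +s 1s <-> zi x <= zi y.
Proof. by rewrite alt_ziP ziD zi1 lerD2r. Qed.
End Order.

Ltac zi_hyps := repeat match goal with
  | H : alt _ _ |- _ => apply alt_ziP in H
  | H : ~ alt _ _ |- _ => apply nalt_ziP in H
  | H : @eq (dom _) _ _ |- _ => apply (f_equal (@zi _)) in H
  | H : context [zi (aad _ _)] |- _ => rewrite ziD in H
  | H : context [zi (amu _ _)] |- _ => rewrite ziM in H
  | H : context [zi (az _)] |- _ => rewrite zi0 in H
  | H : context [zi (ao _)] |- _ => rewrite zi1 in H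
  end.

Ltac zi_pos :=
  repeat match goal with
  | x : dom (dsrM _) |- _ =>
    lazymatch goal with
    | _ : is_true (0 <= zi x) |- _ => fail
    | _ => let H := fresh "ge0" in have H := zi_ge0 x
    end
  end.

Ltac zi_goal :=
  lazymatch goal with
  | |- alt _ _ => apply/alt_ziP
  | |- ~ alt _ _ => apply/nalt_ziP; rewrite zi_le1
  | |- @eq (dom _) _ _ => apply: zi_inj
  | |- is_true (zi _ <= zi _) => rewrite zi_le1
  | _ => idtac
  end; rewrite ?(ziD, ziM, zi0, zi1).

Ltac zify_m := zi_hyps; zi_goal; zi_pos.
Ltac mlra := zify_m; lra.
Ltac mnra := zify_m; nra.
Ltac mring := zi_goal; ring.

(* Closure properties of Sigma_1 and forms of induction *)
Create HintDb defin.

Section SigClosure.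
Variables (S : dsr) (pi : nat -> S).
Hypothesis pi_surj : forall x, exists k, pi k = x.
Variable s : nat -> S -> Prop.
Local Notation D0 := (delta0_def pi s).
Local Notation Sig := (sigma1_def pi s).
Local Notation Tm := (term_def pi).
Implicit Types (P Q : (nat -> S) -> Prop).

Lemma D0_mem (P : S -> Prop) f : (exists k, s k = P) -> Tm f ->
  D0 (fun r => P (f r)).
Proof. by move=> [k <-]; apply: D0_set. Qed.

Lemma D0_cst (P : Prop) : D0 (fun=> P).
Proof.
have [h|h] := pselect P.
  by apply: D0_ext (D0_imp (D0_false pi s) (D0_false pi s)) => r; split.
by apply: D0_ext (D0_false pi s) => r; split.
Qed.

Lemma D0_eta (P : S -> Prop) f : D0 (fun r => P (r 0%N)) -> Tm f ->
  D0 (fun r => P (f r)).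
Proof. by move=> dP tf; apply: (D0_subst pi_surj dP (ts := fun=> f)). Qed.

Lemma D0_eta2 (P : S -> S -> Prop) f g : D0 (fun r => P (r 0%N) (r 1%N)) ->
  Tm f -> Tm g -> D0 (fun r => P (f r) (g r)).
Proof.
move=> dP tf tg.
by apply: (D0_subst pi_surj dP (ts := fun i => if i is 0 then f else g)); case.
Qed.

Lemma D0_bex2 (Q : S -> (nat -> S) -> Prop) :
  D0 (fun r => Q (r 0%N) (fun i => r i.+1)) ->
  D0 (fun r => exists u, u <s r 0%N /\ Q u (fun i => r i.+1)).
Proof.
move=> dQ; apply: D0_bex; first exact: Tm_var.
apply: (D0_subst pi_surj dQ (ts := fun i r => if i is j.+1 then r j.+2 else r 0%N)).
by case=> [|i]; apply: Tm_var.
Qed.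

(** The two witnesses are merged into one number bounding both, which makes a pairing function
    unnecessary. *)
Lemma Sig_and P Q : Sig P -> Sig Q -> Sig (fun r => P r /\ Q r).
Proof.
move=> [A dA PA] [B dB QB].
exists (fun r => (exists u, u <s r 0%N /\ A (scons u (fun i => r i.+1))) /\
                 (exists u, u <s r 0%N /\ B (scons u (fun i => r i.+1)))).
  apply: D0_and.
    apply: (@D0_bex2 (fun u r => A (scons u r))).
    apply: (D0_subst pi_surj dA (ts := fun i r => scons (r 0%N) (fun i => r i.+1) i)).
    by case=> [|i]; apply: Tm_var.
  apply: (@D0_bex2 (fun u r => B (scons u r))).
  apply: (D0_subst pi_surj dB (ts := fun i r => scons (r 0%N) (fun i => r i.+1) i)).
  by case=> [|i]; apply: Tm_var.
move=> r; rewrite PA QB; split=> [[[u hu] [v hv]]|[w [[u [_ hu]] [v [_ hv]]]]].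
  exists (u +s v +s 1s); split; [exists u|exists v]; split=> //=; mlra.
by split; [exists u|exists v].
Qed.

Lemma Sig_ex (Q : S -> (nat -> S) -> Prop) :
  Sig (fun r => Q (r 0%N) (fun i => r i.+1)) -> Sig (fun r => exists n, Q n r).
Proof.
move=> [A dA QA].
exists (fun r => exists n, n <s r 0%N /\
   exists u, u <s r 0%N /\ A (scons u (scons n (fun i => r i.+1)))).
  apply: D0_bex; first exact: Tm_var.
  apply: D0_bex; first exact: Tm_var.
  apply: (D0_subst pi_surj dA (ts := fun i r =>
    scons (r 0%N) (scons (r 1%N) (fun i => r i.+3)) i)).
  by case=> [|[|i]]; apply: Tm_var.
move=> r; split=> [[n /(QA (scons n r))[w h]]|[w [n [_ [u [_ h]]]]]].
  exists (w +s n +s 1s), n; split=> /=; first mlra.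
  by exists w; split=> //; mlra.
by exists n; apply/(QA (scons n r)); exists u.
Qed.

Lemma Sig_or P Q : Sig P -> Sig Q -> Sig (fun r => P r \/ Q r).
Proof.
move=> [A dA PA] [B dB QB]; exists (fun r => A r \/ B r); first exact: D0_or.
move=> r; rewrite PA QB; split=> [[[w h]|[w h]]|[w [h|h]]].
- by exists w; left.
- by exists w; right.
- by left; exists w.
- by right; exists w.
Qed.

Lemma Sig_eta (P : S -> Prop) f : Sig (fun r => P (r 0%N)) -> Tm f ->
  Sig (fun r => P (f r)).
Proof. by move=> dP tf; apply: (Sig_subst pi_surj dP (ts := fun=> f)). Qed.

Lemma Sig_eta2 (P : S -> S -> Prop) f g : Sig (fun r => P (r 0%N) (r 1%N)) ->
  Tm f -> Tm g -> Sig (fun r => P (f r) (g r)).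
Proof.
move=> dP tf tg.
by apply: (Sig_subst pi_surj dP (ts := fun i => if i is 0 then f else g)); case.
Qed.

Hypothesis MI : ISig pi s.

(** Sigma_1 induction on [y] for the existence of a common bound below [y]. The disjunct [a <s y]
    makes the statement trivial where the hypothesis supplies no more witnesses. *)
Lemma collection (a : S) (R : S -> S -> Prop) :
  D0 (fun r => R (r 0%N) (r 1%N)) ->
  (forall n, n <s a -> exists w, R w n) ->
  exists b, forall n, n <s a -> exists w, w <s b /\ R w n.
Proof.
move=> dR h.
have := MI (P := fun y => exists b, a <s y \/
   forall n, n <s y -> exists w, w <s b /\ R w n).
case/(_ _ _ _ a); last 1 first.
- by move=> b [/ltm_irr//|hb]; exists b.
- apply: Sig_ex0; apply: D0_or.
    by apply: D0_lt; [apply: Tm_const|apply: Tm_var].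
  apply: D0_ball; first exact: Tm_var.
  apply: D0_bex; first exact: Tm_var.
  apply: (D0_subst pi_surj dR (ts := fun i r => scons (r 0%N) (fun=> r 1%N) i)).
  by case=> [|i]; apply: Tm_var.
- by exists 0s; right => n h0; exfalso; mlra.
- move=> y [b hb]; have [ya|nya] := pselect (y <s a); last first.
    by exists b; left; mlra.
  have [w hw] := h y ya; exists (b +s w +s 1s).
  case: hb => [hb|hb]; [left; mlra|right => n ny].
  have [ny'|[->|ny']] := ltm_total n y.
  + by have [v [vb hv]] := hb n ny'; exists v; split=> //; mlra.
  + by exists w; split=> //; mlra.
  + by exfalso; mlra.
Qed.

(** By collection the witnesses for all [n] below the bound have a common bound, and this becomes
    the single unbounded quantifier. *)
Lemma Sig_ball t (Q : S -> (nat -> S) -> Prop) : Tm t ->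
  Sig (fun r => Q (r 0%N) (fun i => r i.+1)) ->
  Sig (fun r => forall n, n <s t r -> Q n r).
Proof.
move=> tt [A dA QA].
have tt' : Tm (fun r => t (fun i => r i.+1)).
  have [u uE] := tt.
  exists (tsubst (tvar \o (fun j => if odd j then j else j.+2)) u) => r.
  rewrite uE eval_subst; congr eval; apply/funext => j /=.
  by rewrite /mix; case: ifP => oj; rewrite ?oj //= !negbK oj.
exists (fun r => forall n, n <s t (fun i => r i.+1) ->
   exists u, u <s r 0%N /\ A (scons u (scons n (fun i => r i.+1)))).
  apply: D0_ball => //.
  apply: D0_bex; first exact: Tm_var.
  apply: (D0_subst pi_surj dA (ts := fun i r =>
    scons (r 0%N) (scons (r 1%N) (fun i => r i.+3)) i)).
  by case=> [|[|i]]; apply: Tm_var.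
move=> r; split=> [h|[w h] n nt].
  have [b hb] : exists b, forall n, n <s t r ->
     exists w, w <s b /\ A (scons w (scons n r)).
    apply: (collection (R := fun w n => A (scons w (scons n r)))).
      apply: (D0_subst pi_surj dA (ts := fun i r' =>
         scons (r' 0%N) (scons (r' 1%N) r) i)).
      by case=> [|[|i]] /=; [apply: Tm_var|apply: Tm_var|apply: Tm_const].
    by move=> n nt; apply/(QA (scons n r))/h.
  by exists b.
by apply/(QA (scons n r)); have [u [_ hu]] := h n nt; exists u.
Qed.

Lemma strong_ind (P : S -> Prop) : Sig (fun r => P (r 0%N)) ->
  (forall n, (forall m, m <s n -> P m) -> P n) -> forall n, P n.
Proof.
move=> dP h n; suff : forall k, k <s n +s 1s -> P k by apply; mlra.
move: (n +s 1s); apply: MI.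
- apply: Sig_ball; first exact: Tm_var.
  exact: (@Sig_eta P (fun r => r 0%N) dP (Tm_var _ _)).
- by move=> k h0; exfalso; mlra.
- move=> m IH k km; apply: h => j jk; apply: IH; mlra.
Qed.

(** Both forcings find their m here: what holds below m is Sigma_1, so its failure has a least
    instance. *)
Lemma least_notSig (P : S -> Prop) : Sig (fun r => P (r 0%N)) ->
  forall n, ~ P n -> exists m, ~ P m /\ forall i, i <s m -> P i.
Proof.
move=> dP n nPn; apply: contrapT => h; apply: nPn; move: n.
apply: strong_ind => // n IH; apply: contrapT => nPn; apply: h.
by exists n.
Qed.

(* Running the refutation downwards: [P] fails at [a - k] for all [k <= a]. *)
Lemma Pi_ind (P : S -> Prop) : Sig (fun r => ~ P (r 0%N)) -> P 0s ->
  (forall n, P n -> P (n +s 1s)) -> forall n, P n.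
Proof.
move=> dP P0 PS a; apply: contrapT => nPa.
have := MI (P := fun k => a <s k \/ exists j, j +s k = a /\ ~ P j).
case/(_ _ _ _ a); last 2 first.
- exact: ltm_irr.
- move=> [j [e nPj]]; apply: nPj; suff -> : j = 0s by [].
  mlra.
- apply: Sig_or.
    by apply: Sig_D0 => //; apply: D0_lt; [apply: Tm_const|apply: Tm_var].
  apply: Sig_ex; apply: Sig_and.
    apply: Sig_D0 => //; apply: D0_eq; last exact: Tm_const.
    by apply: Tm_add; apply: Tm_var.
  exact: (@Sig_eta (fun x => ~ P x) (fun r => r 0%N) dP (Tm_var _ _)).
- by right; exists a; rewrite addm0.
- move=> k [h|[j [e nPj]]]; first by left; mlra.
  have [j0|[j0|/lemP[i jE]]] := ltm_total j 0s; first by exfalso; mlra.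
    by left; mlra.
  right; exists i; split; first by mlra.
  by move=> Pi; apply: nPj; rewrite (_ : j = i +s 1s); [apply: PS|mlra].
Qed.

End SigClosure.

#[global] Hint Extern 1 (term_def _ _) => dtm : defin.

Ltac ddef := lazymatch goal with
  | |- term_def _ _ => dtm
  | |- delta0_def _ _ (fun r => @?P r /\ @?Q r) => apply: D0_and; ddef
  | |- delta0_def _ _ (fun r => @?P r \/ @?Q r) => apply: D0_or; ddef
  | |- delta0_def _ _ (fun r => ~ @?P r) => apply: D0_not; ddef
  | |- delta0_def _ _ (fun r => @?P r <-> @?Q r) => apply: D0_iff; ddef
  | |- delta0_def _ _ (fun r => exists n, alt n (@?t r) /\ _) =>
      apply: D0_bex; ddef
  | |- delta0_def _ _ (fun r => forall n, alt n (@?t r) -> _) =>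
      apply: D0_ball; ddef
  | |- delta0_def _ _ (fun r => @?P r -> @?Q r) => apply: D0_imp; ddef
  | |- delta0_def _ _ (fun r => @eq (dom _) _ _) => apply: D0_eq; ddef
  | |- delta0_def _ _ (fun r => alt _ _) => apply: D0_lt; ddef
  | |- sigma1_def _ _ (fun r => @?P r /\ @?Q r) => apply: Sig_and; ddef
  | |- sigma1_def _ _ (fun r => @?P r \/ @?Q r) => apply: Sig_or; ddef
  | |- sigma1_def _ _ (fun r => exists n, alt n (@?t r) /\ @?Q r n) =>
      first [solve [apply: Sig_D0 => //; ddef] | apply: Sig_ex; ddef]
  | |- sigma1_def _ _ (fun r => exists n, _) => apply: Sig_ex; ddef
  | |- sigma1_def _ _ (fun r => forall n, alt n (@?t r) -> _) =>
      first [solve [apply: Sig_D0 => //; ddef] | apply: Sig_ball; ddef]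
  | |- sigma1_def _ _ _ => first [solve [eauto 3 with defin] | apply: Sig_D0 => //; ddef]
  | |- delta0_def _ _ _ => first [assumption | solve [eauto 3 with defin] | apply: D0_cst]
  | |- ISig _ _ => assumption
  | |- _ => by []
  end.

(** * Powers of two and binary strings *)

Section Strings.
Variables (S : dsr) (pi : nat -> S).
Hypothesis pi_surj : forall x, exists k, pi k = x.
Variable s : nat -> S -> Prop.
Hypothesis MI : ISig pi s.
Local Notation D0 := (delta0_def pi s).
Local Notation Sig := (sigma1_def pi s).
Local Notation Tm := (term_def pi).
Implicit Types p q x y d c t u v : S.

Lemma zero_or_S x : x = 0s \/ exists y, x = y +s 1s.
Proof.
have [|[->|/lemP[k ->]]] := ltm_total x 0s; [by move=> h; exfalso; mlra|by left|].
by right; exists k; rewrite [0s +s k]addmC addm0.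
Qed.

Lemma parity x : exists y, x = y +s y \/ x = y +s y +s 1s.
Proof.
move: x; apply: MI; first ddef.
  by exists 0s; left; mlra.
move=> n [y [->|->]]; first by exists y; right.
by exists (y +s 1s); left; mlra.
Qed.

Lemma even_odd x y : x +s x <> y +s y +s 1s.
Proof.
move=> h; have [l|[l|l]] := ltm_total x y.
- mlra.
- by rewrite l in h; mlra.
- mlra.
Qed.

Lemma double_inj x y : x +s x = y +s y -> x = y.
Proof. move=> h; mlra. Qed.

Lemma euclid d x : 0s <s d -> exists q r, x = q *s d +s r /\ r <s d.
Proof.
move=> d0; move: x; apply: MI; first ddef.
  by exists 0s, 0s; split=> //; mlra.
move=> n [q [r [-> rd]]].
have [h|[h|h]] := ltm_total (r +s 1s) d.
- by exists q, (r +s 1s); split=> //; mlra.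
- by exists (q +s 1s), 0s; split=> //; rewrite -h; mring.
- by exfalso; mlra.
Qed.

Lemma euclid_uniq d q (r : S) q' (r' : S) : q *s d +s r = q' *s d +s r' ->
  r <s d -> r' <s d -> q = q' /\ r = r'.
Proof.
move=> e rd rd'; have [h|[h|h]] := ltm_total q q'.
- exfalso; have [k kE] : exists k, q' = q +s k +s 1s by apply/lemP.
  by rewrite kE in e; mnra.
- by split=> //; rewrite h in e; mlra.
- exfalso; have [k kE] : exists k, q = q' +s k +s 1s by apply/lemP.
  by rewrite kE in e; mnra.
Qed.

Definition pow2 p : Prop := forall d c, p = d *s c ->
  d = 1s \/ exists b, d = b +s b.

Lemma pow2_gt0 p : pow2 p -> 0s <s p.
Proof.
move=> h; have [pE|[y ->]] := zero_or_S p; last by mlra.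
(* Everything divides 0, in particular 3, which is neither 1 nor even. *)
rewrite pE in h; have [e|[b]] := h (1s +s 1s +s 1s) 0s (esym (mulm0 _)).
  by exfalso; mlra.
by move=> e; case: (@even_odd b 1s).
Qed.

Lemma pow2_neq0 p : pow2 p -> p <> 0s.
Proof. by move=> /pow2_gt0 h e; rewrite e in h; mlra. Qed.

Lemma D0_pow2 f : Tm f -> D0 (fun r => pow2 (f r)).
Proof.
apply: (D0_eta pi_surj (P := pow2)).
(* Zero is excluded explicitly, because only the divisors of a positive number are bounded by it. *)
apply: D0_ext (_ : D0 (fun r => (r 0%N <> 0s) /\
  forall d, d <s r 0%N +s 1s -> forall c, c <s r 0%N +s 1s -> r 0%N = d *s c ->
   d = 1s \/ exists b, b <s d +s 1s /\ d = b +s b)); last by ddef.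
move=> r; split=> [[n0 h] d c e|h].
  have [d0|[d' dE]] := zero_or_S d.
    by case: n0; rewrite e d0 mulmC mulm0.
  have [c0|[c' cE]] := zero_or_S c.
    by case: n0; rewrite e c0 mulm0.
  have [||->|[b [_ ->]]] := h d _ c _ e; try (rewrite e dE cE; mnra).
    by left.
  by right; exists b.
split; first exact: pow2_neq0.
move=> d _ c _ /h[->|[b ->]]; [by left|right; exists b; split=> //; mlra].
Qed.
#[local] Hint Resolve D0_pow2 : defin.

Lemma pow2_1 : pow2 1s.
Proof.
move=> d c; have [->|[d' ->]] := zero_or_S d.
  by rewrite mulmC mulm0 => /one_neq0.
have [->|[c' ->]] := zero_or_S c; first by rewrite mulm0 => /one_neq0.
move=> e; left.
have [->|[d'' E]] := zero_or_S d'; [mlra|rewrite E in e].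
by exfalso; mnra.
Qed.

(** An odd divisor of 2p has an even cofactor, hence divides p, and so is 1. *)
Lemma pow2_double p : pow2 p -> pow2 (p +s p).
Proof.
move=> hp d c e; have [d' [dE|dE]] := parity d; first by right; exists d'.
have [c' [cE|cE]] := parity c; last first.
  case: (@even_odd p (d' *s c' +s d' *s c' +s d' +s c')).
  by rewrite e dE cE; mring.
left; have [|//|[b bE]] := hp d c'.
  by apply: double_inj; rewrite e cE; mring.
by case: (@even_odd b d'); rewrite -bE.
Qed.

Lemma pow2_half p : pow2 p -> p = 1s \/ exists q, p = q +s q /\ pow2 q.
Proof.
move=> hp; have [|[q qE]] := hp p 1s (esym (mulm1 _)); [by left|right].
exists q; split=> // d c e; apply: (hp d (c +s c)).
by rewrite qE e; mring.
Qed.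

Lemma pow2_mul p q : pow2 p -> pow2 q -> pow2 (p *s q).
Proof.
move=> hp hq; move: hp; move: p; apply: (strong_ind pi_surj MI) => [|p IH hp].
  by ddef.
have [->|[p' [pE hp']]] := pow2_half hp; first by rewrite mulmC mulm1.
rewrite pE mulmDl; apply/pow2_double/IH => //.
by have := pow2_gt0 hp'; rewrite pE => h; mlra.
Qed.

Lemma pow2_dvd p q : pow2 p -> pow2 q -> p <=s q ->
  exists c, q = p *s c /\ pow2 c.
Proof.
move=> hp hq pq.
(* Both powers are halved until the divisor is 1. Bounding [u] by [q] and [c] by [u] makes the
   induction statement Delta_0. *)
suff H : forall p, forall u, u <s q +s 1s -> pow2 p -> pow2 u -> ~ u <s p ->
    exists c, c <s u +s 1s /\ (u = p *s c /\ pow2 c).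
  have [|//|//||c [_ h]] := H p q; [mlra|by mlra|by exists c].
move=> {hp hq pq p}; apply: (strong_ind pi_surj MI) => [|p IH u uq hp hu up].
  by ddef.
have [->|[p' [pE hp']]] := pow2_half hp.
  by exists u; split; [mlra|rewrite mulmC mulm1].
have p'0 := pow2_gt0 hp'.
have [uE|[u' [uE hu']]] := pow2_half hu; first by exfalso; rewrite uE pE in up; mlra.
have [|||||c [cu [cE hc]]] := IH p' _ u' => //; try (rewrite pE ?uE in up *; mlra).
exists c; split; first by rewrite uE; mlra.
by split=> //; rewrite uE pE cE; mring.
Qed.

Lemma pow2_unbounded x : exists p, pow2 p /\ x <s p.
Proof.
move: x; apply: MI; first by ddef.
  by exists 1s; split; [exact: pow2_1|mlra].
move=> n [p [hp h]]; exists (p +s p); split; first exact: pow2_double.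
have := pow2_gt0 hp => h0; mlra.
Qed.

(** Used with [x = u + 1], for which [p] is 2 to the length of the string [u]; this addresses levels
    without exponentiation. *)
Definition at_level p x : Prop := ~ x <s p /\ x <s p +s p.

Lemma pow2_level x : 0s <s x -> exists p, pow2 p /\ at_level p x.
Proof.
have H : forall y, exists p, pow2 p /\ at_level p (y +s 1s).
  apply: MI; first by rewrite /at_level; ddef.
    by exists 1s; split; [exact: pow2_1|split; mlra].
  move=> n [p [hp [h1 h2]]].
  have [h|h] := pselect (n +s 1s +s 1s <s p +s p).
    by exists p; split=> //; split=> //; mlra.
  exists (p +s p); split; first exact: pow2_double.
  by have := pow2_gt0 hp => h0; split; mlra.
move=> x0; have [xE|[y ->]] := zero_or_S x; last exact: H.
by rewrite xE in x0; exfalso; mlra.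
Qed.

Lemma pow2_lt_double p q : pow2 p -> pow2 q -> p <s q -> p +s p <=s q.
Proof.
move=> hp hq pq; have [|c [qE hc]] := pow2_dvd hp hq; first by mlra.
have [cE|[c' [cE hc']]] := pow2_half hc.
  by rewrite qE cE mulm1 in pq; exfalso; mlra.
by have := pow2_gt0 hc'; rewrite qE cE => h; have := pow2_gt0 hp; mnra.
Qed.

Lemma level_uniq p q x : pow2 p -> pow2 q -> at_level p x -> at_level q x ->
  p = q.
Proof.
move=> hp hq [h1 h2] [h3 h4]; have [h|[//|h]] := ltm_total p q.
  by have := pow2_lt_double hp hq h => h5; exfalso; mlra.
by have := pow2_lt_double hq hp h => h5; exfalso; mlra.
Qed.

Definition pre t u : Prop := exists p r, pow2 p /\ r <s p /\
  u +s 1s = (t +s 1s) *s p +s r.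

Lemma D0_pre f g : Tm f -> Tm g -> D0 (fun r => pre (f r) (g r)).
Proof.
apply: (D0_eta2 pi_surj (P := pre)).
apply: D0_ext (_ : D0 (fun r => exists p, p <s r 1%N +s 1s +s 1s /\
  exists q, q <s r 1%N +s 1s +s 1s /\ (pow2 p /\ q <s p /\
  r 1%N +s 1s = (r 0%N +s 1s) *s p +s q))).
- move=> r; move: (r 0%N) (r 1%N) => t u.
  split=> [[p [_ [q [_ h]]]]|[p [q [hp [qp e]]]]].
    by exists p, q.
  have p0 := pow2_gt0 hp.
  by exists p; split; [|exists q; split=> //]; zify_m; nra.
- by ddef.
Qed.
#[local] Hint Resolve D0_pre : defin.

Lemma pre_refl t : pre t t.
Proof. by exists 1s, 0s; split; [exact: pow2_1|split; mlra]. Qed.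

Lemma pre_le t u : pre t u -> t <=s u.
Proof. by move=> [p [q [/pow2_gt0 hp [qp e]]]]; mnra. Qed.

Lemma pre_trans t u v : pre t u -> pre u v -> pre t v.
Proof.
move=> [p [a [hp [ap e]]]] [q [b [hq [bq e']]]].
exists (p *s q), (a *s q +s b); split; first exact: pow2_mul.
split; last by rewrite e' e; mring.
have [k ->] : exists k, p = a +s k +s 1s by apply/lemP.
zify_m; nra.
Qed.

Lemma pre0 u : pre 0s u.
Proof.
have [|p [hp [h1 h2]]] := @pow2_level (u +s 1s); first mlra.
have [k kE] := @zi_sub S p (u +s 1s) (proj1 (nalt_ziP _ _) h1).
exists p, k; split=> //; split; mlra.
Qed.

(** The longer prefix [t'] cuts off the smaller power: p' <= p, so p = p' c. Dividing the part cut
    off with [t] by p' and comparing quotients shows that [t] arises from [t'] by cutting off the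
    factor c. *)
Lemma pre_total t t' u : pre t u -> pre t' u -> t <=s t' -> pre t t'.
Proof.
move=> [p [a [hp [ap e]]]] [p' [a' [hp' [ap' e']]]] tt'.
have p'p : p' <=s p.
  rewrite leNgt; apply/negP => /zi_ltP pp'.
  have := pow2_lt_double hp hp' pp' => h; have h0 := pow2_gt0 hp.
  move: e'; rewrite e => /(f_equal (@zi _)).
  zify_m => e1.
  have h3 : (zi t' + 1) * (zi p + zi p) <= (zi t' + 1) * zi p'.
    by apply: ler_wpM2l => //; lra.
  have h4 : (zi t + 1) * zi p <= (zi t' + 1) * zi p.
    by apply: ler_wpM2r => //; lra.
  nra.
have [c [pE hc]] := pow2_dvd hp' hp p'p.
have p'0 := pow2_gt0 hp'; have c0 := pow2_gt0 hc.
have [b [b' [aE b'p]]] := euclid a p'0.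
have [] : t' +s 1s = (t +s 1s) *s c +s b /\ a' = b'.
  apply: (@euclid_uniq p') => //; rewrite -e' e pE aE; mring.
move=> E _; exists c, b; split=> //; split=> //.
move: ap; rewrite aE pE => h; have [//|[bc|cb]] := ltm_total b c.
  by rewrite bc in h; exfalso; zify_m; nra.
have [k kE] : exists k, b = c +s k +s 1s by apply/lemP.
by rewrite kE in h; exfalso; zify_m; nra.
Qed.

Definition ch0 t := t +s t +s 1s.
Definition ch1 t := t +s t +s 1s +s 1s.

Lemma pre_ch0 t : pre t (ch0 t).
Proof.
exists (1s +s 1s), 0s; split; first exact/pow2_double/pow2_1.
by rewrite /ch0; split; mlra.
Qed.

Lemma pre_ch1 t : pre t (ch1 t).
Proof.
exists (1s +s 1s), 1s; split; first exact/pow2_double/pow2_1.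
by rewrite /ch1; split; mlra.
Qed.

(** If the part cut off is [a] below p = 2q, the digit following [t] in [u] is 0 or 1 according to
    whether a < q. *)
Lemma pre_lt_child t u : pre t u -> t <> u -> pre (ch0 t) u \/ pre (ch1 t) u.
Proof.
move=> [p [a [hp [ap e]]]] tu; have [pE|[q [pE hq]]] := pow2_half hp.
  by case: tu; rewrite pE in e ap; mlra.
have [h|h] := pselect (a <s q).
  left; exists q, a; split=> //; split=> //.
  by rewrite e pE /ch0; mring.
have [k kE] := @zi_sub S q a (proj1 (nalt_ziP _ _) h).
right; exists q, k; split=> //; split; first by rewrite pE in ap; mlra.
by apply: zi_inj; rewrite e pE /ch1 !(ziD, ziM, zi1) kE; ring.
Qed.

(** If u + 1 lies at level p c, the quotient of u + 1 by c lies at level p. *)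
Lemma pre_restrict p u : pow2 p -> p <=s u +s 1s ->
  exists t, pre t u /\ at_level p (t +s 1s).
Proof.
move=> hp pu; have [|q [hq [h1 h2]]] := @pow2_level (u +s 1s); first mlra.
have pq : p <=s q.
  rewrite leNgt; apply/negP => /zi_ltP qp.
  by have := pow2_lt_double hq hp qp => h; zify_m; lra.
have [c [qE hc]] := pow2_dvd hp hq pq; have c0 := pow2_gt0 hc.
have p0 := pow2_gt0 hp.
have [x [r [uE rc]]] := euclid (u +s 1s) c0.
have px : p <=s x.
  rewrite leNgt; apply/negP => /zi_ltP /lemP [k kE].
  by rewrite uE qE kE in h1; zify_m; nra.
have [xE|[t xE]] := zero_or_S x; first by rewrite xE in px; exfalso; zify_m; lra.
exists t; split; first by exists c, r; rewrite -xE.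
rewrite -xE; split; first by mlra.
have [//|h] := ltm_total x (p +s p); exfalso.
have [k kE] : exists k, x = p +s p +s k.
  case: h => [->|/lemP[k ->]]; first by exists 0s; rewrite addm0.
  by exists (k +s 1s); mring.
by rewrite uE qE kE in h2; zify_m; nra.
Qed.

Lemma pre_extend p t : pow2 p -> exists u, pre t u /\ p <=s u +s 1s.
Proof.
move=> hp; have p0 := pow2_gt0 hp.
have [e|[u uE]] := zero_or_S ((t +s 1s) *s p).
  by exfalso; zify_m; nra.
exists u; split; first by exists p, 0s; split=> //; split=> //; rewrite -uE addm0.
by rewrite -uE; zify_m; nra.
Qed.

End Strings.

(** * Exponentiation *)

Section Exponential.
Variables (S : dsr) (pi : nat -> S).
Hypothesis pi_surj : forall x, exists k, pi k = x.
Variable s : nat -> S -> Prop.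
Hypothesis MI : ISig pi s.
Local Notation D0 := (delta0_def pi s).
Local Notation Sig := (sigma1_def pi s).
Local Notation Tm := (term_def pi).
Implicit Types p q x y b c i j n m t u v : S.
#[local] Hint Resolve D0_pow2 D0_pre : defin.

Lemma le_mulm x y : 0s <s x -> y <=s x *s y.
Proof.
move=> /lemP[k ->]; have := zi_ge0 (k *s y) => h; zify_m; lra.
Qed.

Lemma mulm_gt0 x y : 0s <s x -> 0s <s y -> 0s <s x *s y.
Proof. by move=> h1 h2; have := le_mulm y h1 => h; mlra. Qed.

(** Modulo b^2 the power (b + 1)^n is 1 + n b, so the first power of b + 1 after 1 to be congruent
    to 1 is (b + 1)^b. Since b + 1 is a power of two, every power of two congruent to 1 modulo b is
    a power of b + 1. *)
Definition no_wrap b (Q : S) : Prop := forall q, q <s Q +s 1s -> pow2 q ->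
  (exists l, l <s q +s 1s /\ q = 1s +s b *s b *s l) -> q = 1s.

(* [Q] is the [n]-th power of [b + 1], for [n < b]: a power [1 + b k] of
   [b + 1] has exponent congruent to [k] modulo [b], and [no_wrap] excludes
   exponents that reach [b]. *)
Definition pw b (Q : S) n : Prop := pow2 (b +s 1s) /\ pow2 Q /\ n <s b /\
  (exists j, Q = 1s +s b *s (n +s b *s j)) /\ no_wrap b Q.

Lemma Sig_pw f g h : Tm f -> Tm g -> Tm h ->
  Sig (fun r => pw (f r) (g r) (h r)).
Proof.
move=> tf tg th.
refine (Sig_subst pi_surj (P := fun r => pw (r 0%N) (r 1%N) (r 2%N))
  (ts := fun k => if k is 0%N then f else if k is 1%N then g else h) _ _).
  by rewrite /pw /no_wrap; ddef.
by case=> [|[]].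
Qed.
#[local] Hint Resolve Sig_pw : defin.

Lemma pw0 b : pow2 (b +s 1s) -> 0s <s b -> pw b 1s 0s.
Proof.
move=> hb b0; split=> //; split; first exact: pow2_1.
split=> //; split; first by exists 0s; mring.
move=> q q1 hq _; have := pow2_gt0 hq => q0; mlra.
Qed.

Lemma pw0_inv b Q : pw b Q 0s -> Q = 1s.
Proof.
move=> [_ [hQ [b0 [[j jE] nw]]]]; apply: (nw Q) => //; first mlra.
exists j; split; last by rewrite jE; mring.
by rewrite jE; have := le_mulm j (mulm_gt0 b0 b0) => h1; mlra.
Qed.

Lemma mod1_small b c m l : 1s <s c -> c <=s b +s 1s ->
  c +s b *s m = 1s +s b *s l -> c = b +s 1s.
Proof.
move=> c1 cb e.
have [h|[h|/lemP[k kE]]] := ltm_total m l.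
- have [k kE] : exists k, l = m +s k +s 1s by apply/lemP.
  by rewrite kE in e; zify_m; nra.
- by rewrite h in e; exfalso; mlra.
- by exfalso; rewrite kE in e; zify_m; nra.
Qed.

(** A forbidden q between Q and Q (b + 1) would be Q c with 1 < c <= b + 1. Modulo b this forces c =
    b + 1, and then b would divide i + 1, which is positive and less than b. *)
Lemma pwS b Q i : pw b Q i -> i +s 1s <s b -> pw b (Q *s (b +s 1s)) (i +s 1s).
Proof.
move=> [hb [hQ [ib [[j jE] nw]]]] ib'; split=> //.
have hQB := pow2_mul pi_surj MI hQ hb.
split=> //; split=> //.
have E : Q *s (b +s 1s) = 1s +s b *s (i +s 1s +s b *s (j +s i +s b *s j)).
  by rewrite jE; mring.
split; first by exists (j +s i +s b *s j).
move=> q qQ hq [l [_ lE]].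
have [h|h] := pselect (q <s Q +s 1s).
  apply: (nw q) => //; exists l; split=> //; rewrite lE.
    have b0 : 0s <s b by mlra.
    by have := le_mulm l (mulm_gt0 b0 b0) => h1; mlra.
have [|c [qE hc]] := pow2_dvd pi_surj MI hQ hq; first by mlra.
have cB : c = b +s 1s.
  have Q0 := pow2_gt0 hQ.
  apply: (@mod1_small _ _ ((i +s b *s j) *s c) (b *s l)).
  - have [//|[c1|c1]] := ltm_total 1s c.
      by rewrite -c1 mulm1 in qE; rewrite qE in h; exfalso; mlra.
    by rewrite qE in h; exfalso; zify_m; nra.
  - rewrite leNgt; apply/negP => /zi_ltP hbc; rewrite qE in qQ.
    by zify_m; nra.
  - transitivity (Q *s c); first by rewrite jE; mring.
    by rewrite -qE lE; mring.
exfalso; move: lE; rewrite qE cB E => e.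
have b0 : 0s <s b by mlra.
move: (j +s i +s b *s j) e => j' e {E}.
have e2 : i +s 1s +s b *s j' = b *s l.
  apply: zi_inj; have b0' : zi b != 0.
    by apply/eqP => z; zify_m; lra.
  apply: (mulfI b0'); zify_m; lra.
have [hl|[hl|hl]] := ltm_total l j'.
- by zify_m; nra.
- by rewrite hl in e2; mlra.
- by zify_m; nra.
Qed.

Lemma pwS_inv b Q n : pw b Q (n +s 1s) -> exists R,
  Q = R *s (b +s 1s) /\ pw b R n.
Proof.
move=> [hb [hQ [nb [[j jE] nw]]]].
have [|R [QE hR]] := pow2_dvd pi_surj MI hb hQ.
  by rewrite jE; zify_m; nra.
exists R; split; first by rewrite QE mulmC.
split=> //; split=> //; split; first by mlra.
split; last first.
  move=> q qR; apply: nw; rewrite QE.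
  by zify_m; nra.
have R0 := pow2_gt0 hR.
have [k kE] : exists k, R = 0s +s k +s 1s by apply/lemP.
move: (jE); rewrite QE kE => e.
(* [k + b k = b (n + b j)], so [k = b m] and [m + b m = n + b j] *)
have e1 : k +s b *s k = b *s (n +s b *s j) by mlra.
have [m mE] : exists m, zi m = zi (n +s b *s j) - zi k.
  by apply: zi_sub; zify_m; nra.
have kb : k = b *s m by apply: zi_inj; rewrite ziM mE; zify_m; lra.
have e2 : m +s b *s m = n +s b *s j by apply: zi_inj; rewrite kb in mE; zify_m; lra.
have [l lE] : exists l, zi l = zi j - zi m.
  apply: zi_sub; rewrite leNgt; apply/negP => /zi_ltP /lemP [l lE].
  by rewrite lE in e2; zify_m; nra.
exists l; rewrite kb; apply: zi_inj.
rewrite !(ziD, ziM, zi0, zi1) lE.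
have e3 := f_equal (@zi _) e2; rewrite !(ziD, ziM) in e3.
have -> : zi n + zi b * (zi j - zi m) = zi m by lra.
by ring.
Qed.

(** The ratio doubles at each step. [Q] and [R] are universally quantified under the Sigma_1 premise
    [pw], so the statement is Pi_1 and calls for [Pi_ind]. *)
Lemma pw_ratio b n : n <s b -> forall (Q R : S),
  pw b Q n -> pw (b +s b +s 1s) R n -> exists p, pow2 p /\ R = p *s Q.
Proof.
move=> nb Q R hQ hR.
suff H : forall n, n <s b -> forall Q R, pw b Q n -> pw (b +s b +s 1s) R n ->
    exists p, p <s R +s 1s /\ (pow2 p /\ R = p *s Q).
  by have [p [_ hp]] := H n nb Q R hQ hR; exists p.
move=> {n nb Q R hQ hR}; apply: (Pi_ind pi_surj MI) => [||n IH nb Q R hQ hR].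
- apply: Sig_ext (_ : Sig (fun r => r 0%N <s b /\ (exists Q R, (pw b Q (r 0%N) /\
    pw (b +s b +s 1s) R (r 0%N)) /\
    ~ exists p, p <s R +s 1s /\ (pow2 p /\ R = p *s Q)))); last by ddef.
  move=> r; split=> [[nb [Q [R [[h1 h2] h3]]]] h|h].
    by apply: h3; apply: h.
  apply: contrapT => h'; apply: h => nb Q R h1 h2; apply: contrapT => h3.
  by apply: h'; split=> //; exists Q, R.
- move=> b0 Q R /pw0_inv -> /pw0_inv ->; exists 1s.
  by split; [mlra|split; [exact: pow2_1|mring]].
- have [Q' [QE hQ']] := pwS_inv hQ; have [R' [RE hR']] := pwS_inv hR.
  have [|p [_ [hp pE]]] := IH _ Q' R' hQ' hR'; first by mlra.
  exists (p +s p); split; last first.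
    split; first exact: (pow2_double pi_surj MI).
    by rewrite RE QE pE; mring.
  have Q'0 : 0s <s Q' by have [_ [/pow2_gt0]] := hQ'.
  have b0 : 0s <s b by mlra.
  have := le_mulm p Q'0; rewrite mulmC -pE => h.
  have := le_mulm R' b0 => h'.
  by rewrite RE; zify_m; lra.
Qed.

(** The second base is twice the first, so the n-th powers of the two bases differ by the factor
    2^n. Each power carries its exponent as a residue, which replaces coding a sequence of
    doublings. *)
Definition Exp n p : Prop := exists b (Q : S), n <s b /\ pw b Q n /\
  pw (b +s b +s 1s) (p *s Q) n.

Lemma Sig_Exp f g : Tm f -> Tm g -> Sig (fun r => Exp (f r) (g r)).
Proof. by apply: (Sig_eta2 pi_surj); rewrite /Exp; ddef. Qed.
#[local] Hint Resolve Sig_Exp : defin.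

Lemma mulm_inj p q x : 0s <s x -> p *s x = q *s x -> p = q.
Proof.
move=> x0 e; have [h|[//|h]] := ltm_total p q.
  by move: h => /lemP[k kE]; rewrite kE in e; exfalso; zify_m; nra.
by move: h => /lemP[k kE]; rewrite kE in e; exfalso; zify_m; nra.
Qed.

Lemma Exp_pow2 n p : Exp n p -> pow2 p.
Proof.
move=> [b [Q [nb [hQ hR]]]]; have [p' [hp' e]] := pw_ratio nb hQ hR.
have Q0 : 0s <s Q by have [_ [/pow2_gt0]] := hQ.
by rewrite (mulm_inj Q0 e).
Qed.

Lemma Exp0 p : Exp 0s p -> p = 1s.
Proof.
by move=> [b [Q [nb [/pw0_inv -> /pw0_inv]]]]; rewrite mulm1.
Qed.

Lemma Exp_inv n p : Exp (n +s 1s) p -> exists q, p = q +s q /\ Exp n q.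
Proof.
move=> [b [Q [nb [hQ hR]]]].
have [Q' [QE hQ']] := pwS_inv hQ; have [R' [RE hR']] := pwS_inv hR.
have nb' : n <s b by mlra.
have [q [hq e]] := pw_ratio nb' hQ' hR'; exists q; split; last first.
  by exists b, Q'; rewrite -e.
have Q'0 : 0s <s Q by have [_ [/pow2_gt0]] := hQ.
by apply: (mulm_inj Q'0); rewrite RE e QE; mring.
Qed.

Lemma Exp_uniq n p q : Exp n p -> Exp n q -> p = q.
Proof.
move: n p q; apply: (Pi_ind pi_surj MI) => [||n IH p q].
- apply: Sig_ext (_ : Sig (fun r => exists p q, (Exp (r 0%N) p /\
    Exp (r 0%N) q) /\ ~ (p = q))); last by ddef.
  move=> r; split=> [[p [q [[h1 h2] h3]]] h|h].
    by apply: h3; apply: h h1 h2.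
  apply: contrapT => h'; apply: h => p q h1 h2; apply: contrapT => h3.
  by apply: h'; exists p, q.
- by move=> p q /Exp0 -> /Exp0 ->.
- by move=> /Exp_inv[p' [-> hp]] /Exp_inv[q' [-> hq]]; rewrite (IH _ _ hp hq).
Qed.

(** [pw] needs a base above the exponent, so [b] is fixed first, above [n], and the induction builds
    both powers up to exponent [n]. The disjunct [n <s i] covers the exponents beyond it. *)
Lemma Exp_ex n : exists p, Exp n p.
Proof.
have [B [hB nB]] := pow2_unbounded pi_surj MI (n +s 1s +s 1s).
have [B0|[b bE]] := zero_or_S B; first by rewrite B0 in nB; exfalso; mlra.
have b2 : pow2 (b +s b +s 1s +s 1s).
  have := pow2_double pi_surj MI hB; rewrite bE; congr pow2; mring.
rewrite bE in hB nB.
have H : forall i, n <s i \/ exists Q R, pw b Q i /\ pw (b +s b +s 1s) R i.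
  apply: MI; first by ddef.
    by right; exists 1s, 1s; split; apply: pw0 => //; mlra.
  move=> i [h|[Q [R [hQ hR]]]]; first by left; mlra.
  have [h|h] := pselect (n <s i +s 1s); first by left.
  right; exists (Q *s (b +s 1s)), (R *s (b +s b +s 1s +s 1s)).
  by split; apply: pwS => //; mlra.
have [/ltm_irr//|[Q [R [hQ hR]]]] := H n.
have nb : n <s b by mlra.
have [p [_ e]] := pw_ratio nb hQ hR; exists p, b, Q.
by rewrite -e.
Qed.

(** Not a term of the language: in definability proofs it enters only through its Sigma_1 graph, as
    [exists p, p = two_pow _ /\ _]. *)
Definition two_pow n : S := projT1 (cid (Exp_ex n)).

Lemma two_powP n p : p = two_pow n <-> Exp n p.
Proof.
rewrite /two_pow; case: cid => q /= hq; split=> [->//|hp].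
exact: Exp_uniq hp hq.
Qed.

Lemma two_pow0 : two_pow 0s = 1s. Proof. exact/Exp0/two_powP. Qed.

Lemma two_powS n : two_pow (n +s 1s) = two_pow n +s two_pow n.
Proof.
have /two_powP/Exp_inv[q [-> /two_powP ->]] // : two_pow (n +s 1s) = two_pow (n +s 1s) by [].
Qed.

Lemma pow2_two_pow n : pow2 (two_pow n). Proof. exact/(Exp_pow2 (n := n))/two_powP. Qed.
Lemma two_pow_gt0 n : 0s <s two_pow n. Proof. exact/pow2_gt0/pow2_two_pow. Qed.

Lemma Sig_two_pow f g : Tm f -> Tm g -> Sig (fun r => f r = two_pow (g r)).
Proof.
move=> tf tg; apply: Sig_ext (Sig_Exp tg tf) => r.
by rewrite two_powP.
Qed.
#[local] Hint Resolve Sig_two_pow : defin.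

Lemma two_pow_gt n : n <s two_pow n.
Proof.
move: n; apply: MI.
- apply: Sig_ext (_ : Sig (fun r => exists p, p = two_pow (r 0%N) /\ r 0%N <s p)).
    by move=> r; split=> [[p [->]]//|h]; exists (two_pow (r 0%N)).
  by ddef.
- by rewrite two_pow0; mlra.
- by move=> n h; rewrite two_powS; mlra.
Qed.

Lemma two_pow_lt_add n k : two_pow n <s two_pow (n +s k +s 1s).
Proof.
move: k; apply: MI.
- apply: Sig_ext (_ : Sig (fun r => exists p, p = two_pow (n +s r 0%N +s 1s) /\
    two_pow n <s p)); last by ddef.
  by move=> r; split=> [[p [->]]//|h]; exists (two_pow (n +s r 0%N +s 1s)).
- by rewrite addm0 two_powS; have := two_pow_gt0 n => h; mlra.
- move=> k h; rewrite two_powS (_ : n +s (k +s 1s) = n +s k +s 1s); last by mring.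
  by have := two_pow_gt0 (n +s k +s 1s) => h0; zify_m; lra.
Qed.

Lemma two_pow_lt m n : m <s n -> two_pow m <s two_pow n.
Proof. by move=> /lemP[k ->]; apply: two_pow_lt_add. Qed.

Lemma two_pow_le m n : m <=s n -> two_pow m <=s two_pow n.
Proof.
move=> h; have [/two_pow_lt h'|[->//|h']] := ltm_total m n; first by mlra.
by exfalso; mlra.
Qed.

Definition has_length (t n : S) : Prop := at_level (two_pow n) (t +s 1s).

Lemma strlenE t n : has_length t n <-> exists p, p = two_pow n /\ at_level p (t +s 1s).
Proof. by split=> [h|[p [->]]//]; exists (two_pow n). Qed.

Lemma Sig_strlen f g : Tm f -> Tm g -> Sig (fun r => has_length (f r) (g r)).
Proof.
apply: (Sig_eta2 pi_surj).
apply: Sig_ext (_ : Sig (fun r => exists p, p = two_pow (r 1%N) /\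
  at_level p (r 0%N +s 1s))); last by rewrite /at_level; ddef.
by move=> r; rewrite strlenE.
Qed.

Lemma strlen0 : has_length 0s 0s.
Proof. by rewrite /has_length two_pow0; split; mlra. Qed.

Lemma strlen_ch t n u : has_length t n -> u = ch0 t \/ u = ch1 t ->
  has_length u (n +s 1s).
Proof.
rewrite /has_length /at_level two_powS /ch0 /ch1 => -[h1 h2] [->|->]; split; mlra.
Qed.

End Exponential.

(** * Forcing *)

Section Raw.
Variables (M : arith) (pi : nat -> M).
Hypothesis pi_surj : forall x, exists k, pi k = x.
Variable s : nat -> M -> Prop.

Lemma D0_sat0 A (ts : nat -> (nat -> M) -> M) : delta00 A ->
  (forall i, term_def pi (ts i)) -> delta0_def pi s (fun r => sat0 A (fun i => ts i r) s).
Proof. exact: D0_raw. Qed.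

Lemma Sig_raw B (r : nat -> M) : delta00 B ->
  sigma1_def pi s (fun r' => exists w, sat0 B (scons w (scons (r' 0%N) r)) s).
Proof.
move=> dB; apply: Sig_ex0.
have := @D0_sat0 B (fun i r' => scons (r' 0%N) (scons (r' 1%N) r) i) dB.
apply; case=> [|[|i]] /=; [exact: Tm_var|exact: Tm_var|exact: Tm_const].
Qed.

Definition lift_mix2 (i : nat) : nat :=
  if lift_mix i is j.+1 then (lift_mix j).+1 else 0.

(** All parameters are read off one fixed valuation that enumerates the model, so a formula alone
    names a Sigma_1 set. Listing formulas thus lists all Sigma_1 predicates with parameters. *)
Lemma Sig_rawE (P : M -> Prop) : sigma1_def pi s (fun r => P (r 0%N)) ->
  exists B, delta00 B /\ forall n,
    P n <-> exists w, sat0 B (scons w (scons n (mix pi (fun=> az M)))) s.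
Proof.
move=> [Q [A [dA AQ]] QP].
exists (fsubst (tvar \o lift_mix2) id A); split; first exact: delta00_subst.
move=> n; rewrite (QP (scons n (fun=> az M))).
have E w : Q (scons w (scons n (fun=> az M))) <->
  sat0 (fsubst (tvar \o lift_mix2) id A) (scons w (scons n (mix pi (fun=> az M)))) s.
  rewrite AQ /sat0 sat_subst.
  suff -> : mix pi (scons w (scons n (fun=> az M))) =
    eval (scons w (scons n (mix pi (fun=> az M)))) \o (tvar \o lift_mix2) by [].
  apply/funext => i; rewrite mix_scons /= /lift_mix2.
  by case: (lift_mix i) => //= j; rewrite mix_scons.
by split=> -[w h]; exists w; apply/E.
Qed.

End Raw.

Section Forcing.
Variables (S : dsr) (pi : nat -> S).
Hypothesis pi_surj : forall x, exists k, pi k = x.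
Variable s : nat -> S -> Prop.
Hypothesis MI : ISig pi s.
Local Notation D0 := (delta0_def pi s).
Local Notation Sig := (sigma1_def pi s).
Local Notation Tm := (term_def pi).
#[local] Hint Resolve D0_pow2 D0_pre : defin.

(* A string [u] decides [t \in G], for [G] the set of prefixes of a path,
   exactly when [t <= u]: then [t \in G] iff [t] is a prefix of [u]. *)
Fixpoint frc (b : bool) (A : form) (u : S) (r : nat -> S) : Prop :=
  match A with
  | fbot => ~~ b
  | feq t v => if b then eval r t = eval r v else eval r t <> eval r v
  | flt t v => if b then eval r t <s eval r v else ~ eval r t <s eval r v
  | fin t X => match X with
    | 0%N => ~ u <s eval r t /\ (if b then pre (eval r t) u else ~ pre (eval r t) u)
    | Y.+1 => if b then s Y (eval r t) else ~ s Y (eval r t)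
    end
  | fimp A B => if b then frc false A u r \/ frc true B u r
                else frc true A u r /\ frc false B u r
  | fallN A => if b then forall x, frc true A u (scons x r)
               else exists x, frc false A u (scons x r)
  | fallS _ => False
  end.

Lemma Tm_eval_shift t : Tm (fun r => eval (fun i => r i.+1) t).
Proof.
elim: t => [x|||t ht v hv|t ht v hv] /=.
- exact: Tm_var.
- exact: Tm_const.
- exact: Tm_const.
- exact: Tm_add.
- exact: Tm_mul.
Qed.
#[local] Hint Resolve Tm_eval_shift : defin.

Lemma frc_ball_true t A u r : frc true (ball t A) u r <->
  forall x, x <s eval r t -> frc true A u (scons x r).
Proof.
rewrite /ball /=; split=> [h x xt|h x].
  by have := h x; rewrite eval_shift => -[].
by rewrite eval_shift; have [/h|] := pselect (x <s eval r t); [right|left].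
Qed.

Lemma frc_ball_false t A u r : frc false (ball t A) u r <->
  exists x, x <s eval r t /\ frc false A u (scons x r).
Proof.
by rewrite /ball /=; split=> -[x h]; exists x; move: h; rewrite eval_shift.
Qed.

Lemma D0_frc A b : delta00 A ->
  D0 (fun r => frc b A (r 0%N) (fun i => r i.+1)).
Proof.
move=> dA; elim: dA b => [|t v|t v|t X|B C _ IH1 _ IH2|t B _ IH] b.
- by apply: D0_cst.
- by case: b => /=; [|apply: D0_not]; apply: D0_eq; apply: Tm_eval_shift.
- by case: b => /=; [|apply: D0_not]; apply: D0_lt; apply: Tm_eval_shift.
- case: X => [|Y] /=; last first.
    by case: b => /=; [|apply: D0_not]; apply: D0_set; apply: Tm_eval_shift.
  apply: D0_and.
    by apply: D0_not; apply: D0_lt; [apply: Tm_var|apply: Tm_eval_shift].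
  by case: b => /=; [|apply: D0_not]; apply: D0_pre => //;
    [apply: Tm_eval_shift|apply: Tm_var|apply: Tm_eval_shift|apply: Tm_var].
- by case: b => /=; [apply: D0_or|apply: D0_and].
- have h : D0 (fun r => frc b B (r 1%N) (scons (r 0%N) (fun i => r i.+2))).
    have := D0_subst pi_surj (IH b) (ts := fun i r =>
      scons (r 1%N) (scons (r 0%N) (fun i => r i.+2)) i).
    rewrite /= (_ : (fun r => _) = (fun r => frc b B (r 1%N) (scons (r 0%N) (fun i => r i.+2)))).
      by apply; case=> [|[|i]] /=; apply: Tm_var.
    by [].
  case: b IH h => IH h.
    apply: D0_ext (fun r => iff_sym (frc_ball_true _ _ _ _)) _.
    by apply: D0_ball => //; apply: Tm_eval_shift.
  apply: D0_ext (fun r => iff_sym (frc_ball_false _ _ _ _)) _.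
  by apply: D0_bex => //; apply: Tm_eval_shift.
Qed.

Lemma frc_mono b A u v r : pre u v -> frc b A u r -> frc b A v r.
Proof.
move=> uv; elim: A b r => [|t w|t w|t X|B IHB C IHC|B IHB|B IHB] [] r //=.
- case: X => // -[h1 h2]; split; first by have := pre_le uv => h; zify_m; lra.
  exact: (pre_trans pi_surj MI) h2 uv.
- case: X => // -[h1 h2]; split; first by have := pre_le uv => h; zify_m; lra.
  move=> h; apply: h2; apply: (pre_total pi_surj MI h uv).
  by zify_m; lra.
- by case=> [/IHB|/IHC]; [left|right].
- by case=> /IHB ? /IHC.
- by move=> h x; apply: IHB.
- by case=> x /IHB h; exists x.
Qed.

Lemma eval_mono (r r' : nat -> S) t : (forall i, r i <=s r' i) ->
  eval r t <=s eval r' t.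
Proof.
move=> h; elim: t => [x|||t ht v hv|t ht v hv] //=.
  by rewrite !ziD lerD.
by rewrite !ziM ler_pM // zi_ge0.
Qed.

(** Terms are monotone, so every question about membership in G that arises below [r0] concerns a
    number bounded by a value at [r0]. This uniformity in [r] is what carries the induction through
    bounded quantifiers. *)
Lemma frc_decides A (r0 : nat -> S) : delta00 A -> exists N, forall r,
  (forall i, r i <=s r0 i) -> forall u, N <=s u -> frc true A u r \/ frc false A u r.
Proof.
move=> dA; elim: dA r0 => [|t v|t v|t X|B C _ IH1 _ IH2|t B _ IH] r0.
- by exists 0s => r _ u _; right.
- by exists 0s => r _ u _ /=; apply: EM.
- by exists 0s => r _ u _ /=; apply: EM.
- case: X => [|X]; last by exists 0s => r _ u _ /=; apply: EM.
  exists (eval r0 t) => r rr u h /=.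
  have h' : ~ u <s eval r t by have := eval_mono t rr => h1; zify_m; lra.
  by have [] := EM (pre (eval r t) u); [left|right].
- have [[N hN] [K hK]] := (IH1 r0, IH2 r0); exists (N +s K) => r rr u h /=.
  have Nu : N <=s u by zify_m; lra.
  have Ku : K <=s u by zify_m; lra.
  have [hB|hB] := hN r rr u Nu; last by left; left.
  by have [hC|hC] := hK r rr u Ku; [left; right|right].
- have [N hN] := IH (scons (eval r0 t) r0); exists N => r rr u h.
  have [h1|h1] := EM (forall x, x <s eval r t -> frc true B u (scons x r)).
    by left; apply/frc_ball_true.
  right; apply/frc_ball_false; apply: contrapT => h2; apply: h1 => x xt.
  have rr' : forall i, scons x r i <=s scons (eval r0 t) r0 i.
    by case=> [|i] //=; have := eval_mono t rr => h3; zify_m; lra.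
  have [//|h3] := hN _ rr' u h.
  by case: h2; exists x.
Qed.

Definition inM (P : S -> Prop) : Prop := exists k, s k = P.
Definition tree (T : S -> Prop) : Prop := forall u t, T u -> pre t u -> T t.
Definition unbounded (T : S -> Prop) : Prop := forall k, exists u, k <s u /\ T u.
Definition branch (G : S -> Prop) : Prop := [/\ tree G, unbounded G &
  forall t u, G t -> G u -> pre t u \/ pre u t].

Lemma branch_pre G t u : branch G -> G t -> G u -> t <=s u -> pre t u.
Proof.
move=> [_ _ h] Gt Gu tu; have [//|ut] := h _ _ Gt Gu.
have -> : t = u by apply: zi_inj; have := pre_le ut => h'; lra.
exact: pre_refl.
Qed.

Lemma frc_sound G A u r : branch G -> G u -> delta00 A ->
  (frc true A u r -> sat0 A r (scons G s)) /\
  (frc false A u r -> ~ sat0 A r (scons G s)).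
Proof.
move=> hG Gu dA; elim: dA r => [|t v|t v|t X|B C _ IH1 _ IH2|t B _ IH] r.
- by rewrite /sat0 /=; split=> [|_ []].
- by split=> h; exact: h.
- by split=> h; exact: h.
- case: X => [|X]; last by split=> h; exact: h.
  rewrite /sat0 /=; have [tG _ _] := hG; split=> -[h1 h2].
    exact: tG Gu h2.
  by move=> h; apply: h2; apply: (branch_pre hG) => //; zify_m; lra.
- have [[a1 a2] [b1 b2]] := (IH1 r, IH2 r); rewrite /sat0 /=.
  by split=> [[/a2|/b1]//|[/a1 h1 /b2 h2] h]; apply/h2/h.
- split=> [/frc_ball_true h x|/frc_ball_false [x [xt h]] H].
    by rewrite /= eval_shift => /h; apply: (IH _).1.
  apply: (IH (scons x r)).2 => //; apply: H.
  by rewrite /= eval_shift.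
Qed.

Variables (B : form) (r0 : nat -> S).
Hypothesis dB : delta00 B.

(** Bounding the witness by the string keeps forcing of a Sigma_1 statement Delta_0. Nothing is
    lost, since a branch contains arbitrarily large strings. *)
Definition theta (u n : S) : Prop :=
  exists w, w <s u +s 1s /\ frc true B u (scons w (scons n r0)).

Lemma D0_theta f g : Tm f -> Tm g -> D0 (fun r => theta (f r) (g r)).
Proof.
apply: (D0_eta2 pi_surj); apply: D0_bex; first by dtm.
have := D0_subst pi_surj (D0_frc true dB) (ts := fun i r =>
  scons (r 1%N) (scons (r 0%N) (scons (r 2%N) r0)) i).
apply; case=> [|[|[|i]]] /=; try exact: Tm_var.
exact: Tm_const.
Qed.

Lemma theta_mono u v n : pre u v -> theta u n -> theta v n.
Proof.
move=> uv [w [wu h]]; exists w; split; last exact: frc_mono h.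
by have := pre_le uv => h'; zify_m; lra.
Qed.

Lemma theta_truth G n : branch G ->
  (exists w, sat0 B (scons w (scons n r0)) (scons G s)) <->
  exists u, G u /\ theta u n.
Proof.
move=> hG; split=> [[w h]|[u [Gu [w [_ h]]]]]; last first.
  by exists w; apply: (frc_sound _ hG Gu dB).1.
have [N hN] := frc_decides (scons w (scons n r0)) dB.
have [_ uG _] := hG; have [u [Nu Gu]] := uG (N +s w).
exists u; split=> //; exists w; split; first by zify_m; lra.
have Nu' : N <=s u by zify_m; lra.
have [//|] := hN _ (fun i => lexx _) u Nu'.
by move=> /(frc_sound _ hG Gu dB).2 [].
Qed.

End Forcing.

(** * Generic branches meeting countably many requirements *)

Section Generic.
Variables (S : dsr) (pi : nat -> S).
Hypothesis pi_surj : forall x, exists k, pi k = x.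
Variable s : nat -> S -> Prop.
Hypothesis MR : RCAm pi s.
Let MI : ISig pi s := MR.1.
Local Notation D0 := (delta0_def pi s).
Local Notation Sig := (sigma1_def pi s).
Local Notation Tm := (term_def pi).
Local Notation inM := (inM s).
Implicit Types (T : S -> Prop) (p t u v w : S).
#[local] Hint Resolve D0_pow2 D0_pre : defin.

Lemma inM_D0 (P : S -> Prop) : D0 (fun r => P (r 0%N)) -> inM P.
Proof. by move=> dP; apply: MR.2; apply: Sig_D0 => //; apply: D0_not. Qed.

Definition env0 : nat -> S := mix pi (fun=> 0s).
Definition th B := theta s B env0.

Lemma D0_th B f g : delta00 B -> Tm f -> Tm g -> D0 (fun r => th B (f r) (g r)).
Proof. by move=> dB; apply: D0_theta. Qed.
#[local] Hint Resolve D0_th : defin.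

Definition subp (T' T : S -> Prop) : Prop := forall u : S, T' u -> T u.

(** For a tree [T], the strings of [T] that do not force P(i) die out at some level, so the tree
    they form is finite. For [T] in the model this is Sigma_1 in [i]. *)
Definition small (T : S -> Prop) B i : Prop := exists p : S, pow2 p /\
  forall u : S, T u -> at_level p (u +s 1s) -> th B u i.

(** The trunk of [T] reaches level [p]. Meeting this for all [p] leaves exactly one branch. *)
Definition through (T : S -> Prop) p : Prop := exists u : S,
  at_level p (u +s 1s) /\ forall t : S, T t -> pre t u \/ pre u t.

Definition decides (T : S -> Prop) B n : Prop := small T B n \/
  exists m, (forall u, T u -> ~ th B u m) /\ forall i, i <s m -> small T B i.

Lemma small_sub T T' B i : subp T' T -> small T B i -> small T' B i.
Proof. by move=> TT [p [hp h]]; exists p; split=> // u /TT; apply: h. Qed.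

Lemma through_sub T T' p : subp T' T -> through T p -> through T' p.
Proof. by move=> TT [u [hu h]]; exists u; split=> // t /TT; apply: h. Qed.

Lemma decides_sub T T' B n : subp T' T -> decides T B n -> decides T' B n.
Proof.
move=> TT [h|[m [h1 h2]]]; [left; exact: small_sub h|right; exists m].
by split=> [u /TT /h1|i /h2] //; apply: small_sub.
Qed.

Lemma unbounded_level T p : tree T -> unbounded T -> pow2 p ->
  exists u, T u /\ at_level p (u +s 1s).
Proof.
move=> tT uT hp; have [u [pu Tu]] := uT p.
have [|t [tu lt]] := pre_restrict pi_surj MI (u := u) hp; first by zify_m; lra.
by exists t; split=> //; apply: tT Tu tu.
Qed.

Variable Q : (S -> Prop) -> Prop.
Hypothesis Q_tree : forall T, Q T -> tree T /\ unbounded T.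
Hypothesis Q_through : forall T p, Q T -> pow2 p ->
  exists T', [/\ Q T', subp T' T & through T' p].
Hypothesis Q_decides : forall T B n, Q T -> delta00 B ->
  exists T', [/\ Q T', subp T' T & decides T' B n].
Variable D : nat -> (S -> Prop) -> Prop.
Hypothesis D_dense : forall k T, Q T -> exists T', [/\ Q T', subp T' T & D k T'].
Variable T0 : S -> Prop.
Hypothesis QT0 : Q T0.

(** As k runs through the codes of pairs, all levels [pi i], all pairs of a formula [nth_form i] and
    a number [pi j], and all classes [D i] are visited. *)
Definition req (k : nat) (T : S -> Prop) : Prop :=
  let: (i, j) := odflt (0, 0)%N (unpickle k) in
  [/\ pow2 (pi i) -> through T (pi i),
      delta00 (nth_form i) -> decides T (nth_form i) (pi j) & D i T].

Lemma req_dense k T : Q T -> exists T', [/\ Q T', subp T' T & req k T'].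
Proof.
move=> QT; rewrite /req; case: (odflt _ _) => i j.
have [T1 [QT1 s1 h1]] : exists T', [/\ Q T', subp T' T &
    pow2 (pi i) -> through T' (pi i)].
  have [hp|hp] := pselect (pow2 (pi i)); last by exists T; split.
  by have [T' [? ? ?]] := Q_through QT hp; exists T'.
have [T2 [QT2 s2 h2]] : exists T', [/\ Q T', subp T' T1 &
    delta00 (nth_form i) -> decides T' (nth_form i) (pi j)].
  have [hp|hp] := pselect (delta00 (nth_form i)); last by exists T1; split.
  by have [T' [? ? ?]] := Q_decides (pi j) QT1 hp; exists T'.
have [T3 [QT3 s3 h3]] := D_dense i QT2.
exists T3; split=> //; first by move=> u /s3/s2/s1.
split=> //; first by move=> /h1; apply: through_sub => u /s3/s2.
by move=> /h2; apply: decides_sub.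
Qed.

Lemma generic_seq : exists F : nat -> S -> Prop, subp (F 0%N) T0 /\
  forall k, [/\ Q (F k), subp (F k.+1) (F k) & req k (F k.+1)].
Proof.
have /choice[f fE] : forall x : nat * (S -> Prop), exists T', Q x.2 ->
    [/\ Q T', subp T' x.2 & req x.1 T'].
  move=> [k T]; have [QT|nQ] := pselect (Q T); last by exists T.
  by have [T' h] := req_dense k QT; exists T'.
pose F := fix F k := if k is j.+1 then f (j, F j) else T0.
exists F; split=> // k.
have QF : Q (F k) by elim: k => // k IH /=; case: (fE (k, F k) IH).
by case: (fE (k, F k) QF).
Qed.

Theorem generic_ext : exists G, [/\ branch G, ISig pi (scons G s), subp G T0 &
  forall k, exists T, [/\ Q T, D k T & subp G T]].
Proof.
have [F [F0 hF]] := generic_seq.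
have Fsub j k : (j <= k)%N -> subp (F k) (F j).
  elim: k => [|k IH]; first by rewrite leqn0 => /eqP ->.
  rewrite leq_eqVlt => /orP[/eqP->//|/IH h] u; have [_ h' _] := hF k.
  by move/h'/h.
(* [u] enters the branch once some condition has its trunk through [u]. *)
pose G u := exists k, forall t, F k t -> pre t u \/ pre u t.
have Gbig u k : G u -> exists v, F k v /\ pre u v.
  move=> [j hj]; have [Qm _ _] := hF (maxn j k).
  have [_ uF] := Q_tree Qm; have [v [uv Fv]] := uF u.
  exists v; split=> //; first exact: Fsub (leq_maxr j k) _ Fv.
  case: (hj v) => //; first exact: Fsub (leq_maxl j k) _ Fv.
  by move=> /pre_le h; exfalso; zify_m; lra.
have GF u k : G u -> F k u.
  move=> /(Gbig _ k) [v [Fv uv]]; have [Qk _ _] := hF k.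
  by have [tF _] := Q_tree Qk; apply: tF Fv uv.
have stage i j : exists k, [/\ pow2 (pi i) -> through (F k) (pi i),
    delta00 (nth_form i) -> decides (F k) (nth_form i) (pi j), Q (F k) & D i (F k)].
  exists (pickle (i, j)).+1; have [Qk _ _] := hF (pickle (i, j)).+1.
  by have [_ _] := hF (pickle (i, j)); rewrite /req pickleK => -[].
have Gu p : pow2 p -> exists u, G u /\ at_level p (u +s 1s).
  have [i <-] := pi_surj p => hp; have [k [/(_ hp) [u [lu hu]] _ _ _]] := stage i 0%N.
  by exists u; split=> //; exists k.
have bG : branch G.
  split.
  - move=> u t [k hk] tu; exists k => v /hk [vu|uv].
      have [h|h] := leP (zi v) (zi t).
        by left; apply: (pre_total pi_surj MI vu tu).
      by right; apply: (pre_total pi_surj MI tu vu); lra.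
    by right; apply: (pre_trans pi_surj MI tu uv).
  - move=> k; have [p [hp kp]] := pow2_unbounded pi_surj MI (k +s 1s).
    have [u [Gu' [h _]]] := Gu p hp; exists u; split=> //.
    by zify_m; lra.
  - move=> t u [k hk] [l hl]; have [Qm _ _] := hF (maxn k l).
    have [_ uF] := Q_tree Qm; have [v [h Fv]] := uF (t +s u).
    have tv : pre t v.
      case: (hk v) => //; first exact: Fsub (leq_maxl k l) _ Fv.
      by move=> /pre_le h'; exfalso; zify_m; lra.
    have uv : pre u v.
      case: (hl v) => //; first exact: Fsub (leq_maxr k l) _ Fv.
      by move=> /pre_le h'; exfalso; zify_m; lra.
    have [h'|h'] := leP (zi t) (zi u).
      by left; apply: (pre_total pi_surj MI tv uv).
    by right; apply: (pre_total pi_surj MI uv tv); lra.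
exists G; split=> //; last 2 first.
- by move=> u /(@GF _ 0%N)/F0.
- move=> i; have [k [_ _ Qk Dk]] := stage i 0%N; exists (F k).
  by split=> // u; apply: GF.
move=> P /Sig_rawE [B [dB PB]] P0 PS n; apply: contrapT => nPn.
have PE m : P m <-> exists u, G u /\ th B u m.
  by rewrite PB; apply: theta_truth.
have smallP k m : small (F k) B m -> P m.
  move=> [p [hp h]]; have [u [Gu' lu]] := Gu p hp.
  by apply/PE; exists u; split=> //; apply: h => //; apply: GF.
have [i iB] := nth_form_surj B; have [j jn] := pi_surj n.
have [k [_ hd _ _]] := stage i j; rewrite iB jn in hd.
(* Either P(n) has been made true, or P fails at m and holds below m. The latter contradicts P(0)
   when m = 0 and the induction step at m - 1 otherwise. *)
have [/smallP//|[m [h1 h2]]] := hd dB.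
have nPm : ~ P m by move=> /PE [u [/(GF _ k) /h1]].
have [m0|[m' mE]] := zero_or_S m; first by apply: nPm; rewrite m0.
apply: nPm; rewrite mE; apply: PS; apply: (smallP k); apply: h2.
by rewrite mE; mlra.
Qed.

End Generic.

(** * The two forcings: infinite subtrees and cones *)

Section Instances.
Variables (S : dsr) (pi : nat -> S).
Hypothesis pi_surj : forall x, exists k, pi k = x.
Variable s : nat -> S -> Prop.
Hypothesis MR : RCAm pi s.
Let MI : ISig pi s := MR.1.
Local Notation D0 := (delta0_def pi s).
Local Notation Sig := (sigma1_def pi s).
Local Notation Tm := (term_def pi).
Local Notation inM := (inM s).
Implicit Types (T : S -> Prop) (p t u v w : S).
Local Notation th := (th pi s).
Local Notation small := (small pi s).
Local Notation decides := (decides pi s).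
#[local] Hint Resolve D0_pow2 D0_pre D0_th D0_mem : defin.

Lemma D0_inM (P : S -> Prop) f : inM P -> Tm f -> D0 (fun r => P (f r)).
Proof. exact: D0_mem. Qed.
#[local] Hint Resolve D0_inM : defin.

Lemma Sig_small T B f : inM T -> delta00 B -> Tm f ->
  Sig (fun r => small T B (f r)).
Proof.
move=> MT dB; apply: (Sig_eta pi_surj (P := small T B)).
apply: Sig_ext (_ : Sig (fun r => exists p, pow2 p /\ forall u, u <s p +s p ->
  T u -> at_level p (u +s 1s) -> th B u (r 0%N))); last by rewrite /at_level; ddef.
move=> r; split=> -[p [hp h]]; exists p; split=> //.
  by move=> u Tu lu; apply: h => //; case: lu => _ h'; mlra.
by move=> u _; apply: h.
Qed.
#[local] Hint Resolve Sig_small : defin.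

Definition cond (T : S -> Prop) : Prop := [/\ inM T, tree T & unbounded T].

Definition cone (v u : S) : Prop := pre u v \/ pre v u.

Lemma tree_cone v : tree (cone v).
Proof.
move=> u t [uv|vu] tu; first by left; apply: (pre_trans pi_surj MI tu uv).
have [h|h] := leP (zi t) (zi v).
  by left; apply: (pre_total pi_surj MI tu vu).
by right; apply: (pre_total pi_surj MI vu tu); lra.
Qed.

Lemma cond_decides T B n : cond T -> delta00 B ->
  exists T', [/\ cond T', subp T' T & decides T' B n].
Proof.
move=> cT dB; have [MT tT uT] := cT.
have [h|h] := pselect (small T B n); first by exists T; split=> //; left.
have [|m [nm hm]] := least_notSig pi_surj MI (P := small T B) _ h.
  by ddef.
(* Failure of [small] at [m] says that these strings occur at every level, so the subtree is
   infinite. It is Delta_0 relative to [T], hence a set of the model. *)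
pose T' u := T u /\ ~ th B u m.
exists T'; split; last 1 first.
- right; exists m; split; first by move=> u [].
  by move=> i /hm; apply: small_sub => u [].
- split.
  + by apply: (inM_D0 pi_surj MR); rewrite /T'; ddef.
  + move=> u t [Tu nu] tu; split; first exact: tT Tu tu.
    by move=> h'; apply: nu; apply: (theta_mono pi_surj MI tu).
  + move=> k; have [p [hp kp]] := pow2_unbounded pi_surj MI (k +s 1s).
    apply: contrapT => nh; apply: nm; exists p; split=> // u Tu [h1 h2].
    apply: contrapT => nu; apply: nh; exists u; split=> //.
    by zify_m; lra.
- by move=> u [].
Qed.

(** A pigeonhole argument inside the model: if [T] were finite above every string of level [p],
    collection would bound these finite parts uniformly and [T] would be finite. *)
Lemma cond_through T p : cond T -> pow2 p ->
  exists T', [/\ cond T', subp T' T & through T' p].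
Proof.
move=> [MT tT uT] hp; apply: contrapT => nh.
(* The height of the part of [T] above [v] is expressed by an empty level [q], so that every
   quantifier is bounded and collection applies. *)
have H v : v <s p +s p -> exists q, pow2 q /\ v +s 1s <s q /\
    (at_level p (v +s 1s) -> forall u, u <s q +s q -> T u ->
      at_level q (u +s 1s) -> ~ pre v u).
  move=> vp; have [lv|nlv] := pselect (at_level p (v +s 1s)); last first.
    by have [q [hq vq]] := pow2_unbounded pi_surj MI (v +s 1s); exists q.
  have [b hb] : exists b, forall u, T u /\ cone v u -> ~ b <s u.
    apply: contrapT => nb; apply: nh; exists (fun u => T u /\ cone v u); split.
    - split.
      + by apply: (inM_D0 pi_surj MR); rewrite /cone; ddef.
      + move=> u t [Tu cu] tu; split; first exact: tT Tu tu.
        exact: tree_cone cu tu.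
      + move=> b; apply: contrapT => nu; apply: nb; exists b => u hu bu.
        by apply: nu; exists u.
    - by move=> u [].
    - by exists v; split=> // t [].
  have [q [hq bq]] := pow2_unbounded pi_surj MI (b +s v +s 1s).
  exists q; split=> //; split; first by zify_m; lra.
  move=> _ u _ Tu [qu _] vu; apply: (hb u); first by split=> //; right.
  by zify_m; lra.
have [b hb] := collection pi_surj MI (a := p +s p) (R := fun q v => pow2 q /\
    v +s 1s <s q /\ (at_level p (v +s 1s) -> forall u, u <s q +s q -> T u ->
      at_level q (u +s 1s) -> ~ pre v u)) ltac:(rewrite /at_level; ddef) H.
(* A string of [T] beyond the common bound: its prefixes at level [p] and at the level declared
   empty contradict each other. *)
have [t [bt Tt]] := uT (b +s p).
have [|v [vt lv]] := pre_restrict pi_surj MI (u := t) hp; first by zify_m; lra.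
have [|q [qb [hq [vq /(_ lv) hv]]]] := hb v; first by case: lv => _ h; mlra.
have [|w [wt lw]] := pre_restrict pi_surj MI (u := t) hq; first by zify_m; lra.
apply: (hv w) => //; first by case: lw => _ h; mlra.
  exact: tT Tt wt.
apply: (pre_total pi_surj MI vt wt); case: lw => h _; zify_m; lra.
Qed.

Theorem wkl_ext T : inM T -> tree T -> unbounded T ->
  exists G, [/\ branch G, ISig pi (scons G s) & subp G T].
Proof.
move=> MT tT uT.
have Qt T' : cond T' -> tree T' /\ unbounded T' by case=> _ ? ?; split.
have Dt (k : nat) T' : cond T' -> exists T'', [/\ cond T'', subp T'' T' & True].
  by move=> QT'; exists T'; split.
have [] := generic_ext pi_surj MR Qt cond_through cond_decides
  (D := fun _ _ => True) Dt (T0 := T).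
  by split.
by move=> G [h1 h2 h3 _]; exists G.
Qed.

(** The Cohen condition [v] is presented as the tree of all strings comparable with [v], so that
    [generic_ext] serves both forcings. *)
Definition ccond (T : S -> Prop) : Prop := exists v, T = cone v.

Lemma cone_sub v w : pre v w -> subp (cone w) (cone v).
Proof.
move=> vw u [uw|wu]; last by right; apply: (pre_trans pi_surj MI vw wu).
have [h|h] := leP (zi u) (zi v).
  by left; apply: (pre_total pi_surj MI uw vw).
by right; apply: (pre_total pi_surj MI vw uw); lra.
Qed.

Lemma ccond_tree T : ccond T -> tree T /\ unbounded T.
Proof.
move=> [v ->]; split; first exact: tree_cone.
move=> k; have [p [hp kp]] := pow2_unbounded pi_surj MI (k +s 1s).
have [u [vu pu]] := pre_extend v hp; exists u; split; last by right.
by zify_m; lra.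
Qed.

Lemma ccond_through T p : ccond T -> pow2 p ->
  exists T', [/\ ccond T', subp T' T & through T' p].
Proof.
move=> [v ->] hp; have [w [vw pw]] := pre_extend v hp.
exists (cone w); split; [by exists w|exact: cone_sub|].
have [u [uw lu]] := pre_restrict pi_surj MI hp pw.
by exists u; split=> // t; apply: cone_sub.
Qed.

Lemma small_cone B v n : th B v n -> small (cone v) B n.
Proof.
move=> h; have [p [hp vp]] := pow2_unbounded pi_surj MI (v +s 1s).
exists p; split=> // u [uv|vu] [pu _].
  by have := pre_le uv => h'; exfalso; zify_m; lra.
exact: (theta_mono pi_surj MI vu h).
Qed.

(** If no extension of [v] forces P(n), consider the Sigma_1 statement that a single extension
    forces P(i) for all i < k. It fails at n + 1; if m' + 1 is its least failure, an extension good
    for m' has no further extension forcing P(m'). *)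
Lemma ccond_decides T B n : ccond T -> delta00 B ->
  exists T', [/\ ccond T', subp T' T & decides T' B n].
Proof.
move=> [v ->] dB.
have [[t [vt ht]]|h] := pselect (exists t, pre v t /\ th B t n).
  exists (cone t); split; [by exists t|exact: cone_sub|left].
  exact: small_cone.
pose P k := exists t, pre v t /\ forall i, i <s k -> th B t i.
have nP : ~ P (n +s 1s).
  by move=> [t [vt ht]]; apply: h; exists t; split=> //; apply: ht; mlra.
have [|m [nm hm]] := least_notSig pi_surj MI (P := P) _ nP.
  by rewrite /P; ddef.
have [m0|[m' mE]] := zero_or_S m.
  case: nm; exists v; split; first exact: pre_refl.
  by move=> i; rewrite m0 => i0; exfalso; mlra.
have [|t [vt ht]] := hm m'; first by rewrite mE; mlra.
exists (cone t); split; [by exists t|exact: cone_sub|right].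
exists m'; split; last by move=> i /ht; apply: small_cone.
move=> u cu hu; apply: nm; rewrite mE.
have [w [tw uw]] : exists w, pre t w /\ pre u w.
  by case: cu => [ut|tu]; [exists t|exists u]; split=> //; apply: pre_refl.
exists w; split; first exact: (pre_trans pi_surj MI vt tw).
move=> i im; have [h'|[->|h']] := ltm_total i m'.
- by apply: (theta_mono pi_surj MI tw); apply: ht.
- exact: (theta_mono pi_surj MI uw).
- by exfalso; mlra.
Qed.

Theorem cohen_ext (D : nat -> S -> Prop) :
  (forall k v, exists w, pre v w /\ D k w) ->
  exists G, [/\ branch G, ISig pi (scons G s) & forall k, exists2 w, D k w & G w].
Proof.
move=> dD.
have Dc k T : ccond T -> exists T', [/\ ccond T', subp T' T &
    exists2 w, D k w & T' = cone w].
  move=> [v ->]; have [w [vw Dw]] := dD k v.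
  by exists (cone w); split; [exists w|exact: cone_sub|exists w].
have C0 : ccond (cone 0s) by exists 0s.
have [G [h1 h2 _ h3]] := generic_ext pi_surj MR ccond_tree
  ccond_through ccond_decides (D := fun k T => exists2 w, D k w & T = cone w) Dc C0.
exists G; split=> // k; have [_ [_ [w Dw ->] GT]] := h3 k; exists w => //.
have [tG uG _] := h1; have [u [wu Gu]] := uG w.
apply: (tG _ _ Gu); case: (GT u Gu) => // /pre_le h.
by exfalso; zify_m; lra.
Qed.

End Instances.

(** * Delta_1 closure and iteration *)

Section DeltaClosure.
Variables (S : dsr) (pi : nat -> S).
Hypothesis pi_surj : forall x, exists k, pi k = x.
Variable s : nat -> S -> Prop.
Hypothesis MI : ISig pi s.
Local Notation D0 := (delta0_def pi s).
Local Notation Sig := (sigma1_def pi s).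
Local Notation Tm := (term_def pi).

Definition Del (P : S -> Prop) : Prop :=
  Sig (fun r => P (r 0%N)) /\ Sig (fun r => ~ P (r 0%N)).

(** A formula that does not define a Delta_1 set is given the empty set, so that every index names a
    Delta_1 set. *)
Definition dset (k : nat) : S -> Prop :=
  let P n := exists w, sat0 (nth_form k) (scons w (scons n (env0 pi))) s in
  if pselect (Del P) then P else fun=> False.

Lemma dset_Del k : Del (dset k).
Proof.
rewrite /dset; case: (pselect _) => [h|_] //=.
by split; apply: Sig_D0 => //; apply: D0_cst.
Qed.

Lemma Del_dset P : Del P -> inM dset P.
Proof.
move=> dP; have [B [_ PB]] := Sig_rawE dP.1; have [k kB] := nth_form_surj B.
have E : (fun n => exists w, sat0 (nth_form k) (scons w (scons n (env0 pi))) s) = P.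
  by rewrite kB; apply/funext => n; apply: propext; apply: iff_sym; apply: PB.
by exists k; rewrite /dset E; case: pselect.
Qed.

Lemma dset_sub k : inM dset (s k).
Proof.
apply: Del_dset; split; apply: Sig_D0 => //.
  by apply: D0_set; apply: Tm_var.
by apply: D0_not; apply: D0_set; apply: Tm_var.
Qed.

Lemma Tm_eval ts t : (forall i, Tm (ts i)) -> Tm (fun r => eval (fun i => ts i r) t).
Proof.
move=> h; elim: t => [x|||t ht v hv|t ht v hv] /=.
- exact: h.
- exact: Tm_const.
- exact: Tm_const.
- exact: Tm_add.
- exact: Tm_mul.
Qed.

Lemma Tm_shift f : Tm f -> Tm (fun r => f (fun i => r i.+1)).
Proof.
move=> [u uE]; exists (tsubst (tvar \o (fun j => if odd j then j else j.+2)) u) => r.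
rewrite uE eval_subst; congr eval; apply/funext => j /=.
by rewrite /mix; case: ifP => oj; rewrite ?oj //= !negbK oj.
Qed.

Lemma Sig_ball_raw t ts : (forall i, Tm (ts i)) -> forall P : (nat -> S) -> Prop,
  Sig (fun r => P (scons (r 0%N) (fun i => ts i (fun i => r i.+1)))) ->
  Sig (fun r => forall x, x <s eval (fun i => ts i r) t ->
                 P (scons x (fun i => ts i r))) /\
  Sig (fun r => exists x, x <s eval (fun i => ts i r) t /\
                 P (scons x (fun i => ts i r))).
Proof.
move=> h P hP; split; first by apply: Sig_ball => //; apply: Tm_eval.
apply: (Sig_ex pi_surj); apply: (Sig_and pi_surj) => //; apply: Sig_D0 => //.
apply: D0_lt; first exact: Tm_var.
exact: (Tm_shift (Tm_eval t h)).
Qed.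

(** Truth and falsity are handled together because implication exchanges them. Bounded quantifiers
    stay Sigma_1 on both sides, by collection. *)
Lemma Sig_sat0_dset A ts : delta00 A -> (forall i, Tm (ts i)) ->
  Sig (fun r => sat0 A (fun i => ts i r) dset) /\
  Sig (fun r => ~ sat0 A (fun i => ts i r) dset).
Proof.
move=> dA; elim: dA ts => [|t v|t v|t X|B C _ IH1 _ IH2|t B _ IH] ts h.
- split; apply: Sig_D0 => //; first exact: (D0_cst pi s False).
  exact: (D0_cst pi s (~ False)).
- split; apply: Sig_D0 => //; last apply: D0_not.
    by apply: D0_eq; apply: Tm_eval.
  by apply: D0_eq; apply: Tm_eval.
- split; apply: Sig_D0 => //; last apply: D0_not.
    by apply: D0_lt; apply: Tm_eval.
  by apply: D0_lt; apply: Tm_eval.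
- have [h1 h2] := dset_Del X; have ht := Tm_eval t h.
  split; first exact: (Sig_eta pi_surj (P := dset X) h1 ht).
  exact: (Sig_eta pi_surj (P := fun x => ~ dset X x) h2 ht).
- have [[b1 b2] [c1 c2]] := (IH1 ts h, IH2 ts h); rewrite /sat0 /=; split.
    apply: Sig_ext (Sig_or b2 c1) => r; split=> [[//|//]|h'].
    by have [/h'|] := EM (sat0 B (fun i => ts i r) dset); [right|left].
  apply: Sig_ext (Sig_and pi_surj b1 c2) => r; split=> [[h1 h2] /(_ h1) //|h'].
  split; first by apply: contrapT => n; apply: h' => /n.
  by move=> h1; apply: h'.
- have h' i : Tm (fun r => scons (r 0%N) (fun i => ts i (fun i => r i.+1)) i).
    by case: i => [|i]; [apply: Tm_var|apply: Tm_shift].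
  have [h1 h2] := IH (fun i r => scons (r 0%N) (fun i => ts i (fun i => r i.+1)) i) h'.
  have [b1 _] := Sig_ball_raw t h (P := fun r => sat0 B r dset) h1.
  have [_ b2] := Sig_ball_raw t h (P := fun r => ~ sat0 B r dset) h2.
  have E r : sat0 (ball t B) r dset <->
      forall x, x <s eval r t -> sat0 B (scons x r) dset.
    by rewrite /sat0 /=; split=> H x; have := H x; rewrite eval_shift.
  split; first by apply: Sig_ext b1 => r; apply: iff_sym; apply: E.
  apply: Sig_ext b2 => r; rewrite E; split=> [[x [xt nx]] H|H].
    by apply: nx; apply: H.
  apply: contrapT => n; apply: H => x xt; apply: contrapT => nx.
  by apply: n; exists x.
Qed.

Lemma Sig_dset P : sigma1_def pi dset P -> Sig P.
Proof.
move=> [Q [A [dA AQ]] QP].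
have hm i : Tm (fun r => mix pi r i).
  by rewrite /mix; case: odd; [apply: Tm_const|apply: Tm_var].
have [h _] := Sig_sat0_dset dA hm.
have hQ : Sig Q by apply: Sig_ext h => r; apply: iff_sym; apply: AQ.
have hQ' : Sig (fun r => Q (scons (r 0%N) (fun i => r i.+1))).
  by apply: Sig_ext hQ => r; rewrite (_ : scons _ _ = r) //; apply/funext; case.
apply: Sig_ext (Sig_ex pi_surj (Q := fun w r => Q (scons w r)) hQ') => r.
by apply: iff_sym; apply: QP.
Qed.

(** Being Sigma_1 over the Delta_1 sets is being Sigma_1 over the given sets; hence induction is
    inherited and Delta_1 comprehension produces no further sets. *)
Theorem delta_closure : exists s', RCAm pi s' /\ forall k, inM s' (s k).
Proof.
exists dset; split; last exact: dset_sub.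
split=> [P /Sig_dset|P /Sig_dset h1 /Sig_dset h2]; first exact: MI.
exact: Del_dset.
Qed.

End DeltaClosure.

Section Iteration.
Variables (S : dsr) (pi : nat -> S).
Hypothesis pi_surj : forall x, exists k, pi k = x.
Implicit Types (s : nat -> S -> Prop).

Definition sub_fam s s' : Prop := forall k, inM s' (s k).

Lemma sub_fam_refl s : sub_fam s s.
Proof. by move=> k; exists k. Qed.

Lemma sub_fam_inM s s' P : sub_fam s s' -> inM s P -> inM s' P.
Proof. by move=> h [k <-]. Qed.

Lemma sub_fam_trans s s' s'' : sub_fam s s' -> sub_fam s' s'' -> sub_fam s s''.
Proof. by move=> h1 h2 k; apply: sub_fam_inM (h1 k). Qed.

Lemma D0_rename s s' A l : delta00 A -> fbound l l A ->
  (forall X, (X < l)%N -> inM s' (s X)) -> 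
  exists A', delta00 A' /\ forall r, sat0 A r s <-> sat0 A' r s'.
Proof.
move=> dA bA h.
have /choice[g gE] : forall X, exists Y, (X < l)%N -> s' Y = s X.
  move=> X; case: (ltnP X l) => [/h[Y <-]|_]; last by exists 0%N.
  by exists Y.
exists (fsubst tvar g A); split; first exact: delta00_subst.
move=> r; rewrite /sat0 sat_subst.
by rewrite (@sat_bound S _ l l A r (eval r \o tvar) s (s' \o g)) // => X /gE.
Qed.

Lemma Sig_rename s s' P : sub_fam s s' ->
  sigma1_def pi s P -> sigma1_def pi s' P.
Proof.
move=> ss [Q [A [dA AQ]] QP]; have [l bA] := fbound_ex A.
have [A' [dA' AA']] := D0_rename dA bA (fun X _ => ss X).
by exists Q => //; exists A'; split=> // r; rewrite AQ.
Qed.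

Definition union (F : nat -> nat -> S -> Prop) (k : nat) : S -> Prop :=
  let: (i, j) := odflt (0, 0)%N (unpickle k) in F i j.

Section Union.
Variable F : nat -> nat -> S -> Prop.
Hypothesis F_RCA : forall i, RCAm pi (F i).
Hypothesis F_sub : forall i, sub_fam (F i) (F i.+1).

Lemma chain_sub i j : (i <= j)%N -> sub_fam (F i) (F j).
Proof.
elim: j => [|j IH]; first by rewrite leqn0 => /eqP -> k; exists k.
rewrite leq_eqVlt => /orP[/eqP -> k|/IH h]; first by exists k.
exact: sub_fam_trans h (F_sub j).
Qed.

Lemma union_sub i : sub_fam (F i) (union F).
Proof. by move=> k; exists (pickle (i, k)); rewrite /union pickleK. Qed.

Lemma union_inM P : inM (union F) P -> exists i, inM (F i) P.
Proof.
move=> [k <-]; rewrite /union; case: (odflt _ _) => i j.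
by exists i, j.
Qed.

Lemma union_finite l : exists i, forall X, (X < l)%N -> inM (F i) (union F X).
Proof.
elim: l => [|l [i hi]]; first by exists 0%N.
have [|j hj] := @union_inM (union F l); first by exists l.
exists (maxn i j) => X; rewrite ltnS leq_eqVlt => /orP[/eqP->|/hi].
  exact: sub_fam_inM (chain_sub (leq_maxr i j)) hj.
exact: sub_fam_inM (chain_sub (leq_maxl i j)).
Qed.

Lemma Sig_union P : sigma1_def pi (union F) P -> exists i, sigma1_def pi (F i) P.
Proof.
move=> [Q [A [dA AQ]] QP]; have [l bA] := fbound_ex A.
have [i hi] := union_finite l.
have [A' [dA' AA']] := D0_rename dA bA hi.
by exists i, Q => //; exists A'; split=> // r; rewrite AQ.
Qed.

(** A formula mentions finitely many sets, which all occur at one stage of the chain. Each instance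
    of induction or comprehension is therefore settled at a stage. *)
Lemma union_RCA : RCAm pi (union F).
Proof.
split=> [P /Sig_union[i h]|P /Sig_union[i h] /Sig_union[j h']].
  exact: (F_RCA i).1 h.
have ij k k' Q : (k <= k')%N -> sigma1_def pi (F k) Q -> sigma1_def pi (F k') Q.
  by move=> kk; apply: Sig_rename => //; apply: chain_sub.
apply: (sub_fam_inM (union_sub (maxn i j))); apply: (F_RCA _).2.
  exact: ij (leq_maxl i j) h.
exact: ij (leq_maxr i j) h'.
Qed.
End Union.

Variable D : (S -> Prop) -> nat -> S -> Prop.

(** The premises, being an infinite tree and density, do not depend on [s], so a set treated once
    remains treated in every larger family. *)
Definition treated s (P : S -> Prop) : Prop :=
  (tree P -> unbounded P -> exists G, [/\ branch G, subp G P & inM s G]) /\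
  ((forall k v, exists w, pre v w /\ D P k w) ->
   exists G, [/\ branch G, inM s G & forall k, exists2 w, D P k w & G w]).

Lemma treated_sub s s' P : sub_fam s s' -> treated s P -> treated s' P.
Proof.
move=> ss [h1 h2]; split=> [t u|/h2 [G [bG MG hG]]].
  by have [G [bG GP MG]] := h1 t u; exists G; split=> //; apply: sub_fam_inM MG.
by exists G; split=> //; apply: sub_fam_inM MG.
Qed.

Lemma closure_scons s G : ISig pi (scons G s) ->
  exists s', [/\ RCAm pi s', sub_fam s s' & inM s' G].
Proof.
move=> /(delta_closure pi_surj) [s' [MR h]]; exists s'; split=> //.
  by move=> k; apply: (h k.+1).
exact: (h 0%N).
Qed.

Lemma treat_one s P : RCAm pi s -> inM s P -> exists s',
  [/\ RCAm pi s', sub_fam s s' & treated s' P].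
Proof.
move=> MR MP.
have [s1 [MR1 ss1 h1]] : exists s', [/\ RCAm pi s', sub_fam s s' &
    tree P -> unbounded P -> exists G, [/\ branch G, subp G P & inM s' G]].
  have [[tP uP]|n] := EM (tree P /\ unbounded P); last first.
    by exists s; split; [exact: MR|exact: sub_fam_refl|move=> t u; case: n].
  have [G [bG IG GP]] := wkl_ext pi_surj MR MP tP uP.
  have [s' [MR' ss MG]] := closure_scons IG.
  by exists s'; split=> // _ _; exists G.
have [s2 [MR2 ss2 h2]] : exists s', [/\ RCAm pi s', sub_fam s1 s' &
   ((forall k v, exists w, pre v w /\ D P k w) ->
   exists G, [/\ branch G, inM s' G & forall k, exists2 w, D P k w & G w])].
  have [dP|n] := EM (forall k v, exists w, pre v w /\ D P k w); last first.
    by exists s1; split; [exact: MR1|exact: sub_fam_refl|move=> t; case: n].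
  have [G [bG IG GP]] := cohen_ext pi_surj MR1 dP.
  have [s' [MR' ss MG]] := closure_scons IG.
  by exists s'; split=> // _; exists G.
exists s2; split=> //; first exact: sub_fam_trans ss1 ss2.
split=> // tP uP; have [G [bG GP MG]] := h1 tP uP; exists G; split=> //.
exact: sub_fam_inM ss2 MG.
Qed.

Lemma treat_all s : RCAm pi s -> exists s',
  [/\ RCAm pi s', sub_fam s s' & forall k, treated s' (s k)].
Proof.
move=> MR.
have /choice[f fE] : forall x : (nat -> S -> Prop) * (S -> Prop), exists s',
    RCAm pi x.1 -> inM x.1 x.2 -> [/\ RCAm pi s', sub_fam x.1 s' & treated s' x.2].
  move=> [s0 P]; have [MR0|n] := EM (RCAm pi s0); last by exists s0.
  have [MP|n] := EM (inM s0 P); last by exists s0.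
  by have [s' h] := treat_one MR0 MP; exists s'.
pose F := fix F k := if k is j.+1 then f (F j, s j) else s.
have hF k : RCAm pi (F k) /\ sub_fam s (F k).
  elim: k => [|k [IH1 IH2]] /=; first by split=> // k; exists k.
  have [h1 h2 _] := fE (F k, s k) IH1 (IH2 k).
  by split=> //; apply: sub_fam_trans IH2 h2.
have hS k : sub_fam (F k) (F k.+1) /\ treated (F k.+1) (s k).
  by have [h1 h2] := hF k; have [_ h3 h4] := fE (F k, s k) h1 (h2 k).
exists (union F); split.
- by apply: union_RCA => k; [case: (hF k)|case: (hS k)].
- exact: (union_sub F 0%N).
- by move=> k; apply: treated_sub (union_sub F k.+1) _; case: (hS k).
Qed.

Theorem model_ext s : RCAm pi s -> exists s',
  [/\ RCAm pi s', sub_fam s s' & forall P, inM s' P -> treated s' P].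
Proof.
move=> MR.
have /choice[f fE] : forall s0, exists s', RCAm pi s0 ->
    [/\ RCAm pi s', sub_fam s0 s' & forall k, treated s' (s0 k)].
  move=> s0; have [MR0|n] := EM (RCAm pi s0); last by exists s0.
  by have [s' h] := treat_all MR0; exists s'.
pose F := fix F k := if k is j.+1 then f (F j) else s.
have hF k : RCAm pi (F k).
  by elim: k => [|k IH] //=; case: (fE (F k) IH).
have hS k : sub_fam (F k) (F k.+1) /\ forall l, treated (F k.+1) (F k l).
  by case: (fE (F k) (hF k)).
exists (union F); split.
- by apply: union_RCA => k; [exact: hF|case: (hS k)].
- exact: (union_sub F 0%N).
- move=> P /union_inM [i [k <-]].
  by apply: treated_sub (union_sub F i.+1) _; case: (hS i).
Qed.

End Iteration.

(** * WKL and the uncountability of the reals in a model *)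

Section Satx.
Variable M : arith.

(* [sat] with the defined connectives rendered by the connectives of Prop. *)
Fixpoint satx (C : (M -> Prop) -> Prop) (A : form) (r : nat -> M)
    (s : nat -> M -> Prop) : Prop :=
  match A with
  | fbot => False
  | feq t u => eval r t = eval r u
  | flt t u => alt (eval r t) (eval r u)
  | fin t X => s X (eval r t)
  | fimp A B =>
    let imp := satx C A r s -> satx C B r s in
    match B with
    | fbot =>
      match A with
      | fimp A1 (fimp A2 fbot) => satx C A1 r s /\ satx C A2 r s
      | fallN (fimp A1 fbot) => exists n, satx C A1 (scons n r) s
      | fallS (fimp A1 fbot) => exists P, C P /\ satx C A1 r (scons P s)
      | _ => ~ satx C A r s
      end
    | _ =>
      match A with
      | fimp A1 A2 =>
        match A2 with
        | fbot =>
          match A1 with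
          | fimp _ (fimp _ fbot) => imp
          | _ => satx C A1 r s \/ satx C B r s
          end
        | _ => imp
        end
      | _ => imp
      end
    end
  | fallN A => forall n, satx C A (scons n r) s
  | fallS A => forall P, C P -> satx C A r (scons P s)
  end.

Lemma satx_imp C A B r s : satx C (fimp A B) r s =
(let imp := satx C A r s -> satx C B r s in
    match B with
    | fbot =>
      match A with
      | fimp A1 (fimp A2 fbot) => satx C A1 r s /\ satx C A2 r s
      | fallN (fimp A1 fbot) => exists n, satx C A1 (scons n r) s
      | fallS (fimp A1 fbot) => exists P, C P /\ satx C A1 r (scons P s)
      | _ => ~ satx C A r s
      end
    | _ =>
      match A with
      | fimp A1 A2 =>
        match A2 with
        | fbot =>
          match A1 with
          | fimp _ (fimp _ fbot) => imp
          | _ => satx C A1 r s \/ satx C B r s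
          end
        | _ => imp
        end
      | _ => imp
      end
    end).
Proof. reflexivity. Qed.

Lemma fand_prop (P Q : Prop) : ((P -> Q -> False) -> False) = (P /\ Q).
Proof.
apply: propext; split=> [h|[p q] h]; last exact: h.
by split; apply: contrapT => n; apply: h => p q; apply: n.
Qed.

Lemma for_prop (P Q : Prop) : ((P -> False) -> Q) = (P \/ Q).
Proof.
apply: propext; split=> [h|[p|q] h]; [|by case: (h p)|exact: q].
by have [p|/h] := EM P; [left|right].
Qed.

Lemma fex_prop T (P : T -> Prop) : ((forall x, P x -> False) -> False) = exists x, P x.
Proof.
apply: propext; split=> [h|[x px] /(_ x px) //].
by apply: contrapT => n; apply: h => x px; apply: n; exists x.
Qed.

Lemma fexS_prop T (C P : T -> Prop) :
  ((forall x, C x -> P x -> False) -> False) = exists x, C x /\ P x.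
Proof.
apply: propext; split=> [h|[x [cx px]] /(_ x cx px) //].
by apply: contrapT => n; apply: h => x cx px; apply: n; exists x.
Qed.

(** [fimp (fand A1 A2) B] is literally also a disjunction; [satx] reads it as an implication. The
    readable form allows WKL and the statement on the reals to be matched by computation. *)
Lemma satxE C A r s : sat C A r s = satx C A r s.
Proof.
revert A r s; fix IH 1 => -[|t u|t u|t X|A B|A|A] r s; try reflexivity;
  last 2 first.
- by apply: eq_forall => n; apply: IH.
- by apply: eq_forall => P; congr (_ -> _); apply: IH.
have gen : sat C (fimp A B) r s = (satx C A r s -> satx C B r s).
  by rewrite -(IH A) -(IH B).
have and_case A1 A2 : (forall r s, sat C A1 r s = satx C A1 r s) ->
    (forall r s, sat C A2 r s = satx C A2 r s) ->
    sat C (fand A1 A2) r s = (satx C A1 r s /\ satx C A2 r s).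
  by move=> e1 e2; rewrite -e1 -e2; apply: fand_prop.
have exN_case A1 : (forall r s, sat C A1 r s = satx C A1 r s) ->
    sat C (fexN A1) r s = (exists n, satx C A1 (scons n r) s).
  by move=> e1; under eq_exists do rewrite -e1; apply: fex_prop.
have exS_case A1 : (forall r s, sat C A1 r s = satx C A1 r s) ->
    sat C (fexS A1) r s = (exists P, C P /\ satx C A1 r (scons P s)).
  by move=> e1; under eq_exists do rewrite -e1; apply: fexS_prop.
have or_case A1 : (forall r s, sat C A1 r s = satx C A1 r s) ->
    sat C (for_ A1 B) r s = (satx C A1 r s \/ satx C B r s).
  by move=> e1; rewrite -e1 -(IH B); apply: for_prop.
(* [satx_imp] keeps conversion from unfolding [satx] on the subformulas. *)
rewrite satx_imp.
destruct B.
  destruct A as [|t u|t u|t X|A1 A2|A1|A1]; cbv beta iota zeta;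
    [exact gen|exact gen|exact gen|exact gen| | |].
  - destruct A2 as [|t u|t u|t X|A3 A4|A3|A3]; cbv beta iota zeta;
      [exact gen|exact gen|exact gen|exact gen| |exact gen|exact gen].
    destruct A4; cbv beta iota zeta; [|exact gen..].
    exact (and_case _ _ (IH A1) (IH A3)).
  - destruct A1 as [|t u|t u|t X|A3 A4|A3|A3]; cbv beta iota zeta;
      [exact gen|exact gen|exact gen|exact gen| |exact gen|exact gen].
    destruct A4; cbv beta iota zeta; [|exact gen..].
    exact (exN_case _ (IH A3)).
  - destruct A1 as [|t u|t u|t X|A3 A4|A3|A3]; cbv beta iota zeta;
      [exact gen|exact gen|exact gen|exact gen| |exact gen|exact gen].
    destruct A4; cbv beta iota zeta; [|exact gen..].
    exact (exS_case _ (IH A3)).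
all: destruct A as [|t' u'|t' u'|t' X'|A1 A2|A1|A1]; cbv beta iota zeta;
  [exact gen|exact gen|exact gen|exact gen| |exact gen|exact gen].
all: destruct A2; cbv beta iota zeta; [|exact gen..].
all: have h := or_case _ (IH A1).
all: destruct A1 as [|t1 u1|t1 u1|t1 X1|A3 A4|A3|A3]; cbv beta iota zeta;
  [exact h|exact h|exact h|exact h| |exact h|exact h].
all: destruct A4 as [|t4 u4|t4 u4|t4 X4|A5 A6|A5|A5]; cbv beta iota zeta;
  [exact h|exact h|exact h|exact h| |exact h|exact h].
all: destruct A6; cbv beta iota zeta; [exact gen|exact h..].
Qed.
End Satx.

Section Semantic.
Variable M : arith.
Implicit Types (X Y F G f T : M -> Prop) (C : (M -> Prop) -> Prop).
Local Notation "x <=! y" := (x <s y \/ x = y) (at level 70).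

Definition pairm (m n : M) : M := (m +s n) *s (m +s n) +s m.

Definition pow2' (p : M) : Prop := forall d c, p = d *s c ->
  d = 1s \/ exists b, d = b +s b.
Definition pre' (t u : M) : Prop := exists p r, pow2' p /\ r <s p /\
  u +s 1s = (t +s 1s) *s p +s r.
Definition iffm (P Q : Prop) := (P -> Q) /\ (Q -> P).

(** The clause for a digit 0 appears as the disjunction [f n \/ _], because an implication with a
    negated premise is the same formula as a disjunction. *)
Definition wkl_sem C : Prop := forall T, C T ->
  (forall u t, T u /\ pre' t u -> T t) /\ (forall k, exists u, k <s u /\ T u) ->
  exists f, C f /\ exists G, C G /\
    (((forall m, G m -> exists n u, m = pairm n u) /\
      (forall n, exists u, forall u', iffm (G (pairm n u')) (u' = u))) /\
     (G (pairm 0s 0s) /\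
      forall n u, G (pairm n u) ->
       (f n -> G (pairm (n +s 1s) (u +s u +s 1s +s 1s))) /\
       (f n \/ G (pairm (n +s 1s) (u +s u +s 1s))))) /\
    forall n u, G (pairm n u) -> T u.

Lemma wkl_semE C r s : satx C WKL r s = wkl_sem C.
Proof. vm_compute; reflexivity. Qed.

Record mq := MQ { qp : M; qn : M; qd : M }.
Definition qcode q := pairm (pairm (qp q) (qn q)) (qd q).
Definition qden q := qd q +s 1s.
Definition qadd q r := MQ
  (qp q *s qden r +s qp r *s qden q) (qn q *s qden r +s qn r *s qden q)
  (qd q *s qd r +s qd q +s qd r).
Definition qopp q := MQ (qn q) (qp q) (qd q).
Definition qlt q r : Prop :=
  qp q *s qden r +s qn r *s qden q <s qn q *s qden r +s qp r *s qden q.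
Definition qle q r : Prop :=
  qp q *s qden r +s qn r *s qden q <=! qn q *s qden r +s qp r *s qden q.
Definition qdist q r e : Prop :=
  qlt (qadd q (qopp r)) e /\ qlt (qadd r (qopp q)) e.
Definition allq (A : mq -> Prop) : Prop := forall a b c, A (MQ a b c).
Definition exq (A : mq -> Prop) : Prop := exists a b c, A (MQ a b c).

Definition mseq := M -> mq -> Prop.
Definition mseq_of X : mseq := fun i q => X (pairm i (qcode q)).
Definition mrow F n : mseq := fun i q => F (pairm (pairm n i) (qcode q)).

Definition mrational_seq X : Prop :=
  (forall m, X m -> exists i, exq (fun q => m = pairm i (qcode q))) /\
  (forall i, exq (fun q => allq (fun r => iffm (mseq_of X i r) (qcode r = qcode q)))).
Definition mrational_dblseq F : Prop :=
  (forall m, F m -> exists n i, exq (fun q => m = pairm (pairm n i) (qcode q))) /\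
  (forall n i, exq (fun q => allq (fun r => iffm (mrow F n i r) (qcode r = qcode q)))).
Definition mcauchy (x : mseq) : Prop := allq (fun e => qlt (MQ 0s 0s 0s) e ->
  exists N, forall m n, (N <=! m) /\ (N <=! n) ->
    allq (fun q => allq (fun r => x m q /\ x n r -> qdist q r e))).
Definition mrealle (x y : mseq) : Prop := allq (fun e => qlt (MQ 0s 0s 0s) e ->
  exists N, forall n, (N <=! n) ->
    allq (fun q => allq (fun r => x n q /\ y n r -> qle q (qadd r e)))).

Definition reals_sem C : Prop := forall F, C F ->
  mrational_dblseq F /\ (forall n, mcauchy (mrow F n)) ->
  exists Y, C Y /\ ((mrational_seq Y /\ mcauchy (mseq_of Y)) /\
    forall n, ~ (mrealle (mrow F n) (mseq_of Y) /\ mrealle (mseq_of Y) (mrow F n))).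

Lemma reals_semE C r s : satx C reals_uncountable r s = reals_sem C.
Proof. vm_compute; reflexivity. Qed.

End Semantic.

(** * Inequalities between fractions, cleared of denominators *)

Section Inequalities.
Variable R : realDomainType.
Implicit Types A B d f W p T U : R.

(** In fractions: if A/d < B/f + 1/(8W), B/f < (T + 2)/(4W) and (T + 3)/(4W) <= U/(4Wp), then A/d +
    1/(8W) < U/(4Wp). Here A/d is a late term, B/f the reference term, and U/(4Wp) an approximation
    of the new real. *)
Lemma avoid_above A B d f W p T U : 0 < d -> 0 < f -> 0 < W -> 0 < p ->
  (A * f - B * d) * (8 * W) < d * f -> 4 * W * B < (T + 2) * f ->
  (T + 3) * p <= U -> (8 * W * A + d) * (4 * W * p) < U * d * (8 * W).
Proof.
move=> d0 f0 W0 p0 h1 h2 h3.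
have h4 : 8 * W * A < (2 * T + 5) * d.
  rewrite -(ltr_pM2r f0); have h2' := h2; rewrite -(ltr_pM2r d0) in h2'.
  by lra.
have h5 : 0 < 4 * W * p by rewrite !mulr_gt0.
have h6 : (8 * W * A + d) * (4 * W * p) < (2 * T + 6) * d * (4 * W * p).
  by rewrite (ltr_pM2r h5); lra.
have h7 : (T + 3) * p * (d * (8 * W)) <= U * (d * (8 * W)).
  by rewrite ler_pM2r // !mulr_gt0.
by lra.
Qed.

(** The mirror image: B/f lies at or above (T + 2)/(4W) and U/(4Wp) at or below (T + 1)/(4W), so the
    late term A/d exceeds U/(4Wp) by more than 1/(8W). *)
Lemma avoid_below A B d f W p T U : 0 < d -> 0 < f -> 0 < W -> 0 < p ->
  (B * d - A * f) * (8 * W) < d * f -> (T + 2) * f <= 4 * W * B ->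
  U <= (T + 1) * p -> (8 * W * U + 4 * W * p) * d < A * (4 * W * p) * (8 * W).
Proof.
move=> d0 f0 W0 p0 h1 h2 h3.
have h4 : (2 * T + 3) * d < 8 * W * A.
  rewrite -(ltr_pM2r f0); have h2' := h2; rewrite -(ler_pM2r d0) in h2'.
  by lra.
have h5 : 0 < 4 * W * p by rewrite !mulr_gt0.
have h6 : (2 * T + 3) * d * (4 * W * p) < 8 * W * A * (4 * W * p).
  by rewrite (ltr_pM2r h5).
have h7 : U * (d * (8 * W)) <= (T + 1) * p * (d * (8 * W)).
  by rewrite ler_pM2r // !mulr_gt0.
by lra.
Qed.

(* [U / (V p)] and [U' / (V p')] both lie in [[v / V, (v + 1) / V)]. *)
Lemma dyadic_close U U' V p p' v r r' c e : 0 < V -> 0 < p -> 0 < p' ->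
  0 <= r' -> r < p -> U = v * p + r -> U' = v * p' + r' -> 0 < c -> c <= V ->
  1 <= e -> (U * (V * p') - U' * (V * p)) * c < e * (V * p * (V * p')).
Proof.
move=> V0 p0 p0' r0' rp UE UE' c0 cV e1.
have XE : U * (V * p') - U' * (V * p) = V * (r * p' - r' * p).
  by rewrite UE UE'; ring.
have h1 : r * p' < p * p' by rewrite ltr_pM2r.
have h2 : 0 <= r' * p by rewrite mulr_ge0 // ltW.
have h3 : V * (r * p' - r' * p) < V * (p * p') by rewrite ltr_pM2l //; lra.
have q0 : 0 < V * (p * p') by rewrite !mulr_gt0.
have h4 : V * (p * p') * c <= V * (p * p') * V by rewrite ler_pM2l.
have h5 : V * (r * p' - r' * p) * c < V * (p * p') * c by rewrite ltr_pM2r.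
have q1 : 0 < V * (p * p') * V by rewrite mulr_gt0.
have h6 : 1 * (V * (p * p') * V) <= e * (V * (p * p') * V) by rewrite ler_pM2r.
rewrite XE.
by lra.
Qed.

End Inequalities.

Section Pairing.
Variable S : dsr.
Implicit Types m n i c : S.

(** With k = m + n, the summand m <= k is smaller than the gap 2k + 1 to the next square, so k can
    be recovered. *)
Lemma pairm_inj m n m' n' : pairm m n = pairm m' n' -> m = m' /\ n = n'.
Proof.
rewrite /pairm => e.
have lt k k' m0 m1 : m0 <=s k -> k *s k +s m0 = k' *s k' +s m1 -> ~ k <s k'.
  by move=> h1 h2 /lemP[j jE]; rewrite jE in h2; zify_m; nra.
have [h|[h|h]] := ltm_total (m +s n) (m' +s n').
- by case: (lt _ _ _ _ _ e h); zify_m; lra.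
- by rewrite h in e; split; mlra.
- by case: (lt _ _ _ _ _ (esym e) h); zify_m; lra.
Qed.

Lemma pairm_ge m n : m <=s pairm m n /\ n <=s pairm m n.
Proof.
rewrite /pairm; have h : (m +s n) <=s (m +s n) *s (m +s n).
  have [->|[k ->]] := zero_or_S (m +s n); last by zify_m; nra.
  by zify_m; lra.
by split; rewrite ziD; zify_m; rewrite ?(ziD, ziM) in h *; lra.
Qed.

Lemma qcode_inj (q r : mq S) : qcode q = qcode r -> q = r.
Proof.
case: q r => a b c [a' b' c'] /= /pairm_inj /= [/pairm_inj[-> ->] ->].
by [].
Qed.

End Pairing.

(** * From a branch to a path with its sequence of restrictions *)

Section Graph.
Variables (S : dsr) (pi : nat -> S).
Hypothesis pi_surj : forall x, exists k, pi k = x.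
Variable s : nat -> S -> Prop.
Hypothesis MR : RCAm pi s.
Let MI : ISig pi s := MR.1.
Local Notation Sig := (sigma1_def pi s).

(** The graph of a total Sigma_1 function is Delta_1: a number lies outside it if it is no pair, or
    if the function takes another value. *)
Lemma graph_inM (phi : S -> S -> Prop) :
  Sig (fun r => phi (r 0%N) (r 1%N)) -> (forall i, exists c, phi i c) ->
  (forall i c c', phi i c -> phi i c' -> c = c') ->
  inM s (fun m => exists i c, m = pairm i c /\ phi i c).
Proof.
move=> Sphi total uniq.
have Sphi' f g : term_def pi f -> term_def pi g -> Sig (fun r => phi (f r) (g r)).
  exact: (Sig_eta2 pi_surj Sphi).
apply: MR.2; first by rewrite /pairm; ddef.
apply: Sig_ext (_ : Sig (fun r =>
   (forall i, i <s r 0%N +s 1s -> forall c, c <s r 0%N +s 1s ->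
     ~ (r 0%N = (i +s c) *s (i +s c) +s i)) \/
   exists i c c', (r 0%N = (i +s c) *s (i +s c) +s i /\ phi i c') /\ ~ (c = c')));
  last by ddef.
move=> r; move: (r 0%N) => m; split=> [[h|[i [c [c' [[mE h1] h2]]]]]|h].
- move=> [i [c [mE _]]]; have [h1 h2] := pairm_ge i c.
  by apply: (h i _ c _ mE); rewrite mE; apply/ltS.
- move=> [j [d [mE' h3]]]; move: mE; rewrite mE' => /pairm_inj[ji dc].
  by apply: h2; rewrite -dc; apply: uniq h3 _; rewrite ji.
- have [[i [c mE]]|n] := EM (exists i c, m = pairm i c).
    right; have [c' hc'] := total i; exists i, c, c'; split=> // cc'.
    by apply: h; exists i, c; split=> //; rewrite cc'.
  by left=> i _ c _ mE; apply: n; exists i, c.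
Qed.

Variable G : S -> Prop.
Hypothesis bG : branch G.
Hypothesis MG : inM s G.
Implicit Types p t u v n : S.
Local Notation strlen := (has_length pi_surj MI).
Local Notation exp2 := (two_pow pi_surj MI).

Lemma Sig_G f : term_def pi f -> Sig (fun r => G (f r)).
Proof. by move=> tf; apply: Sig_D0 => //; apply: D0_mem. Qed.
#[local] Hint Resolve Sig_G : defin.
#[local] Hint Extern 1 (sigma1_def _ _ (fun r => has_length _ _ _ _)) => apply: Sig_strlen : defin.
#[local] Hint Extern 1 (sigma1_def _ _ (fun r => _ = two_pow _ _ _)) => apply: Sig_two_pow : defin.

Lemma level_same p u v : at_level p (u +s 1s) -> at_level p (v +s 1s) ->
  pre u v -> u = v.
Proof.
move=> [h1 h2] [h3 h4] uv; apply: contrapT => ne.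
by case: (pre_lt_child uv ne) => {ne} /pre_le; rewrite /ch0 /ch1 => h; zify_m; lra.
Qed.

Lemma G_level_uniq p u v : G u -> G v -> at_level p (u +s 1s) ->
  at_level p (v +s 1s) -> u = v.
Proof.
move=> Gu Gv lu lv; have [_ _ h] := bG; have [uv|vu] := h u v Gu Gv.
  exact: level_same lu lv uv.
by apply/esym/(level_same lv lu).
Qed.

Lemma G_len n : exists u, G u /\ strlen u n.
Proof.
have [tG uG _] := bG.
exact: (unbounded_level pi_surj MR tG uG (@pow2_two_pow _ _ pi_surj _ MI n)).
Qed.

Lemma G_len_uniq n u v : G u -> G v -> strlen u n -> strlen v n -> u = v.
Proof. exact: G_level_uniq. Qed.

Lemma G_child u : G u -> G (ch0 u) \/ G (ch1 u).
Proof.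
move=> Gu; have [tG uG _] := bG; have [v [uv Gv]] := uG u.
have [||h|h] := @pre_lt_child _ u v.
- by apply: (branch_pre bG) => //; zify_m; lra.
- by move=> e; rewrite e in uv; case: (ltm_irr uv).
- by left; apply: tG Gv h.
- by right; apply: tG Gv h.
Qed.

Lemma G_child_uniq u n : strlen u n -> G (ch0 u) -> G (ch1 u) -> False.
Proof.
move=> hu h0 h1.
have e : ch0 u = ch1 u.
  by apply: (G_len_uniq (n := n +s 1s)) => //; apply: strlen_ch hu _; [left|right].
by move: e; rewrite /ch0 /ch1 => e; mlra.
Qed.

(** The n-th digit of the branch is 1. Replacing [ch1] by [ch0] gives the complement, so the set is
    Delta_1. *)
Definition path_set n : Prop := exists u, (G u /\ strlen u n) /\ G (ch1 u).

Lemma path_set_inM : inM s path_set.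
Proof.
apply: MR.2; first by rewrite /path_set /ch1; ddef.
apply: Sig_ext (_ : Sig (fun r => exists u, (G u /\ strlen u (r 0%N)) /\
  G (u +s u +s 1s))); last by ddef.
move=> r; move: (r 0%N) => n; split.
  move=> [u [[Gu lu] G0]] [v [[Gv lv] G1]].
  have e := G_len_uniq Gu Gv lu lv; rewrite -e in G1.
  exact: G_child_uniq lu G0 G1.
move=> h; have [u [Gu lu]] := G_len n; exists u; split=> //.
have [//|G1] := G_child Gu; case: h; exists u; split=> //.
Qed.

Definition path_graph (m : S) : Prop := exists n u, m = pairm n u /\ (G u /\ strlen u n).

Lemma path_graph_inM : inM s path_graph.
Proof.
apply: (graph_inM (phi := fun n u => G u /\ strlen u n)); first by ddef.
  exact: G_len.
by move=> n u v [Gu lu] [Gv lv]; apply: G_len_uniq lu lv.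
Qed.

Lemma path_graphE n u : path_graph (pairm n u) <-> G u /\ strlen u n.
Proof.
split=> [[n' [u' [/pairm_inj[-> ->]]]]//|h].
by exists n, u.
Qed.

Lemma G0s : G 0s.
Proof.
have [tG _ _] := bG; have [u [Gu _]] := G_len 0s.
by apply: tG Gu _; apply: (pre0 pi_surj MI).
Qed.

Lemma branch_wkl (T : S -> Prop) : subp G T ->
  exists f, inM s f /\ exists G, inM s G /\
    (((forall m, G m -> exists n u, m = pairm n u) /\
      (forall n, exists u, forall u', iffm (G (pairm n u')) (u' = u))) /\
     (G (pairm 0s 0s) /\
      forall n u, G (pairm n u) ->
       (f n -> G (pairm (n +s 1s) (u +s u +s 1s +s 1s))) /\
       (f n \/ G (pairm (n +s 1s) (u +s u +s 1s))))) /\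
    forall n u, G (pairm n u) -> T u.
Proof.
move=> GT; exists path_set; split; first exact: path_set_inM.
exists path_graph; split; first exact: path_graph_inM.
split; last by move=> n u /path_graphE[/GT].
split; first split.
- by move=> m [n [u [-> _]]]; exists n, u.
- move=> n; have [u [Gu lu]] := G_len n; exists u => u'; split.
    by move=> /path_graphE [Gu' lu']; apply: G_len_uniq lu' lu.
  by move=> ->; apply/path_graphE.
- split.
    by apply/path_graphE; split; [exact: G0s|exact: strlen0].
  move=> n u /path_graphE [Gu lu]; split.
    move=> [v [[Gv lv] G1]]; have e := G_len_uniq Gu Gv lu lv.
    apply/path_graphE; rewrite -[u +s u +s 1s +s 1s]/(ch1 u) e; split=> //.
    by apply: strlen_ch lv _; right.
  have [h|h] := G_child Gu.
    right; apply/path_graphE; split=> //.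
    by apply: strlen_ch lu _; left.
  by left; exists u.
Qed.

End Graph.

(** * A real outside a given family, from a Cohen generic branch *)

Section Reals.
Variables (S : dsr) (pi : nat -> S).
Hypothesis pi_surj : forall x, exists k, pi k = x.
Variable s : nat -> S -> Prop.
Hypothesis MR : RCAm pi s.
Let MI : ISig pi s := MR.1.
Local Notation Sig := (sigma1_def pi s).
Implicit Types (u v w p n m i e : S) (q : mq S) (F Y G : S -> Prop).

Lemma le_or (x y : S) : (x <s y \/ x = y) <-> x <=s y.
Proof.
split=> [[h|->//]|h]; first by mlra.
by have [h'|[h'|h']] := ltm_total x y; [left|right|exfalso; mlra].
Qed.

(** [p] is 2 to the difference of the lengths, so (u + 1)/P is (v + 1)/V plus an error r/P below
    1/V. *)
Lemma pre_level (V P v u : S) : pow2 V -> at_level V (v +s 1s) -> pow2 P ->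
  at_level P (u +s 1s) -> pre v u -> exists p r,
  [/\ 0s <s p, r <s p, u +s 1s = (v +s 1s) *s p +s r & P = V *s p].
Proof.
move=> hV [l1 l2] hP lP [p [r [hp [rp E]]]]; have p0 := pow2_gt0 hp.
exists p, r; split=> //.
apply: (level_uniq pi_surj MI hP _ lP); first exact: (pow2_mul pi_surj MI hV hp).
rewrite E; zify_m.
have h1 : zi V * zi p <= (zi v + 1) * zi p by rewrite ler_wpM2r.
have h2 : (zi v + 1 + 1) * zi p <= (zi V + zi V) * zi p by rewrite ler_wpM2r.
by split; zi_goal; lra.
Qed.

Definition dyad u p : mq S := MQ (u +s 1s) 0s p.

(** From index [N] on, the approximations given by extensions of [w] stay on one fixed side of the
    row, at distance more than 1/(e + 1). Only strings and rows of the ground model are mentioned,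
    so the generic real need not exist yet. *)
Definition avoids F n w : Prop := exists e N,
  (forall m q u p, N <=s m -> mrow F n m q -> pre w u -> pow2 (p +s 1s) ->
     at_level (p +s 1s) (u +s 1s) -> ~ qle (dyad u p) (qadd q (MQ 1s 0s e))) \/
  (forall m q u p, N <=s m -> mrow F n m q -> pre w u -> pow2 (p +s 1s) ->
     at_level (p +s 1s) (u +s 1s) -> ~ qle q (qadd (dyad u p) (MQ 1s 0s e))).

Lemma row_total F n i : mrational_dblseq F -> exists q, mrow F n i q.
Proof.
move=> [_ h]; have [a [b [c hq]]] := h n i; exists (MQ a b c).
exact: (hq a b c).2.
Qed.

(* The string [v] of level [W] has the dyadic interval
   [[(v + 1) / W, (v + 2) / W)].  Beyond some index the row stays within
   1 / (8 W) of one of its terms, hence it keeps at least that distance from the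
   first or from the last quarter of this interval. *)
Lemma avoids_dense F n v : mrational_dblseq F -> mcauchy (mrow F n) ->
  exists w, pre v w /\ avoids F n w.
Proof.
move=> hF hC.
have [|W [hW [W1 W2]]] := @pow2_level _ _ pi_surj _ MI (v +s 1s); first by mlra.
have W0 := pow2_gt0 hW.
(* The tolerance is 1/(8W); a code stores its denominator minus one. *)
have [e eE] : exists e, zi e = 8 * zi W - 1.
  have [|e eE] := @zi_sub S 1s ((W +s W) +s (W +s W) +s ((W +s W) +s (W +s W))).
    by zify_m; lra.
  by exists e; rewrite eE !(ziD, zi1); ring.
have hW4 : pow2 (W +s W +s (W +s W)) by do 2!apply: (pow2_double pi_surj MI).
have e0 : qlt (MQ 0s 0s 0s) (MQ 1s 0s e) by rewrite /qlt /qden /=; mlra.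
have [N hN] := hC 1s 0s e e0.
have [[ra rb rc] hr] := row_total n N hF.
have close m a b c : N <=s m -> mrow F n m (MQ a b c) ->
  ((zi a - zi b) * (zi rc + 1) - (zi ra - zi rb) * (zi c + 1)) * (8 * zi W) <
     (zi c + 1) * (zi rc + 1) /\
  ((zi ra - zi rb) * (zi c + 1) - (zi a - zi b) * (zi rc + 1)) * (8 * zi W) <
     (zi c + 1) * (zi rc + 1).
  move=> /le_or Nm hm.
  have [] := hN m N (conj Nm (or_intror erefl)) a b c ra rb rc (conj hm hr).
  rewrite /qlt /qadd /qopp /qden /= => /zi_ltP h1 /zi_ltP h2.
  rewrite !(ziD, ziM, zi1, zi0) eE in h1 h2.
  by split; lra.
have W0' : 0 < zi W by zify_m; lra.
have rc0 : 0 < zi rc + 1 by have := zi_ge0 rc => ?; lra.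
(* The reference term is compared with the midpoint (4(v + 1) + 2)/(4W) of the interval of [v]: to
   its left, the digits 11 lead to the last quarter; otherwise 00 leads to the first. *)
have [lt|ge] := ltP (4 * zi W * (zi ra - zi rb)) ((4 * (zi v + 1) + 2) * (zi rc + 1)).
- exists (ch1 (ch1 v)); split.
    by apply: (pre_trans pi_surj MI (pre_ch1 pi_surj MI v)); apply: (pre_ch1 pi_surj MI).
  exists e, N; left=> m [a b c] u p Nm hm wu hp lp.
  have lw : at_level (W +s W +s (W +s W)) (ch1 (ch1 v) +s 1s).
    by rewrite /ch1; split; mlra.
  have [d [r [d0 rd uE pE]]] := pre_level hW4 lw hp lp wu.
  have [h1 _] := close m a b c Nm hm.
  have d0' : 0 < zi d by zify_m; lra.
  have c0 : 0 < zi c + 1 by have := zi_ge0 c => ?; lra.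
  have uE' : zi u + 1 = (4 * (zi v + 1) + 3) * zi d + zi r.
    by move: uE => /(f_equal (@zi _)); rewrite /ch1 !(ziD, ziM, zi1) => ->; ring.
  have pE' : zi p + 1 = 4 * zi W * zi d.
    by move: pE => /(f_equal (@zi _)); rewrite !(ziD, ziM, zi1) => ->; ring.
  have r0 := zi_ge0 r.
  have hU : (4 * (zi v + 1) + 3) * zi d <= zi u + 1 by lra.
  have := avoid_above c0 rc0 W0' d0' h1 lt hU; rewrite -pE' => H.
  rewrite /qle /qadd /qden /= => /le_or; rewrite !(ziD, ziM, zi1, zi0) eE => H'.
  by lra.
- exists (ch0 (ch0 v)); split.
    by apply: (pre_trans pi_surj MI (pre_ch0 pi_surj MI v)); apply: (pre_ch0 pi_surj MI).
  exists e, N; right=> m [a b c] u p Nm hm wu hp lp.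
  have lw : at_level (W +s W +s (W +s W)) (ch0 (ch0 v) +s 1s).
    by rewrite /ch0; split; mlra.
  have [d [r [d0 rd uE pE]]] := pre_level hW4 lw hp lp wu.
  have [_ h1] := close m a b c Nm hm.
  have d0' : 0 < zi d by zify_m; lra.
  have c0 : 0 < zi c + 1 by have := zi_ge0 c => ?; lra.
  have uE' : zi u + 1 = (4 * (zi v + 1)) * zi d + zi r.
    by move: uE => /(f_equal (@zi _)); rewrite /ch0 !(ziD, ziM, zi1) => ->; ring.
  have pE' : zi p + 1 = 4 * zi W * zi d.
    by move: pE => /(f_equal (@zi _)); rewrite !(ziD, ziM, zi1) => ->; ring.
  have hU : zi u + 1 <= (4 * (zi v + 1) + 1) * zi d.
    by move: rd => /zi_ltP rd; lra.
  have := avoid_below c0 rc0 W0' d0' h1 ge hU; rewrite -pE' => H.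
  rewrite /qle /qadd /qden /= => /le_or; rewrite !(ziD, ziM, zi1, zi0) eE => H'.
  by lra.
Qed.

Variable G : S -> Prop.
Hypothesis bG : branch G.
Hypothesis MG : inM s G.
Local Notation strlen := (has_length pi_surj MI).
Local Notation exp2 := (two_pow pi_surj MI).
#[local] Hint Extern 1 (sigma1_def _ _ (fun r => G _)) => apply: Sig_G : defin.
#[local] Hint Extern 1 (sigma1_def _ _ (fun r => has_length _ _ _ _)) => apply: Sig_strlen : defin.
#[local] Hint Extern 1 (sigma1_def _ _ (fun r => _ = two_pow _ _ _)) => apply: Sig_two_pow : defin.

Lemma G_len_pre m n u v : G u -> G v -> strlen v n -> strlen u m -> n <=s m ->
  pre v u.
Proof.
move=> Gu Gv lv lu nm; have [h|[h|h]] := ltm_total n m.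
- apply: (branch_pre bG) => //; case: lv => _ h1; case: lu => h2 _.
  have h3 : exp2 (n +s 1s) <=s exp2 m by apply: two_pow_le; mlra.
  by rewrite two_powS in h3; zify_m; lra.
- rewrite h in lv; rewrite (G_len_uniq bG Gu Gv lu lv).
  exact: pre_refl.
- by exfalso; mlra.
Qed.

(* For the path with binary digits d_0, d_1, ... this is the real 1.d_0 d_1 ...
   in [1, 2], whose [i]-th approximation is [(u + 1) / 2^i], [u] the code of the
   first [i] digits. *)
Definition real_term i c : Prop := exists u p, ((G u /\ strlen u i) /\
  p +s 1s = exp2 i) /\ c = qcode (dyad u p).

Definition real_set m : Prop := exists i c, m = pairm i c /\ real_term i c.

Lemma real_term_uniq i c c' : real_term i c -> real_term i c' -> c = c'.
Proof.
move=> [u [p [[[Gu lu] hp] ->]]] [u' [p' [[[Gu' lu'] hp'] ->]]].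
rewrite (G_len_uniq bG Gu Gu' lu lu').
by rewrite -hp in hp'; rewrite (addmI hp').
Qed.

Lemma real_term_ex i : exists u p, ((G u /\ strlen u i) /\ p +s 1s = exp2 i).
Proof.
have [u hu] := G_len pi_surj MR bG i; exists u.
have [e|[p pE]] := zero_or_S (exp2 i); last by exists p.
by have := two_pow_gt0 pi_surj MI i; rewrite e => /ltm_irr.
Qed.

Lemma real_set_inM : inM s real_set.
Proof.
apply: (graph_inM pi_surj MR (phi := real_term)).
- by rewrite /real_term /qcode /pairm /dyad /=; ddef.
- by move=> i; have [u [p h]] := real_term_ex i; exists (qcode (dyad u p)), u, p.
- exact: real_term_uniq.
Qed.

Lemma real_setE i q : mseq_of real_set i q <-> exists u p,
  ((G u /\ strlen u i) /\ p +s 1s = exp2 i) /\ q = dyad u p.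
Proof.
split=> [[i' [c [/pairm_inj[<- <-] [u [p [h e]]]]]]|[u [p [h ->]]]].
  by exists u, p; split=> //; apply: qcode_inj.
by exists i, (qcode (dyad u p)); split=> //; exists u, p.
Qed.

Lemma real_set_seq : mrational_seq real_set.
Proof.
split.
  move=> m [i [c [-> [u [p [_ ->]]]]]].
  by exists i, (u +s 1s), 0s, p.
move=> i; have [u [p h]] := real_term_ex i.
exists (u +s 1s), 0s, p => a b c; split.
  move=> /real_setE [u' [p' [h' ->]]].
  by apply: (@real_term_uniq i); [exists u', p'|exists u, p].
by move=> /qcode_inj ->; apply/real_setE; exists u, p.
Qed.

Lemma real_set_cauchy : mcauchy (mseq_of real_set).
Proof.
(* The tolerance (a - b)/(c + 1) is at least 1/(c + 1). From index c + 1 on, all approximations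
   share c + 1 digits and differ by less than 2^-(c + 1), which is smaller. *)
move=> a b c; rewrite /qlt /qden /= => ab; exists (c +s 1s).
move=> m n [/le_or cm /le_or cn] qa qb qc ra rb rc.
move=> [/real_setE [u [p [[[Gu lu] hp] qE]]] /real_setE [u' [p' [[[Gu' lu'] hp'] rE]]]].
have [v [Gv lv]] := G_len pi_surj MR bG (c +s 1s).
have hV := @pow2_two_pow _ _ pi_surj _ MI (c +s 1s).
have [d [r [d0 rd uE pE]]] := pre_level hV lv (@pow2_two_pow _ _ pi_surj _ MI m) lu
  (G_len_pre Gu Gv lv lu cm).
have [d' [r' [d0' rd' uE' pE']]] := pre_level hV lv (@pow2_two_pow _ _ pi_surj _ MI n) lu'
  (G_len_pre Gu' Gv lv lu' cn).
have cV := two_pow_gt pi_surj MI (c +s 1s).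
move: (exp2 (c +s 1s)) hV pE pE' cV {lv} => V hV pE pE' cV.
rewrite qE rE {qE rE} /qdist /qlt /qadd /qopp /qden /dyad /=.
rewrite -hp in pE; rewrite -hp' in pE'.
zify_m.
have V0 : 0 < zi V by lra.
have d0Z : 0 < zi d by lra.
have d0Z' : 0 < zi d' by lra.
have rdZ : zi r < zi d by lra.
have rdZ' : zi r' < zi d' by lra.
have c0 : 0 < zi c + 1 by lra.
have cVZ : zi c + 1 <= zi V by lra.
have e1 : 1 <= zi a - zi b by lra.
have H1 := dyadic_close V0 d0Z d0Z' (zi_ge0 r') rdZ uE uE' c0 cVZ e1.
have H2 := dyadic_close V0 d0Z' d0Z (zi_ge0 r) rdZ' uE' uE c0 cVZ e1.
rewrite -pE -pE' in H1 H2.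
by split; apply/zi_ltP; rewrite !(ziD, ziM, zi0, zi1); lra.
Qed.

Lemma branch_real F : mrational_dblseq F ->
  (forall k, exists2 w, avoids F (pi k) w & G w) ->
  exists Y, inM s Y /\ ((mrational_seq Y /\ mcauchy (mseq_of Y)) /\
    forall n, ~ (mrealle (mrow F n) (mseq_of Y) /\ mrealle (mseq_of Y) (mrow F n))).
Proof.
move=> hF hG; exists real_set; split; first exact: real_set_inM.
split; first by split; [exact: real_set_seq|exact: real_set_cauchy].
move=> n [le1 le2]; have [k kn] := pi_surj n.
have [w [e [N h]] Gw] := hG k; rewrite kn in h.
have e0 : qlt (MQ 0s 0s 0s) (MQ 1s 0s e) by rewrite /qlt /qden /=; mlra.
have [N1 h1] := le1 1s 0s e e0; have [N2 h2] := le2 1s 0s e e0.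
(* The index also exceeds [w], so that the string of length m, having a code of at least 2^m - 1 >=
   m, extends [w]. *)
have [m [Nm N1m [N2m wm]]] : exists m,
    [/\ N <=s m, N1 <=s m & N2 <=s m /\ w <=s m].
  exists (N +s N1 +s N2 +s w).
  by split; [| |split]; zify_m; lra.
have [[qa qb qc] hq] := row_total n m hF.
have [u [p [[Gu lu] hp]]] := real_term_ex m.
have hY : mseq_of real_set m (dyad u p) by apply/real_setE; exists u, p.
have wu : pre w u.
  apply: (branch_pre bG) => //.
  have /alt_ziP h3 := two_pow_gt pi_surj MI m; have /nalt_ziP h4 := lu.1.
  by rewrite ziD zi1 in h4; lra.
have hp2 : pow2 (p +s 1s) by rewrite hp; apply: pow2_two_pow.
have lp : at_level (p +s 1s) (u +s 1s) by rewrite hp.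
case: h => h.
  apply: (h m _ u p Nm hq wu hp2 lp).
  by apply: (h2 m _ (u +s 1s) 0s p qa qb qc (conj hY hq)); apply/le_or.
apply: (h m _ u p Nm hq wu hp2 lp).
by apply: (h1 m _ qa qb qc (u +s 1s) 0s p (conj hq hY)); apply/le_or.
Qed.

End Reals.

(** * Conservativity *)

Lemma basic_nth i : (i < 8)%N -> nth fbot basic_axioms i \in basic_axioms.
Proof. by move=> h; apply: mem_nth. Qed.

Lemma basicP (M : arith) C (r : nat -> M) s :
  (forall B, B \in basic_axioms -> sat C B r s) <-> Basic M.
Proof.
split=> [h|[h0 h1 h2 h3 h4 h5 h6 h7] B].
  have H i : (i < 8)%N -> satx C (nth fbot basic_axioms i) r s.
    by move=> /basic_nth /h; rewrite satxE.
  split.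
  - exact: (H 0%N erefl).
  - exact: (H 1%N erefl).
  - exact: (H 2%N erefl).
  - exact: (H 3%N erefl).
  - exact: (H 4%N erefl).
  - exact: (H 5%N erefl).
  - exact: (H 6%N erefl).
  - exact: (H 7%N erefl).
move=> /(nthP fbot) [i]; rewrite [size _]/= => hi <-; rewrite satxE.
by case: i hi => [|[|[|[|[|[|[|[|i]]]]]]]] // _.
Qed.

Lemma closure_ex A : exists C, universal_closure A C.
Proof. by have [k kA] := fbound_ex A; exists (iter k fallN (iter k fallS A)), k, k. Qed.

Lemma fbound_iter k l A : fbound 0 0 (iter k fallN (iter l fallS A)) = fbound k l A.
Proof.
have HN : forall k' l' B, fbound k' l' (iter k fallN B) = fbound (k + k') l' B.
  by elim: k => //= k IH k' l' B; rewrite IH addnS.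
have HS : forall k' l' B, fbound k' l' (iter l fallS B) = fbound k' (l + l') B.
  by elim: l => //= l IH k' l' B; rewrite IH addnS.
by rewrite HN HS !addn0.
Qed.

Lemma RCA0_sentence B : RCA0 B -> sentence B.
Proof.
case=> [C|A C _|A D C _ _]; last 2 first.
- by move=> [k [l [b ->]]]; rewrite /sentence fbound_iter.
- by move=> [k [l [b ->]]]; rewrite /sentence fbound_iter.
move=> /(nthP fbot) [i]; rewrite [size _]/= => hi <-.
by case: i hi => [|[|[|[|[|[|[|[|i]]]]]]]].
Qed.

Section RCA0Schemes.
Variable M : arith.
Variable C : (M -> Prop) -> Prop.
Implicit Types (r : nat -> M) (s : nat -> M -> Prop).

Lemma sat_fexN A r s : delta00 A ->
  sat C (fexN A) r s <-> exists w, sat0 A (scons w r) s.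
Proof.
move=> dA; rewrite /fexN /fnot /= fex_prop.
by split=> -[w h]; exists w; move: h; rewrite delta00_sat.
Qed.

Lemma sat_induction A r s : delta00 A ->
  sat C (induction_form (fexN A)) r s <->
  let P n := exists w, sat0 A (scons w (scons n r)) s in
  (P (az M) -> (forall n, P n -> P (aad n (ao M))) -> forall n, P n).
Proof.
move=> dA.
have PE n : sat C (fexN A) (scons n r) s <-> exists w, sat0 A (scons w (scons n r)) s.
  exact: sat_fexN.
have E : sat C (induction_form (fexN A)) r s =
  (sat C (instN tzero (fexN A)) r s /\
   (forall n, sat C (fexN A) (scons n r) s -> sat C (succ_inst (fexN A)) (scons n r) s) ->
   forall n, sat C (fexN A) (scons n r) s).
  by rewrite /induction_form -(fand_prop (sat C (instN tzero (fexN A)) r s)).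
have SE n : sat C (succ_inst (fexN A)) (scons n r) s <->
    exists w, sat0 A (scons w (scons (aad n (ao M)) r)) s.
  rewrite -PE /succ_inst sat_subst.
  by rewrite (_ : eval _ \o _ = scons (aad n (ao M)) r) //; apply/funext => -[].
have ZE : sat C (instN tzero (fexN A)) r s <->
    exists w, sat0 A (scons w (scons (az M) r)) s.
  by rewrite sat_instN; apply: PE.
rewrite E; split=> [h /= h0 hS n|/= h [/ZE h0 hS] n].
  apply: (PE n).1; apply: h; split=> [|m hm]; first by apply: ZE.2.
  by apply: (SE m).2; apply: hS; apply: (PE m).1.
apply: (PE n).2; apply: h => // m hm.
by apply: (SE m).1; apply: hS; apply: (PE m).2.
Qed.

Lemma sat_comprehension A B r s : delta00 A -> delta00 B ->
  sat C (comprehension_form (fexN A) (fallN B)) r s <->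
  let P n := exists w, sat0 A (scons w (scons n r)) s in
  ((forall n, P n <-> forall w, sat0 B (scons w (scons n r)) s) -> C P).
Proof.
move=> dA dB.
have PE n : sat C (fexN A) (scons n r) s <-> exists w, sat0 A (scons w (scons n r)) s.
  exact: sat_fexN.
have QE n : sat C (fallN B) (scons n r) s <-> forall w, sat0 B (scons w (scons n r)) s.
  by rewrite /=; split=> h w; have := h w; rewrite delta00_sat.
have E1 : sat C (fallN (fiff (fexN A) (fallN B))) r s <->
    forall n, (exists w, sat0 A (scons w (scons n r)) s) <->
              forall w, sat0 B (scons w (scons n r)) s.
  rewrite -[sat _ _ _ _]/(forall n, sat C (fiff (fexN A) (fallN B)) (scons n r) s).
  have E n : sat C (fiff (fexN A) (fallN B)) (scons n r) s =
    ((sat C (fexN A) (scons n r) s -> sat C (fallN B) (scons n r) s) /\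
     (sat C (fallN B) (scons n r) s -> sat C (fexN A) (scons n r) s)).
    exact: (fand_prop (sat C (fexN A) (scons n r) s -> _)).
  split=> h n.
    by have := h n; rewrite E => -[h1 h2]; split=> [/PE/h1/QE|/QE/h2/PE].
  by rewrite E; have [h1 h2] := h n; split=> [/PE/h1/QE|/QE/h2/PE].
pose A' := fiff (fin (tvar 0) 0) (shiftS (fexN A)).
have E2 : sat C (fexS (fallN A')) r s <->
    exists X, C X /\ forall n, X n <-> exists w, sat0 A (scons w (scons n r)) s.
  have -> : sat C (fexS (fallN A')) r s =
      exists X, C X /\ forall n, sat C A' (scons n r) (scons X s).
    exact: (fexS_prop C (fun X => forall n, sat C A' (scons n r) (scons X s))).
  have E X n : sat C A' (scons n r) (scons X s) <->
      (X n <-> exists w, sat0 A (scons w (scons n r)) s).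
    have -> : sat C A' (scons n r) (scons X s) =
      ((X n -> sat C (shiftS (fexN A)) (scons n r) (scons X s)) /\
       (sat C (shiftS (fexN A)) (scons n r) (scons X s) -> X n)).
      exact: (fand_prop (X n -> sat C (shiftS (fexN A)) (scons n r) (scons X s))).
    have -> : sat C (shiftS (fexN A)) (scons n r) (scons X s) =
              sat C (fexN A) (scons n r) s by rewrite /shiftS sat_subst.
    by rewrite -PE.
  by split=> -[X [CX h]]; exists X; split=> // n; apply/E.
rewrite -[sat _ _ _ _]/(sat C (fallN (fiff (fexN A) (fallN B))) r s ->
   sat C (fexS (fallN A')) r s) E1 E2.
split=> /= h hyp; have := h hyp.
  case=> X [CX XE]; rewrite (_ : (fun _ => _) = X) //.
  by apply/funext => n; apply: propext; apply: iff_sym.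
by move=> CP; exists (fun n => exists w, sat0 A (scons w (scons n r)) s).
Qed.
End RCA0Schemes.

Definition range (M : arith) (s : nat -> M -> Prop) (P : M -> Prop) : Prop :=
  exists k, s k = P.

(** The universal closures of the axioms are instantiated at the valuation enumerating the whole
    model, which turns every parameter into a free variable of the formula. *)
Lemma RCA0_model (M : arith) (pi r : nat -> M) s :
  (forall x, exists k, pi k = x) ->
  (forall B, RCA0 B -> sat (range s) B r s) -> Basic M /\ RCAm pi s.
Proof.
move=> pi_surj h; have Cs X : range s (s X) by exists X.
have MB : Basic M.
  by apply/(basicP (range s) r s) => B hB; apply: h; apply: RCA0_basic.
split=> //; split.
  move=> P /Sig_rawE [B [dB PB]] P0 PS.
  have [C0 hC] := closure_ex (induction_form (fexN B)).
  have /h : RCA0 C0 by apply: RCA0_induction hC; exists B.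
  move/(sat_closure _ Cs hC)/(_ (mix pi (fun=> az M)) s Cs)/(sat_induction _ _ _ dB).
  move=> /= H n; apply/PB; apply: H; first exact/PB.
  by move=> m /PB /PS /PB.
move=> P /Sig_rawE [B [dB PB]] nP.
have [D [dD PD]] := Sig_rawE (P := fun x => ~ P x) nP.
have dD' : delta00 (fnot D) by apply: delta00_imp => //; apply: delta00_bot.
have [C0 hC] := closure_ex (comprehension_form (fexN B) (fallN (fnot D))).
have /h : RCA0 C0.
  by apply: RCA0_comprehension hC; [exists B|exists (fnot D)].
move/(sat_closure _ Cs hC)/(_ (mix pi (fun=> az M)) s Cs).
move/(sat_comprehension _ _ _ dB dD') => /= [|k kE].
  move=> n; rewrite -PB; split=> [Pn w hw|H].
    by apply: (PD n).2 Pn; exists w.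
  by apply: contrapT => /PD [w hw]; apply: (H w).
exists k; rewrite kE; apply/funext => n; apply: propext.
by apply: iff_sym; apply: PB.
Qed.

Lemma model_RCA0 (S : dsr) (pi : nat -> S) s r :
  (forall x, exists k, pi k = x) -> Basic S -> RCAm pi s ->
  forall B, RCA0 B -> sat (range s) B r s.
Proof.
move=> pi_surj MB [MI MC] B; have Cs X : range s (s X) by exists X.
case=> [C0|A C0 [D dD ->] hC|A D C0 [A1 dA ->] [D1 dD ->] hC].
- by move=> hC; apply: (basicP (range s) r s).2.
- apply/(sat_closure _ Cs hC) => r' s' Cs'; apply/sat_induction => //=.
  apply: MI; apply: (Sig_rename (s := s')) => //.
  exact: Sig_raw.
- apply/(sat_closure _ Cs hC) => r' s' Cs'; apply/sat_comprehension => //=.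
  move=> h; apply: MC.
    by apply: (Sig_rename (s := s')) => //; apply: Sig_raw.
  have dD' : delta00 (fnot D1) by apply: delta00_imp => //; apply: delta00_bot.
  apply: Sig_ext (Sig_rename Cs' (Sig_raw pi_surj s' r' dD')) => x.
  rewrite h; split=> [[w hw] /(_ w)//|H].
  by apply: contrapT => n; apply: H => w; apply: contrapT => nw; apply: n; exists w.
Qed.

Lemma sat_arithmetical (M : arith) C C' B (r : nat -> M) s : arithmetical B ->
  sat C B r s = sat C' B r s.
Proof.
elim: B r s => //= [A IHA B IHB r s /andP[a b]|A IHA r s a].
  by rewrite (IHA _ _ a) (IHB _ _ b).
by apply: eq_forall => n; apply: IHA.
Qed.

(** Removing sets from a model only weakens universal set quantifiers, and the arithmetical matrix
    does not see the class of sets. *)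
Lemma sat_pi11 (M : arith) (C C' : (M -> Prop) -> Prop) A (r : nat -> M) s :
  pi11 A -> (forall P, C P -> C' P) -> sat C' A r s -> sat C A r s.
Proof.
move=> [l [B [aB ->]]] CC' /sat_iter_fallS h; apply/sat_iter_fallS => v Cv.
rewrite (sat_arithmetical C C') //; apply: h => X /Cv; exact: CC'.
Qed.

Lemma treated_wkl (S : dsr) (pi : nat -> S) s D :
  (forall x, exists k, pi k = x) -> RCAm pi s ->
  (forall P, inM s P -> treated D s P) -> wkl_sem (inM s).
Proof.
move=> pi_surj MR hT T MT [h1 h2].
have tT : tree T by move=> u t Tu tu; apply: (h1 u t); split.
have [G [bG GT MG]] := (hT T MT).1 tT h2.
exact: (branch_wkl pi_surj MR bG MG GT).
Qed.

Definition real_req (S : dsr) (pi : nat -> S) (F : S -> Prop) (k : nat) (w : S) :=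
  avoids F (pi k) w.

Lemma treated_reals (S : dsr) (pi : nat -> S) s :
  (forall x, exists k, pi k = x) -> RCAm pi s ->
  (forall P, inM s P -> treated (real_req pi) s P) -> reals_sem (inM s).
Proof.
move=> pi_surj MR hT F MF [hF hC].
have [|G [bG MG hG]] := (hT F MF).2.
  by move=> k v; apply: (avoids_dense pi_surj MR).
exact: (branch_real pi_surj MR bG MG hF hG).
Qed.

Theorem proposition2p11 (A : form) (hsent : sentence A) (hpi11 : pi11 A) :
  provable RCA0_WKL_unc A -> provable RCA0 A.
Proof.
move=> [G [hG dA]]; apply: contrapT => nA.
have [M [pi [r [s [pi_surj hs nsA]]]]] := completeness RCA0_sentence nA.
have [MB MR] := RCA0_model pi_surj hs.
pose S := dsr_of pi_surj MB MR.1.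
have [s' [MR' ss hT]] := @model_ext S pi pi_surj (@real_req S pi) s MR.
(* Truth of [A] in the extension would descend to the smaller model, where [A] fails; so it suffices
   to verify the axioms used in the derivation in the extension. *)
apply: nsA; apply: (sat_pi11 (C' := range s') hpi11) => [P|].
  by move=> [k <-]; apply: ss.
rewrite (@sat_bound M _ 0 0 A r r s s') //.
apply: (soundness dA) => [X|B /hG]; first by exists X.
case=> [|[->|->]].
- exact: (@model_RCA0 S pi s' r pi_surj MB MR').
- by rewrite satxE wkl_semE; apply: (@treated_wkl S pi s' _ pi_surj MR' hT).
- by rewrite satxE reals_semE; apply: (@treated_reals S pi s' pi_surj MR' hT).
Qed.
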